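(* Let $T>0$, $c_0>0$, let $V,g:\mathbb{R}\to\mathbb{R}$ be twice differentiable with $\sup_{z\in\mathbb{R}}(|V'(z)|+|V''(z)|)<\infty$ and $\sup_{z\in\mathbb{R}}(|g'(z)|+|g''(z)|)<\infty$, and let $\rho_0$ be (the density of) a compactly supported probability measure on $\mathbb{R}$ that is absolutely continuous with respect to Lebesgue measure. Then the functional $$J[\omega]=\int_{\mathbb{R}}\phi_\omega(x)\rho_0(x)\,dx,\qquad\omega\in L^2(0,T),$$ is everywhere finite and concave on $L^2(0,T)$, and there exist constants $C_1,C_2>0$ depending only on the problem data $(c_0,V,g,T,\rho_0)$ such that $$J[\omega]\le C_1-C_2\|\omega\|_2^2\qquad\forall\,\omega\in L^2(0,T).$$ Furthermore, $J$ is Fréchet differentiable at every $\omega\in L^2(0,T)$, with Fréchet derivative (identified with an element of $L^2(0,T)$ through the $L^2$ inner product) $$\delta J[\omega](t)=\int_{\mathbb{R}}\dot z^*_\omega(t,x)\rho_0(x)\,dx,\qquad\text{for a.e. }t\in(0,T),$$ where $z^*_\omega$ is a Borel measurable selection of minimizing trajectories.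
   Context: $\|\cdot\|_2$ is the norm of $L^2(0,T)$. For $\omega\in L^2(0,T)$ and $x\in\mathbb{R}$ define $$\phi_\omega(x)=\inf\left\{\int_0^T\left[\tfrac{c_0}{2}\dot z(t)^2+\dot z(t)\omega(t)+V(z(t))\right]dt+g(z(T))\;:\;z\in H^1(0,T),\ z(0)=x\right\},\qquad(\ast)$$ where $H^1(0,T)$ functions are identified with their continuous representatives on $[0,T]$. Under the stated assumptions on $V,g$, problem $(\ast)$ has a minimizer for every $x$, unique for Lebesgue-a.e. $x$. A Borel measurable selection of minimizing trajectories is a Borel measurable map $(t,x)\mapsto z^*_\omega(t,x)$ on $[0,T]\times\mathbb{R}$ such that for every $x\in\mathbb{R}$ the function $z^*_\omega(\cdot,x)$ is a minimizer of $(\ast)$; such selections exist. $\dot z^*_\omega(t,x)$ denotes the derivative in $t$, defined for a.e. $t$. *)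

(* Defs.v *)
From HB Require Import structures.
From mathcomp Require Import all_boot all_order all_algebra.
From mathcomp Require Import all_classical all_reals all_analysis.

Set Implicit Arguments.
Unset Strict Implicit.
Unset Printing Implicit Defensive.
Import Order.TTheory GRing.Theory Num.Theory.
Import numFieldNormedType.Exports.

Local Open Scope classical_set_scope.
Local Open Scope ring_scope.

Section Definitions.
Context {R : realType}.
Notation mu := (@lebesgue_measure R).
Implicit Types (T c : R) (V g rho w z u psi : R -> R).

(* L^2(0,T) is seen inside L^2(R) through extension by zero, so that only the
   values on ]0, T[ of the representative w matter. *)
Definition L2 T w : Prop := (w \_ `]0, T[) \in Lfun mu 2%:E.

Definition norm2 T w : R := fine ('N[mu]_2 [EFin \o (w \_ `]0, T[)%R])%E.

(* C^1 functions with compact support in the open interval ]0, T[ *)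
Definition test_function T psi : Prop :=
  [/\ forall t, derivable psi t 1,
      continuous (derive1 psi) &
      exists a b : R, [/\ 0 < a, b < T &
        forall t, t \notin `[a, b] -> psi t = 0]].

Definition weak_derivative T z u : Prop :=
  forall psi, test_function T psi ->
    \int[mu]_(t in `]0, T[) (z t * derive1 psi t) =
    - \int[mu]_(t in `]0, T[) (u t * psi t).

(* z is the continuous representative, on [0, T], of an element of H^1(0,T) *)
Definition H1 T z : Prop :=
  [/\ {within `[0, T], continuous z}, L2 T z &
      exists u, L2 T u /\ weak_derivative T z u].

(* The continuous representative of an element of H^1(0,T) is differentiable
   almost everywhere on ]0, T[, with derive1 z equal a.e. to its weak derivative. *)
Definition action T c V g w z : R :=
  \int[mu]_(t in `]0, T[)
     (c / 2 * derive1 z t ^+ 2 + derive1 z t * w t + V (z t)) + g (z T).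

Definition admissible T (x : R) : set (R -> R) :=
  [set z | H1 T z /\ z 0 = x].

Definition phi T c V g w (x : R) : \bar R :=
  ereal_inf [set (action T c V g w z)%:E | z in admissible T x].

Definition J T c V g rho w : \bar R :=
  (\int[mu]_x (phi T c V g w x * (rho x)%:E))%E.

Definition minimizer T c V g w (x : R) z : Prop :=
  admissible T x z /\ (action T c V g w z)%:E = phi T c V g w x.

Definition borel_selection T c V g w (zs : R -> R -> R) : Prop :=
  measurable_fun (`[0, T] `*` [set: R]) (fun p : R * R => zs p.1 p.2) /\
  forall x, minimizer T c V g w x (zs^~ x).

Definition twice_differentiable_bounded (f : R -> R) : Prop :=
  (forall x, derivable f x 1 /\ derivable (derive1 f) x 1) /\
  exists M : R, forall x, `|derive1 f x| + `|derive1n 2 f x| <= M.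

Definition compactly_supported_density rho : Prop :=
  [/\ measurable_fun [set: R] rho,
      forall x, 0 <= rho x,
      (\int[mu]_x (rho x)%:E = 1)%E &
      exists K : set R, compact K /\ {ae mu, forall x, ~ K x -> rho x = 0}].

(* d is the L^2 gradient at w: the Frechet derivative of F at w is the
   continuous linear form h |-> <d, h>. *)
Definition frechet_gradient T (F : (R -> R) -> R) w (d : R -> R) : Prop :=
  L2 T d /\
  forall e : R, 0 < e -> exists2 r : R, 0 < r &
    forall h : R -> R, L2 T h -> norm2 T h < r ->
      `|F (w \+ h) - F w - \int[mu]_(t in `]0, T[) (d t * h t)|
        <= e * norm2 T h.

End Definitions.

(* Main.v *)
Require Import Defs.
From HB Require Import structures.
From mathcomp Require Import all_boot all_order all_algebra.
From mathcomp Require Import all_classical all_reals all_analysis.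
From mathcomp Require Import measurable_realfun ring lra.

(** A trajectory is written [z = x + prim u] with [u] in L^2(0,T). Minimising
    over a gradient step in [u] shows that along a minimising sequence [u] is
    L^2-close to [costate x u - w / c], where the costate is the backward primitive
    of [V' z] with terminal value [- g' (z T)], divided by [c]. By Gronwall, run
    backward from [T], such near-critical trajectories are controlled by their
    endpoint [z T] alone, so compactness of a real interval replaces weak
    compactness: minimisers exist and depend continuously on the data wherever they
    are unique. Minimisers starting from [x1 < x2] do not cross, since splicing them
    would give a minimiser from [x1] with the endpoint of the one from [x2], against
    backward determinacy; hence they are ordered by [x], which gives both
    Borel measurability of any selection and uniqueness off a countable set. Finally the value is an infimum of functions affine in [w], with
    superdifferential [u] at [w], so that J is concave and [h |-> E (ip u h)] is a
    supergradient; it is a Frechet derivative by stability of minimisers at points of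
    uniqueness and dominated convergence. The upper bound comes from the competitor
    [u = - w / c]. *)

Set Implicit Arguments.
Unset Strict Implicit.
Unset Printing Implicit Defensive.
Import Order.TTheory GRing.Theory Num.Theory.
Import numFieldNormedType.Exports.

Local Open Scope classical_set_scope.
Local Open Scope ring_scope.

(** No convexity of [V] or [g] is assumed, so one starting point may have several minimisers, and
    [w] is only square integrable, so a critical trajectory need not be C^1. Two facts tame this.
    Two trajectories driven by the same [w] have velocities whose difference no longer contains the
    rough term [w / c]: only residuals and costates remain, and costates depend on the paths in a
    Lipschitz way. Moreover the costate satisfies its condition at [T], so a critical trajectory is
    determined by its endpoint but not by its starting point. Non-uniqueness at [x] therefore shows
    as a nondegenerate interval of endpoints, and the ordering in [x] forbids two such intervals to
    overlap, so each can be labelled by its own rational. Measurability is the other obstacle.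
    Velocities are chosen separately for each [x], up to null sets of times, with no joint
    measurability in time and [x]. Averages over [x] are therefore taken of functions of the path.
    The same splitting of the velocity into a costate and [w / c] makes the null set of times in the
    gradient formula depend on [w] alone. *)

Section SmoothPotential.
Context {R : realType}.

(** All that is used of [V] and [g], whose values may be unbounded. The Taylor bound is one-sided
    because a descent step only needs an upper estimate. It has [M] instead of [M / 2] because it
    comes from the mean value theorem applied twice, the second derivative not being known to be
    continuous. *)
Definition smooth_bound (M : R) (f : R -> R) :=
  [/\ 0 <= M, forall x, `|derive1 f x| <= M,
      forall x y, `|f x - f y| <= M * `|x - y|,
      forall x y, `|derive1 f x - derive1 f y| <= M * `|x - y| &
      forall x h, f (x + h) <= f x + derive1 f x * h + M * h ^+ 2].

Lemma mvt_global (f : R -> R) : (forall x, derivable f x 1) ->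
  forall x y, exists2 c, `|c - x| <= `|y - x| & f y - f x = derive1 f c * (y - x).
Proof.
move=> df.
have H a b : a <= b -> exists2 c, a <= c <= b & f b - f a = derive1 f c * (b - a).
  move=> ab; have [||c] := @MVT_segment R f (derive1 f) a b ab.
  - move=> x _; rewrite derive1E; apply: DeriveDef => //.
  - apply: continuous_subspaceT => x.
    by apply/differentiable_continuous/derivable1_diffP; exact: df.
  - by rewrite in_itv /= => ? ?; exists c.
move=> x y; have [xy|/ltW yx] := leP x y.
  have [c /andP[xc cy] E] := H _ _ xy; exists c => //.
  by rewrite !ger0_norm ?subr_ge0 // lerD2r.
have [c /andP[xc cy] E] := H _ _ yx; exists c => //.
  by rewrite !ler0_norm ?subr_le0 // lerN2 lerD2r.
by rewrite -opprB E -mulrN opprB.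
Qed.

Lemma twice_differentiable_smooth (f : R -> R) :
  twice_differentiable_bounded f -> exists M, smooth_bound M f.
Proof.
case=> df [M HM]; exists M.
have M1 x : `|derive1 f x| <= M.
  by apply: le_trans (HM x); rewrite lerDl.
have M2 x : `|derive1 (derive1 f) x| <= M.
  by have := HM x; rewrite /= => H; apply: le_trans H; rewrite lerDr.
have M0 : 0 <= M by exact: le_trans (M1 0).
have Lf' x y : `|derive1 f x - derive1 f y| <= M * `|x - y|.
  have [|c _ ->] := @mvt_global (derive1 f) _ y x; first by move=> t; case: (df t).
  by rewrite normrM ler_wpM2r.
split=> // [x y|x h].
  have [|c _ ->] := @mvt_global f _ y x; first by move=> t; case: (df t).
  by rewrite normrM ler_wpM2r.
have [|c hc E] := @mvt_global f _ x (x + h); first by move=> t; case: (df t).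
move: hc E; rewrite addrAC subrr add0r => hc E.
have -> : f (x + h) = f x + derive1 f c * h by lra.
rewrite -addrA lerD2l -lerBlDl -mulrBl (le_trans (ler_norm _)) // normrM.
apply: le_trans (_ : (M * `|h|) * `|h| <= _).
  by rewrite ler_wpM2r // (le_trans (Lf' _ _)) // ler_wpM2l.
by rewrite -mulrA -expr2 real_normK // num_real.
Qed.

End SmoothPotential.

(** * Square integrable functions on ]0, T[ *)

Section SquareIntegrable.
Context {R : realType} (T : R) (T_gt0 : 0 < T).
Notation mu := (@lebesgue_measure R).
Notation D := (`]0, T[%classic : set (measurableTypeR R)).
Implicit Types (f g h : R -> R) (k K : R).

Definition intg (f : R -> R) := mu.-integrable D (EFin \o f).
Definition iD (f : R -> R) : R := \int[mu]_(t in D) f t.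
Definition sqint (f : R -> R) :=
  measurable_fun D f /\ intg (fun t => f t ^+ 2).
Definition ip (f g : R -> R) := iD (fun t => f t * g t).
(** Functions are not quotiented, so this is a seminorm, and equality in L^2 is expressed by a
    difference of zero norm. *)
Definition nrm (f : R -> R) := Num.sqrt (ip f f).

Lemma iDE f : iD f = \int[mu]_(t in D) f t. Proof. by []. Qed.

Lemma ipE f g : ip f g = iD (fun t => f t * g t). Proof. by []. Qed.

Lemma mD : measurable D. Proof. exact: measurable_itv. Qed.
Hint Resolve mD : core.

Lemma lebD : mu D = T%:E.
Proof. by rewrite lebesgue_measure_itv/= lte_fin T_gt0 -EFinD subr0. Qed.

Lemma intg_meas f : intg f -> measurable_fun D f.
Proof. by move=> /measurable_int /measurable_EFinP. Qed.

Lemma intg_bounded f K : measurable_fun D f -> (forall t, D t -> `|f t| <= K) -> intg f.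
Proof.
move=> mf fK; apply: measurable_bounded_integrable => //.
  by rewrite [X in (X < _)%E]lebD ltry.
exists K; split; first exact: num_real.
by move=> x Kx t Dt; apply: le_trans (fK t Dt) (ltW Kx).
Qed.

Lemma intg_cst k : intg (fun=> k).
Proof. exact: (@intg_bounded _ `|k|). Qed.

Lemma intg_le f g : measurable_fun D f -> (forall t, D t -> `|f t| <= g t) ->
  intg g -> intg f.
Proof.
move=> mf fg ig; apply: le_integrable ig => //; first exact/measurable_EFinP.
by move=> t Dt /=; rewrite lee_fin (le_trans (fg t Dt)) // ler_norm.
Qed.

Lemma intgD f g : intg f -> intg g -> intg (fun t => f t + g t).
Proof. by move=> f1 g1; exact: (integrableD mD f1 g1). Qed.

Lemma intgB f g : intg f -> intg g -> intg (fun t => f t - g t).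
Proof. by move=> f1 g1; exact: (integrableB mD f1 g1). Qed.

Lemma intgZ k f : intg f -> intg (fun t => k * f t).
Proof. by move=> f1; exact: (integrableZl mD k f1). Qed.

Lemma iDD f g : intg f -> intg g -> iD (fun t => f t + g t) = iD f + iD g.
Proof. by move=> *; exact: RintegralD. Qed.

Lemma iDB f g : intg f -> intg g -> iD (fun t => f t - g t) = iD f - iD g.
Proof. by move=> *; exact: RintegralB. Qed.

Lemma iDZ k f : intg f -> iD (fun t => k * f t) = k * iD f.
Proof. by move=> *; exact: RintegralZl. Qed.

Lemma iD_cst k : iD (fun=> k) = k * T.
Proof. by rewrite /iD Rintegral_cst //; congr (_ * _); rewrite -[RHS]/(fine T%:E) -lebD. Qed.

Lemma eq_iD f g : (forall t, D t -> f t = g t) -> iD f = iD g.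
Proof. by move=> fg; apply: eq_Rintegral => t; rewrite inE; exact: fg. Qed.

Lemma le_iD f g : intg f -> intg g -> (forall t, D t -> f t <= g t) -> iD f <= iD g.
Proof. by move=> *; apply: le_Rintegral. Qed.

Lemma iD_ge0 f : (forall t, D t -> 0 <= f t) -> 0 <= iD f.
Proof. exact: Rintegral_ge0. Qed.

Lemma norm_iD f : intg f -> `|iD f| <= iD (fun t => `|f t|).
Proof. by move=> fi; exact: le_normr_Rintegral. Qed.

Lemma intg_norm f : intg f -> intg (fun t => `|f t|).
Proof. by move=> fi; exact: integrable_norm. Qed.

Lemma norm_iD_le f K : measurable_fun D f -> (forall t, D t -> `|f t| <= K) ->
  `|iD f| <= K * T.
Proof.
move=> mf fK; have fi := intg_bounded mf fK.
apply: le_trans (norm_iD fi) _; rewrite -iD_cst.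
by apply: le_iD => //; [exact: intg_norm|exact: intg_cst].
Qed.

Lemma sqint_mul f g : sqint f -> sqint g -> intg (fun t => f t * g t).
Proof.
move=> [mf f2] [mg g2]; apply: (@intg_le _ (fun t => f t ^+ 2 + g t ^+ 2)).
- exact: measurable_funM.
- by move=> t _; rewrite ler_norml; apply/andP; split; nra.
- exact: intgD.
Qed.

Lemma sqintD f g : sqint f -> sqint g -> sqint (fun t => f t + g t).
Proof.
move=> sf sg; have fg := sqint_mul sf sg; case: sf sg => mf f2 [mg g2].
split; first exact: measurable_funD.
rewrite (_ : (fun t => _) = (fun t => f t ^+ 2 + (2 * (f t * g t) + g t ^+ 2))).
  by apply: intgD => //; apply: intgD => //; exact: intgZ.
by apply/funext => t; ring.
Qed.

Lemma sqintZ k f : sqint f -> sqint (fun t => k * f t).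
Proof.
move=> [mf f2]; split; first exact: measurable_funM.
rewrite (_ : (fun t => _) = (fun t => k ^+ 2 * f t ^+ 2)); first exact: intgZ.
by apply/funext => t; ring.
Qed.

Lemma sqintB f g : sqint f -> sqint g -> sqint (fun t => f t - g t).
Proof.
move=> sf sg; rewrite (_ : (fun t => _) = (fun t => f t + (-1) * g t)).
  by apply: sqintD => //; exact: sqintZ.
by apply/funext => t; ring.
Qed.

Lemma sqint_bounded f K : measurable_fun D f -> (forall t, D t -> `|f t| <= K) -> sqint f.
Proof.
move=> mf fK; split=> //; apply: (@intg_bounded _ (K ^+ 2)).
  exact: measurable_funX.
move=> t Dt; rewrite normrX ler_pXn2r ?fK // nnegrE //.
exact: le_trans (fK t Dt).
Qed.

Lemma sqint_cst k : sqint (fun=> k).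
Proof. exact: (@sqint_bounded _ `|k|). Qed.

Lemma sqint_intg f : sqint f -> intg f.
Proof.
move=> sf; have := sqint_mul sf (sqint_cst 1).
by under eq_fun do rewrite mulr1.
Qed.

Lemma ipC f g : ip f g = ip g f.
Proof. by apply: eq_iD => t _; rewrite mulrC. Qed.

Lemma ip_ge0 f : 0 <= ip f f.
Proof. by apply: iD_ge0 => t _; rewrite -expr2 sqr_ge0. Qed.

Lemma ipDl f g h : sqint f -> sqint g -> sqint h ->
  ip (fun t => f t + g t) h = ip f h + ip g h.
Proof.
move=> *; rewrite /ip -iDD; [|exact: sqint_mul..].
by apply: eq_iD => t _; rewrite mulrDl.
Qed.

Lemma ipBl f g h : sqint f -> sqint g -> sqint h ->
  ip (fun t => f t - g t) h = ip f h - ip g h.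
Proof.
move=> *; rewrite /ip -iDB; [|exact: sqint_mul..].
by apply: eq_iD => t _; rewrite mulrBl.
Qed.

Lemma ipZl k f h : sqint f -> sqint h ->
  ip (fun t => k * f t) h = k * ip f h.
Proof.
move=> *; rewrite /ip -iDZ; [|exact: sqint_mul..].
by apply: eq_iD => t _; rewrite mulrA.
Qed.

Lemma nrm_ge0 f : 0 <= nrm f. Proof. exact: sqrtr_ge0. Qed.

Lemma nrm_sqr f : nrm f ^+ 2 = ip f f.
Proof. by rewrite sqr_sqrtr // ip_ge0. Qed.

Lemma cauchy_schwarz f g : sqint f -> sqint g -> `|ip f g| <= nrm f * nrm g.
Proof.
move=> sf sg.
have key a b : 0 <= a ^+ 2 * ip f f + 2 * a * b * ip f g + b ^+ 2 * ip g g.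
  apply: le_trans (ip_ge0 (fun t => a * f t + b * g t)) _.
  have sa := sqintZ a sf; have sb := sqintZ b sg.
  rewrite ipDl //; last exact: sqintD.
  rewrite !ipZl //; [|exact: sqintD..].
  rewrite ![ip _ (fun t => _ + _)]ipC !ipDl // !ipZl // (ipC g f).
  by rewrite le_eqVlt; apply/orP; left; apply/eqP; ring.
have f0 := ip_ge0 f; have g0 := ip_ge0 g.
rewrite -ler_sqr ?nnegrE ?mulr_ge0 ?nrm_ge0 // exprMn !nrm_sqr real_normK ?num_real //.
move: f0 g0 key; set p := ip f g; set F := ip f f; set G := ip g g => f0 g0 key.
(* These choices give F (F G - p^2) >= 0 and G (F G - p^2) >= 0, which settle the cases F > 0 and G
   > 0. When both vanish, the pairs (1, 1) and (1, -1) force p = 0. *)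
have k1 := key p (- F); have k2 := key G (- p).
have [F0|F0] := eqVneq F 0; last first.
  have Fp : 0 < F by rewrite lt_neqAle eq_sym F0.
  rewrite -(ler_pM2l Fp); nra.
have [G0|G0] := eqVneq G 0; last first.
  have Gp : 0 < G by rewrite lt_neqAle eq_sym G0.
  rewrite -(ler_pM2l Gp); nra.
have k3 := key 1 1; have k4 := key 1 (-1); rewrite F0 G0 in k3 k4 *.
have -> : p = 0 by lra.
by rewrite expr0n /= mul0r.
Qed.

Lemma nrmD f g : sqint f -> sqint g -> nrm (fun t => f t + g t) <= nrm f + nrm g.
Proof.
move=> sf sg; rewrite -ler_sqr ?nnegrE ?addr_ge0 ?nrm_ge0 //.
rewrite nrm_sqr ipDl //; last exact: sqintD.
rewrite ![ip _ (fun t => _ + _)]ipC !ipDl // (ipC g f) sqrrD !nrm_sqr.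
have := cauchy_schwarz sf sg; have := ler_norm (ip f g); lra.
Qed.

Lemma nrmZ k f : sqint f -> nrm (fun t => k * f t) = `|k| * nrm f.
Proof.
move=> sf; have sk := sqintZ k sf.
rewrite /nrm ipZl // ipC ipZl // mulrA -expr2 sqrtrM ?sqr_ge0 //.
by rewrite sqrtr_sqr.
Qed.

Lemma nrmB f g : sqint f -> sqint g -> nrm (fun t => f t - g t) <= nrm f + nrm g.
Proof.
move=> sf sg.
have -> : (fun t => f t - g t) = (fun t => f t + -1 * g t).
  by apply/funext => t; rewrite mulN1r.
have := nrmD sf (sqintZ (-1) sg).
by rewrite nrmZ // normrN1 mul1r.
Qed.

Lemma eq_nrm f g : (forall t, D t -> f t = g t) -> nrm f = nrm g.
Proof. by move=> fg; rewrite /nrm /ip; congr Num.sqrt; apply: eq_iD => t /fg ->. Qed.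

Lemma nrm_bounded f K : measurable_fun D f -> (forall t, D t -> `|f t| <= K) ->
  nrm f <= K * Num.sqrt T.
Proof.
move=> mf fK.
have T2 : 0 < T / 2 < T by move: T_gt0; clear; lra.
have K0 : 0 <= K by apply: le_trans (fK (T / 2) _) => //; rewrite /= in_itv.
rewrite -ler_sqr ?nnegrE ?nrm_ge0 ?mulr_ge0 ?sqrtr_ge0 // nrm_sqr exprMn.
rewrite (sqr_sqrtr (ltW T_gt0)).
apply: le_trans (ler_norm _) _; apply: norm_iD_le; first exact: measurable_funM.
by move=> t Dt; rewrite normrM expr2 ler_pM // fK.
Qed.

End SquareIntegrable.

(** * Integrals of functions that agree almost everywhere *)

Section AeIntegral.
Context d (X : measurableType d) (R : realType).
Variable mu : {measure set X -> \bar R}.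
Local Open Scope ereal_scope.

Import HBNNSimple.

(** The integral of [f] is a supremum over simple functions below [f]. Each of them is a.e. below
    [g], which bounds it by the integral of [g]; conversely, simple functions below [g] off the null
    set are below [f]. This allows the integrand of [action], which contains [derive1 z], to be
    replaced without first being proved measurable. *)
Let ge0_ae_eq_integral_nonmeas (D : set X) (f g : X -> \bar R) :
  measurable D -> measurable_fun D g ->
  (forall x, D x -> 0 <= f x) -> (forall x, D x -> 0 <= g x) ->
  ae_eq mu D f g -> \int[mu]_(x in D) f x = \int[mu]_(x in D) g x.
Proof.
move=> mDD mg f0 g0 [N [mN N0 fgN]].
have gf x : D x -> ~ N x -> f x = g x.
  by move=> Dx Nx; apply: contrapT => h; apply: Nx; apply: fgN => /= /(_ Dx).
apply/eqP; rewrite eq_le; apply/andP; split.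
  rewrite ge0_integralE //; apply: ge_ereal_sup => /= _ [h hf <-].
  have -> : sintegral mu h = \int[mu]_x (h x)%:E.
    by rewrite integral_nnsfun // patch_setT.
  rewrite [leRHS]integral_mkcond; apply: ae_ge0_le_integral => //.
  - by move=> x _; rewrite lee_fin.
  - by apply/measurable_EFinP.
  - by move=> x _; rewrite patchE; case: ifPn => // /set_mem; exact: g0.
  - by apply/(measurable_restrictT _ _).1.
  exists N; split => // x /=; apply: contra_notP => Nx _.
  move: (hf x); rewrite !patchE; case: ifPn => // /set_mem Dx.
  by rewrite gf.
rewrite (ge0_negligible_integral mN) // [leRHS]ge0_integralE //.
rewrite ge0_integralE; last by move=> x [Dx _]; exact: g0.
apply: ereal_sup_le => _ [h hg <-]; exists h => // x.
apply: le_trans (hg x) _; rewrite !patchE.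
case: ifPn => [/set_mem[Dx Nx]|_]; first by rewrite mem_set // gf.
by case: ifPn => // /set_mem; exact: f0.
Qed.

(* Contrary to [ae_eq_integral], [f] is not assumed measurable. *)
Lemma ae_eq_integral_nonmeas (D : set X) (g f : X -> \bar R) :
  measurable D -> measurable_fun D g ->
  ae_eq mu D f g -> \int[mu]_(x in D) f x = \int[mu]_(x in D) g x.
Proof.
move=> mDD mg fg; have [fgp fgn] := (ae_eq_funeposneg mu D f g).1 fg.
rewrite integralE [in RHS]integralE; congr (_ - _);
  apply: ge0_ae_eq_integral_nonmeas => //; first exact: measurable_funepos.
exact: measurable_funeneg.
Qed.
End AeIntegral.

(** * Agreement with the L^2 norm of the extension by zero *)

Section L2Bridge.
Context {R : realType} (T : R) (T_gt0 : 0 < T).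
Notation mu := (@lebesgue_measure R).
Implicit Types (f g h u w : R -> R).

Lemma Lnorm2E w : sqint T w ->
  ('N[mu]_2%:E [EFin \o (w \_ `]0%R, T[)%R] = (nrm T w)%:E)%E.
Proof.
move=> [mw iw]; rewrite unlock /=.
have -> : (\int[mu]_x `|((w \_ `]0%R, T[)%R x)%:E| `^ 2 = (iD T (fun t => w t * w t))%:E)%E.
  rewrite /iD /Rintegral fineK; last first.
    apply: integrable_fin_num; first exact: mD.
    by apply: eq_integrable iw => // t _ /=; rewrite expr2.
  rewrite [RHS]integral_mkcond; apply: eq_integral => x _.
  rewrite !patchE; case: ifPn => _.
    by rewrite abse_EFin poweR_EFin powR_mulrn // -expr2 real_normK // num_real.
  by rewrite abse_EFin normr0 poweR_EFin powR0.
by rewrite poweR_EFin /nrm -powR12_sqrt // ip_ge0.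
Qed.

Lemma L2_sqint w : L2 T w <-> sqint T w.
Proof.
split=> [Lw|sw].
  have := Lfun2_integrable_sqr Lw; move: Lw; rewrite /L2 inE => /andP[/[!inE] /= mw _] iw.
  split; first by apply/(measurable_restrictT _ _).2 => //; exact: mD.
  apply: (integrable_mkcond _ (mD T)).2.
  apply: eq_integrable iw => // x _ /=; rewrite !patchE; case: ifPn => // _.
  by rewrite expr0n.
rewrite /L2 inE; apply/andP; split; rewrite inE /=.
  by apply/(measurable_restrictT _ _).1; [exact: mD|case: sw].
by rewrite /finite_norm Lnorm2E // ltry.
Qed.

Lemma norm2_nrm w : sqint T w -> norm2 T w = nrm T w.
Proof. by move=> sw; rewrite /norm2 Lnorm2E. Qed.

End L2Bridge.

(** * Primitives: regularity, differentiation, Fubini and adjointness *)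

Section Primitive.
Context {R : realType} (T : R) (T_gt0 : 0 < T).
Notation mu := (@lebesgue_measure R).
Notation D := (`]0, T[%classic : set (measurableTypeR R)).
Implicit Types (f g u w : R -> R) (s t k K : R).

Lemma measurable_EFin_comp (A : set (measurableTypeR R)) f :
  measurable_fun A f -> measurable_fun A (fun t => (f t)%:E).
Proof. by move=> mf; exact/measurable_EFinP. Qed.

Definition before (t s : R) : R := (s < t)%R%:R.
Definition after (t s : R) : R := (t < s)%R%:R.
(** Pairing with an indicator turns linearity, bounds and changes of order of integration into facts
    about [ip]. It also defines a function on the whole line, constant outside [0, T], so continuity
    needs no endpoint cases. *)
Definition prim u t := ip T u (before t).
Definition tail u t := ip T u (after t).

Lemma prim_ip u t : prim u t = ip T u (before t). Proof. by []. Qed.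

Lemma tail_ip u t : tail u t = ip T u (after t). Proof. by []. Qed.

Lemma measurableT_before t : measurable_fun [set: measurableTypeR R] (before t).
Proof.
have -> : before t = \1_(`]-oo, t[%classic : set (measurableTypeR R)).
  by apply/funext => s; rewrite /before indicE; congr (nat_of_bool _)%:R;
    apply/idP/idP; rewrite inE /= in_itv.
exact: measurable_indic.
Qed.

Lemma measurableT_after t : measurable_fun [set: measurableTypeR R] (after t).
Proof.
have -> : after t = \1_(`]t, +oo[%classic : set (measurableTypeR R)).
  by apply/funext => s; rewrite /after indicE; congr (nat_of_bool _)%:R;
    apply/idP/idP; rewrite inE /= in_itv /= andbT.
exact: measurable_indic.
Qed.

Lemma measurable_before t : measurable_fun D (before t).
Proof. by apply: measurable_funTS; exact: measurableT_before. Qed.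

Lemma measurable_after t : measurable_fun D (after t).
Proof. by apply: measurable_funTS; exact: measurableT_after. Qed.

Lemma before_le1 t s : `|before t s| <= 1.
Proof. by rewrite /before; case: (s < t); rewrite ?normr1 ?normr0. Qed.

Lemma after_le1 t s : `|after t s| <= 1.
Proof. by rewrite /after; case: (t < s); rewrite ?normr1 ?normr0. Qed.

Lemma sqint_before t : sqint T (before t).
Proof. by apply: sqint_bounded => //; [exact: measurable_before|move=> s _; exact: before_le1]. Qed.

Lemma sqint_after t : sqint T (after t).
Proof. by apply: sqint_bounded => //; [exact: measurable_after|move=> s _; exact: after_le1]. Qed.

Lemma itv_before s t r : s <= t ->
  before t r - before s r = \1_(`[s, t[%classic : set R) r.
Proof.
move=> st; rewrite /before indicE.
have -> : (r \in (`[s, t[%classic : set R)) = (s <= r < t).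
  by apply/idP/idP; rewrite inE /= in_itv.
case: (ltP r s) => rs /=; first by rewrite (lt_le_trans rs st) subrr.
by rewrite subr0.
Qed.

Lemma sqint_beforeB s t : sqint T (fun r => before t r - before s r).
Proof. by apply: sqintB; exact: sqint_before. Qed.

Lemma iD_beforeB_le s t : iD T (fun r => `|before t r - before s r|) <= `|t - s|.
Proof.
have W a b : a <= b -> iD T (fun r => `|before b r - before a r|) <= b - a.
  move=> ab; under eq_iD do rewrite itv_before //.
  rewrite (@eq_iD _ _ _ \1_(`[a, b[%classic : set (measurableTypeR R))); last first.
    by move=> r _; rewrite ger0_norm // indicE; case: (_ \in _).
  rewrite /iD /Rintegral integral_indic; [|exact: mD|exact: measurable_itv].
  have lab : mu `[a, b[%classic = (b - a)%:E.
    rewrite lebesgue_measure_itv /= lte_fin; case: ltP => ba; first by rewrite EFinB.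
    by congr (_%:E); apply/eqP; rewrite eq_sym subr_eq0 eq_le ab ba.
  have H : (mu (`[a, b[%classic `&` `]0%R, T[%classic) <= (b - a)%:E)%E.
    rewrite -lab; apply: le_measure; rewrite ?inE; [|exact: measurable_itv|exact: subIsetl].
    by apply: measurableI; exact: measurable_itv.
  have H0 : (0 <= mu (`[a, b[%classic `&` `]0%R, T[%classic))%E by [].
  have G (r : \bar R) : (0 <= r)%E -> (r <= (b - a)%:E)%E -> fine r <= b - a.
    by case: r => //= r _; rewrite lee_fin.
  exact: G.
have [st|/ltW ts] := leP s t; first by rewrite ger0_norm ?subr_ge0 // W.
rewrite ler0_norm ?subr_le0 // opprB; apply: le_trans (W _ _ ts).
by rewrite le_eqVlt; apply/orP; left; apply/eqP; apply: eq_iD => r _; rewrite distrC.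
Qed.

(** A difference of two indicators takes the values -1, 0 and 1, so its square is its absolute
    value. This is where the exponent 1/2 in [prim_holder] comes from. *)
Lemma nrm_beforeB s t : nrm T (fun r => before t r - before s r) <= Num.sqrt `|t - s|.
Proof.
rewrite ler_wsqrtr // (le_trans _ (iD_beforeB_le s t)) // le_eqVlt; apply/orP; left.
apply/eqP; apply: eq_iD => r _; rewrite /before.
by case: (r < t); case: (r < s); rewrite ?subr0 ?subrr ?sub0r ?mulrNN ?mulr1 ?mulr0 ?normrN ?normr1 ?normr0.
Qed.

Lemma primD u w t : sqint T u -> sqint T w ->
  prim (fun s => u s + w s) t = prim u t + prim w t.
Proof. by move=> *; apply: ipDl => //; exact: sqint_before. Qed.

Lemma primB u w t : sqint T u -> sqint T w ->
  prim (fun s => u s - w s) t = prim u t - prim w t.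
Proof. by move=> *; apply: ipBl => //; exact: sqint_before. Qed.

Lemma primZ k u t : sqint T u -> prim (fun s => k * u s) t = k * prim u t.
Proof. by move=> *; apply: ipZl => //; exact: sqint_before. Qed.

Lemma eq_prim u w : (forall t, D t -> u t = w t) -> prim u = prim w.
Proof. by move=> uw; apply/funext => t; apply: eq_iD => s /uw ->. Qed.

Lemma primB_ip u s t : sqint T u ->
  prim u t - prim u s = ip T u (fun r => before t r - before s r).
Proof.
move=> su; rewrite ipC ipBl //; try exact: sqint_before.
by rewrite !(ipC _ _ u).
Qed.

Lemma prim_holder u s t : sqint T u ->
  `|prim u t - prim u s| <= nrm T u * Num.sqrt `|t - s|.
Proof.
move=> su; rewrite primB_ip //.
apply: le_trans (cauchy_schwarz su (sqint_beforeB s t)) _.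
by rewrite ler_wpM2l ?nrm_ge0 // nrm_beforeB.
Qed.

Lemma prim_le u t : sqint T u -> `|prim u t| <= nrm T u * Num.sqrt T.
Proof.
move=> su; apply: le_trans (cauchy_schwarz su (sqint_before t)) _.
rewrite ler_wpM2l ?nrm_ge0 // -[leRHS]mul1r; apply: nrm_bounded => //.
  exact: measurable_before.
by move=> s _; exact: before_le1.
Qed.

Lemma continuous_holder f K : 0 <= K ->
  (forall s t, `|f t - f s| <= K * Num.sqrt `|t - s|) -> continuous f.
Proof.
move=> K0 H s; apply/cvgrPdist_le => e e0.
have K1 : 0 < K + 1 by rewrite ltr_wpDl.
have d0 : 0 < (e / (K + 1)) ^+ 2 by rewrite exprn_gt0 // divr_gt0.
near=> t; rewrite distrC; apply: le_trans (H s t) _.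
have h : Num.sqrt `|t - s| <= e / (K + 1).
  have e1 := ltW (divr_gt0 e0 K1).
  rewrite -(ger0_norm e1) -(sqrtr_sqr (e / (K + 1))); apply: ler_wsqrtr.
  rewrite distrC; near: t.
  by apply/nbhs_ballP; exists ((e / (K + 1)) ^+ 2) => // x; exact: ltW.
apply: le_trans (ler_wpM2l K0 h) _.
by rewrite mulrCA ler_piMr ?(ltW e0) // ler_pdivrMr // mul1r lerDl.
Unshelve. all: by end_near. Qed.

Lemma prim_continuous u : sqint T u -> continuous (prim u).
Proof.
by move=> su; apply: (@continuous_holder _ (nrm T u)); [exact: nrm_ge0|move=> s t; exact: prim_holder].
Qed.

Lemma measurable_continuous f : continuous f -> measurable_fun D f.
Proof.
by move=> cf; apply: measurable_funTS; exact: continuous_measurable_fun.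
Qed.

Lemma prim_meas u : sqint T u -> measurable_fun D (prim u).
Proof. by move=> su; apply: measurable_continuous; exact: prim_continuous. Qed.

Lemma prim_sqint u : sqint T u -> sqint T (prim u).
Proof.
move=> su; apply: (@sqint_bounded _ _ T_gt0 _ (nrm T u * Num.sqrt T)); first exact: prim_meas.
by move=> t _; exact: prim_le.
Qed.

Lemma iD_eq0 f : (forall s, D s -> f s = 0) -> iD T f = 0.
Proof. by move=> f0; rewrite (eq_iD f0) iD_cst // mul0r. Qed.

Lemma prim0 u : prim u 0 = 0.
Proof.
by apply: iD_eq0 => s; rewrite /= in_itv /= /before => /andP[s0 _]; rewrite ltNge ltW // mulr0.
Qed.

Lemma primT u : prim u T = iD T u.
Proof.
by apply: eq_iD => s; rewrite /= in_itv /= /before => /andP[_ ->]; rewrite mulr1.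
Qed.

Lemma tailE u t : sqint T u -> tail u t = iD T u - prim u t.
Proof.
move=> su; have sa := sqint_after t; have sb := sqint_before t.
apply/eqP; rewrite -subr_eq opprK addrC eq_sym; apply/eqP.
rewrite /prim /tail !(ipC _ u) -ipDl //; rewrite /ip /iD /Rintegral; congr fine.
apply: ae_eq_integral; first exact: mD.
- by apply: measurable_EFin_comp; case: su.
- have m1 : measurable_fun D (fun x => (before t x + after t x) * u x).
    by apply: measurable_funM; [case: (sqintD sb sa)|case: su].
  exact: measurable_EFin_comp m1.
(* Both inequalities in [before] and [after] are strict, so the two indicators add up to 1 except at
   [s = t]. *)
exists [set t]; split; [exact: measurable_set1|exact: lebesgue_measure_set1|].
move=> s /=; apply: contra_notP => /eqP st _; rewrite /before /after.
by case: (ltgtP s t) st => // _ _; rewrite ?addr0 ?add0r mul1r.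
Qed.

Lemma prim_itv f t : 0 <= t <= T -> prim f t = \int[mu]_(s in `]0, t[) f s.
Proof.
move=> /andP[t0 tT]; rewrite /prim /ip /iD Rintegral_mkcond [RHS]Rintegral_mkcond.
apply: eq_Rintegral => s _; rewrite !patchE !mem_setE !in_itv /= /before.
have [s0|s0] := ltP 0 s => //=.
have [st|st] := ltP s t; first by rewrite (lt_le_trans st tT) mulr1.
by case: ifP; rewrite ?mulr0.
Qed.

Lemma prim_cst k t : 0 <= t <= T -> prim (fun=> k) t = k * t.
Proof.
move=> tT; rewrite prim_itv // Rintegral_cst //; congr (_ * _).
move: tT => /andP[t0 _].
have E : (mu `]0%R, t[%classic = t%:E)%E.
  rewrite lebesgue_measure_itv /= lte_fin; case: ltP => t1; first by rewrite oppr0 adde0.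
  by congr (_%:E); apply/eqP; rewrite eq_le t0 t1.
by rewrite -[RHS]/(fine t%:E) -E.
Qed.

Lemma prim_lipschitz f K s t : sqint T f -> (forall r, D r -> `|f r| <= K) ->
  `|prim f t - prim f s| <= K * `|t - s|.
Proof.
move=> sf fK; rewrite primB_ip //; have sB := sqint_beforeB s t.
have K0 : 0 <= K.
  have T2 : 0 < T / 2 < T by move: T_gt0; clear; lra.
  by apply: le_trans (fK (T / 2) _) => //; rewrite /= in_itv.
apply: le_trans (norm_iD (sqint_mul sf sB)) _.
apply: le_trans (ler_wpM2l K0 (iD_beforeB_le s t)).
have ib := intg_norm (sqint_intg T_gt0 sB).
rewrite -iDZ //; apply: le_iD; [by apply: intg_norm; exact: sqint_mul|exact: intgZ|].
by move=> r Dr; rewrite normrM ler_wpM2r // fK.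
Qed.

Lemma derive1_quadratic f t l K d : 0 < d ->
  (forall h, `|h| < d -> `|f (t + h) - f t - l * h| <= K * h ^+ 2) ->
  is_derive t 1 f l.
Proof.
move=> d0 H; have K0 : 0 <= K.
  have := H (d / 2); rewrite gtr0_norm ?divr_gt0 // ltr_pdivrMr // ltr_pMr // ltr1n => /(_ isT).
  by move/(le_trans (normr_ge0 _)); rewrite pmulr_lge0 // exprn_gt0 // divr_gt0.
have C : h^-1 *: (f (h *: 1 + t) - f t) @[h --> 0^'] --> l.
  apply/cvgrPdist_le => e e0; near=> h.
  have h0 : h != 0 by near: h; exact: nbhs_dnbhs_neq.
  have hd : `|h| < d by near: h; exact: dnbhs0_lt.
  have hK : `|h| <= e / (K + 1).
    by near: h; apply: dnbhs0_le; rewrite divr_gt0 // ltr_wpDl.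
  have E : l - h^-1 *: (f (h *: 1 + t) - f t) = - h^-1 * (f (t + h) - f t - l * h).
    by rewrite scaler1 (addrC h) /GRing.scale /=; field.
  rewrite E normrM normrN normfV mulrC ler_pdivrMr ?normr_gt0 //.
  apply: le_trans (H _ hd) _; rewrite -(real_normK (num_real h)) expr2 mulrA.
  rewrite ler_wpM2r //; apply: le_trans (ler_wpM2l K0 hK) _.
  by rewrite mulrCA ler_piMr ?(ltW e0) // ler_pdivrMr ?mul1r ?lerDl // ltr_wpDl.
apply: DeriveDef; first by apply/cvg_ex; exists l.
by apply/cvg_lim; [exact: Rhausdorff|exact: C].
Unshelve. all: by end_near. Qed.

(** A Lipschitz estimate centred at [t] makes the remainder of [prim f] quadratic. Applied to
    costates it gives a derivative at every interior time, where the a.e. theorem would leave a null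
    set depending on the starting point. *)
Lemma is_derive_prim_lipschitz f K t : sqint T f -> 
  (forall s, D s -> `|f s - f t| <= K * `|s - t|) -> D t -> is_derive t 1 (prim f) (f t).
Proof.
move=> sf Lf /[dup] Dt; rewrite /= in_itv /= => /andP[t0 tT].
have m0 : 0 < Num.min t (T - t) by rewrite lt_min t0 subr_gt0.
apply: (@derive1_quadratic _ _ _ K _ m0) => h; rewrite lt_min => /andP[ht hT].
have sB := sqint_beforeB t (t + h); have sc := sqint_cst T_gt0 (f t).
have th : 0 <= t + h <= T.
  by move: ht hT; rewrite !ltr_norml => /andP[? ?] /andP[? ?]; apply/andP; split; lra.
have E : f t * h = ip T (fun=> f t) (fun r => before (t + h) r - before t r).
  by rewrite -primB_ip // !prim_cst ?(ltW t0) ?(ltW tT) //; ring.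
rewrite primB_ip // E -ipBl //.
have sd := sqintB sf sc.
apply: le_trans (norm_iD (sqint_mul sd sB)) _.
have -> : K * h ^+ 2 = K * `|h| * `|h| by rewrite -mulrA -expr2 real_normK // num_real.
have := iD_beforeB_le t (t + h); rewrite (_ : t + h - t = h); last by ring.
have K0 : 0 <= K * `|h|.
  have T2 : 0 < t / 2 < T by move: t0 tT; clear; lra.
  have := Lf (t / 2); rewrite /= in_itv /= => /(_ T2) /(le_trans (normr_ge0 _)).
  rewrite pmulr_lge0; first by move=> K0; exact: mulr_ge0.
  by rewrite normr_gt0 subr_eq0 lt_eqF //; move: t0; clear; lra.
move=> /(ler_wpM2l K0); apply: le_trans.
have ib := intg_norm (sqint_intg T_gt0 sB).
rewrite -iDZ //; apply: le_iD; [by apply: intg_norm; exact: sqint_mul|exact: intgZ|].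
move=> r Dr; rewrite normrM.
have [->|rne] := eqVneq (before (t + h) r - before t r) 0; first by rewrite normr0 !mulr0.
rewrite ler_wpM2r //; apply: le_trans (Lf r Dr) _.
apply: ler_wpM2l.
  have T2 : 0 < t / 2 < T by move: t0 tT; clear; lra.
  have := Lf (t / 2); rewrite /= in_itv /= => /(_ T2) /(le_trans (normr_ge0 _)).
  rewrite pmulr_lge0 //.
  by rewrite normr_gt0 subr_eq0 lt_eqF //; move: t0; clear; lra.
(* Where the two indicators differ, [r] lies between [t] and [t + h], so its distance to [t] is at
   most |h|. *)
move: rne; rewrite /before.
have [r1|r1] := ltP r (t + h); have [r2|r2] := ltP r t; rewrite ?subrr ?eqxx // => _.
  rewrite ger0_norm ?subr_ge0 //; apply: le_trans (ler_norm _); lra.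
rewrite ltr0_norm ?subr_lt0 //; rewrite -normrN; apply: le_trans (ler_norm _); lra.
Qed.

Lemma ftc_ae u : sqint T u ->
  {ae mu, forall t, derivable (prim u) t 1 /\ derive1 (prim u) t = (u \_ D) t}.
Proof.
move=> su.
have iu : mu.-integrable setT (EFin \o (u \_ D)).
  have := (integrable_mkcond _ (mD T)).1 (sqint_intg T_gt0 su).
  by apply: eq_integrable => // x _ /=; rewrite !patchE; case: ifP.
have -> : prim u = (fun x => \int[mu]_(t in `]-oo, x]) (u \_ D) t).
  apply/funext => x; rewrite -Rintegral_itv_bndo_bndc; last first.
    by apply: integrableS iu => //; exact: measurable_itv.
  rewrite Rintegral_mkcond /prim /ip /iD Rintegral_mkcond; apply: eq_Rintegral => s _.
  rewrite !patchE mem_setE in_itv /= /before.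
  have -> : (s \in (`]-oo, x[%classic : set R)) = (s < x).
    by apply/idP/idP; rewrite inE /= in_itv.
  by case: (s < x); case: ifP; rewrite ?mulr1 ?mulr0.
apply: FTC1Ny.
  by move=> y; apply: integrableS iu => //; exact: measurable_itv.
exact: open_integrable_locally openT iu.
Qed.

Lemma prim_ftc2 (F f : R -> R) t : continuous f -> (forall s, is_derive s 1 F (f s)) ->
  0 <= t <= T -> prim f t = F t - F 0.
Proof.
move=> cf dF /[dup] tT /andP[]; rewrite le_eqVlt => /predU1P[<- _|t0 tT'].
  by rewrite prim0 subrr.
have cF : continuous F.
  by move=> x; apply/differentiable_continuous/derivable1_diffP; case: (dF x).
rewrite prim_itv //; transitivity (fine ((F t)%:E - (F 0)%:E)%E) => //.
rewrite -(@continuous_FTC2 _ f F 0 t t0).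
- rewrite /Rintegral; congr fine; apply: esym.
  have mA (A : set (measurableTypeR R)) : measurable_fun A f.
    by apply: measurable_funTS; exact: continuous_measurable_fun.
  rewrite -integral_itv_obnd_cbnd; last exact: measurable_EFin_comp.
  by rewrite -integral_itv_bndo_bndc //; exact: measurable_EFin_comp.
- exact: continuous_subspaceT.
- split; first by move=> x _; case: (dF x).
  + by apply: cvg_at_right_filter; exact: cF.
  + by apply: cvg_at_left_filter; exact: cF.
- by move=> x _; rewrite derive1E; case: (dF x).
Qed.

(** Every kernel met below is a bounded factor times a product of integrable functions of one
    variable. The product bound gives joint integrability by Tonelli. *)
Lemma Rintegral_Fubini (k : measurableTypeR R * measurableTypeR R -> R) (a b : R -> R) :
  measurable_fun setT k ->
  mu.-integrable setT (EFin \o a) -> mu.-integrable setT (EFin \o b) ->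
  (forall x y, `|k (x, y)| <= a x * b y) ->
  \int[mu]_x \int[mu]_y k (x, y) = \int[mu]_y \int[mu]_x k (x, y) /\
  mu.-integrable setT (fun x => (\int[mu]_y k (x, y))%:E).
Proof.
move=> mk ia ib kab.
have mkx x : measurable_fun setT (fun y : measurableTypeR R => k (x, y)).
  by apply: (measurableT_comp mk); exact: pair1_measurable.
have mky y : measurable_fun setT (fun x : measurableTypeR R => k (x, y)).
  by apply: (measurableT_comp mk); exact: pair2_measurable.
have ix x : mu.-integrable setT (fun y => (k (x, y))%:E).
  have := integrableZl measurableT (a x) ib; apply: le_integrable => //.
    by apply: measurable_EFin_comp; exact: mkx.
  by move=> y _; rewrite /= lee_fin (le_trans (kab _ _)) // ler_norm.
have iy y : mu.-integrable setT (fun x => (k (x, y))%:E).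
  have := integrableZl measurableT (b y) ia; apply: le_integrable => //.
    by apply: measurable_EFin_comp; exact: mky.
  by move=> x _; rewrite /= lee_fin (le_trans (kab _ _)) // mulrC ler_norm.
have mkE : measurable_fun setT (fun p => (k p)%:E) by exact/measurable_EFinP.
have ik : (mu \x mu)%E.-integrable setT (fun p => (k p)%:E).
  apply/integrable12ltyP => //.
  pose B := fine (\int[mu]_y `|(b y)%:E|)%E.
  have iab := integrable_abse ib.
  have BE : (\int[mu]_y `|(b y)%:E|)%E = B%:E.
    by rewrite /B fineK //; apply: integrable_fin_num => //.
  apply: (@le_lt_trans _ _ (\int[mu]_x (`|(a x)%:E| * B%:E))%E); last first.
    have := integrableZr measurableT B (integrable_abse ia).
    by move=> /integrable_lty -/(_ measurableT).
  apply: ge0_le_integral => //.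
  - by move=> x _; exact: integral_ge0.
  - have := @measurable_fun_fubini_tonelli_F _ _ _ _ _ mu (fun p => `|(k p)%:E|%E).
    by apply=> //; exact: measurableT_comp.
  - apply: emeasurable_funM => //; apply: measurableT_comp => //; exact: (measurable_int mu ia).
  - move=> x _; rewrite -BE -ge0_integralZl //; last by apply: (measurable_int mu iab).
    apply: ge0_le_integral => //.
    + by apply: measurableT_comp => //; apply: measurable_EFin_comp; exact: mkx.
    + by apply: measurable_funeM; exact: (measurable_int mu iab).
    + move=> y _; rewrite !abse_EFin -EFinM lee_fin (le_trans (kab _ _)) //.
      by rewrite -normrM ler_norm.
have EX x : (\int[mu]_y (k (x, y))%:E = (\int[mu]_y k (x, y))%:E)%E.
  by rewrite /Rintegral fineK //; apply: integrable_fin_num.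
have EY y : (\int[mu]_x (k (x, y))%:E = (\int[mu]_x k (x, y))%:E)%E.
  by rewrite /Rintegral fineK //; apply: integrable_fin_num.
split.
  rewrite /Rintegral; congr fine.
  under eq_integral do rewrite -[X in X%:E]/(Rintegral mu setT _) -EX.
  by rewrite (Fubini ik) //; apply: eq_integral => y _; rewrite EY.
apply: eq_integrable (integrable_fubini_F ik) => // x _; rewrite /fubini_F EX.
by [].
Qed.

Lemma integrable_patch f : intg T f -> mu.-integrable setT (EFin \o (f \_ D)).
Proof.
move=> /(integrable_mkcond _ (mD T)) ; apply: eq_integrable => // x _ /=.
by rewrite !patchE; case: ifP.
Qed.

(** [tail] is the adjoint of [prim]: both sides integrate f(x) u(y) over the triangle y < x. It
    replaces integration by parts, without boundary terms, throughout. *)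
Lemma ip_prim f u : sqint T f -> sqint T u -> ip T f (prim u) = ip T u (tail f).
Proof.
move=> sf su.
have iF := integrable_patch (sqint_intg T_gt0 sf).
have iU := integrable_patch (sqint_intg T_gt0 su).
pose k (p : measurableTypeR R * measurableTypeR R) : R :=
  (f \_ D) p.1 * ((u \_ D) p.2 * before p.1 p.2).
have mk : measurable_fun setT k.
  apply: measurable_funM.
    by apply: (measurableT_comp _ measurable_fst); apply/measurable_EFinP; exact: (measurable_int mu iF).
  apply: measurable_funM.
    by apply: (measurableT_comp _ measurable_snd); apply/measurable_EFinP; exact: (measurable_int mu iU).
  have mlt : measurable_fun setT (fun p : measurableTypeR R * measurableTypeR R => p.2 < p.1).
    by apply: measurable_fun_ltr; [exact: measurable_snd|exact: measurable_fst].
  have -> : (fun p : measurableTypeR R * measurableTypeR R => before p.1 p.2) =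
      (fun p => if p.2 < p.1 then 1 else 0).
    by apply/funext => p; rewrite /before; case: ifP.
  exact: measurable_fun_ifT.
have [] := @Rintegral_Fubini k (fun x => `|(f \_ D) x|) (fun x => `|(u \_ D) x|) mk.
- by have := integrable_abse iF; apply: eq_integrable.
- by have := integrable_abse iU; apply: eq_integrable.
- move=> x y; rewrite /k !normrM ler_wpM2l // ler_piMr //; exact: before_le1.
move=> E _.
have mb (b g : R -> R) : sqint T g -> sqint T b ->
    mu.-integrable setT (fun y => ((g \_ D) y * b y)%:E).
  move=> sg sb; refine (@eq_integrable _ _ _ mu setT measurableT _ _ _ (integrable_patch (sqint_mul sg sb))).
  by move=> y _ /=; rewrite !patchE; case: ifP; rewrite ?mul0r.
have -> : ip T f (prim u) = \int[mu]_x \int[mu]_y k (x, y).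
  rewrite /ip /iD Rintegral_mkcond; apply: eq_Rintegral => x _.
  transitivity (\int[mu]_y ((f \_ D) x * ((u \_ D) y * before x y))); last exact: eq_Rintegral.
  rewrite (RintegralZl _ measurableT (mb _ _ su (sqint_before x))).
  rewrite !patchE; case: ifP => _; last by rewrite mul0r.
congr (_ * _).
  rewrite /prim /ip /iD Rintegral_mkcond; apply: eq_Rintegral => y _.
  by rewrite !patchE; case: ifP; rewrite ?mul0r.
rewrite E /ip /iD [RHS]Rintegral_mkcond; apply: eq_Rintegral => y _.
transitivity (\int[mu]_x ((u \_ D) y * ((f \_ D) x * before x y))).
  by apply: eq_Rintegral => x _; rewrite /k mulrCA.
rewrite (RintegralZl _ measurableT (mb _ _ sf (sqint_after y))).
rewrite !patchE; case: ifP => _; last by rewrite mul0r.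
congr (_ * _).
rewrite /tail /ip /iD [RHS]Rintegral_mkcond; apply: eq_Rintegral => x _.
by rewrite !patchE; case: ifP; rewrite ?mul0r.
Qed.
End Primitive.

(** * Weak derivatives and primitives *)

Section SplineBump.
Context {R : realType}.
Implicit Types (t h a b d : R).

Lemma continuous_lipschitz (f : R -> R) (K : R) :
  (forall s t, `|f t - f s| <= K * `|t - s|) -> continuous f.
Proof.
move=> H s; apply/cvgrPdist_le => e e0.
have K1 : 0 < `|K| + 1 by rewrite ltr_wpDl.
have d0 : 0 < e / (`|K| + 1) by rewrite divr_gt0.
apply/nbhs_ballP; exists (e / (`|K| + 1)) => // t /ltW st /=.
rewrite distrC; apply: le_trans (H s t) _; rewrite distrC.
apply: le_trans (_ : `|K| * `|s - t| <= _); first by rewrite ler_wpM2r // ler_norm.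
apply: le_trans (ler_wpM2l (normr_ge0 K) st) _.
by rewrite mulrCA ler_piMr ?(ltW e0) // ler_pdivrMr // mul1r lerDl.
Qed.

Definition pos_part t : R := Num.max 0 t.

Lemma pos_part_lipschitz s t : `|pos_part t - pos_part s| <= `|t - s|.
Proof.
rewrite /pos_part; have [s0|s0] := lerP s 0; have [t0|t0] := lerP t 0.
- by rewrite subrr normr0.
- by rewrite subr0 gtr0_norm // gtr0_norm; move: s0 t0; clear; lra.
- by rewrite sub0r normrN gtr0_norm // ltr0_norm; move: s0 t0; clear; lra.
- by [].
Qed.

(** The squared positive part is C^1 with Lipschitz derivative. Since [test_function] only asks for
    C^1, splines built from it can serve as test functions in place of smooth bumps. *)
Lemma pos_part_sqr_taylor t h :
  `|pos_part (t + h) ^+ 2 - pos_part t ^+ 2 - 2 * pos_part t * h| <= h ^+ 2.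
Proof.
rewrite /pos_part ler_norml.
have [t0|t0] := lerP t 0; have [h0|h0] := lerP (t + h) 0; apply/andP; split;
  move: t0 h0; clear; nra.
Qed.

(* The quadratic spline rising from 0 at [a] to 1 at [a + 2 d]; its derivative
   [bump a d] is the hat function supported on this interval. *)
Definition ramp a d t : R :=
  (pos_part (t - a) ^+ 2 - 2 * pos_part (t - a - d) ^+ 2 + pos_part (t - a - 2 * d) ^+ 2)
  / (2 * d ^+ 2).
Definition bump a d t : R :=
  (pos_part (t - a) - 2 * pos_part (t - a - d) + pos_part (t - a - 2 * d)) / d ^+ 2.

Lemma ramp_eq0 a d t : 0 < d -> t <= a -> ramp a d t = 0.
Proof.
move=> d0 ta; rewrite /ramp /pos_part !max_l; try by move: d0 ta; clear; lra.
Qed.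

Lemma ramp_eq1 a d t : 0 < d -> a + 2 * d <= t -> ramp a d t = 1.
Proof.
move=> d0 ta; rewrite /ramp /pos_part !max_r; try by move: d0 ta; clear; lra.
by field; rewrite lt0r_neq0.
Qed.

Lemma bump_ge0 a d t : 0 < d -> 0 <= bump a d t.
Proof.
move=> d0; apply: divr_ge0; last by rewrite sqr_ge0.
rewrite /pos_part; have [t0|t0] := lerP (t - a) 0; have [t1|t1] := lerP (t - a - d) 0;
  have [t2|t2] := lerP (t - a - 2 * d) 0; move: d0 t0 t1 t2; clear; lra.
Qed.

Lemma bump_eq0 a d t : 0 < d -> ~~ (a <= t <= a + 2 * d) -> bump a d t = 0.
Proof.
move=> d0; rewrite negb_and -!ltNge => /orP[ta|ta]; rewrite /bump /pos_part.
  rewrite !max_l; try by move: d0 ta; clear; lra.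
rewrite !max_r; try by move: d0 ta; clear; lra.
Qed.

Lemma ramp_derive a d t : 0 < d -> is_derive t 1 (ramp a d) (bump a d t).
Proof.
(* The three squares of [ramp] contribute remainders h^2, 2 h^2 and h^2; their sum over 2 d^2 gives
   the constant. *)
move=> d0; apply: (@derive1_quadratic _ _ _ _ (2 / d ^+ 2) _ ltr01) => h _.
have dn : d != 0 by rewrite lt0r_neq0.
have p1 := pos_part_sqr_taylor (t - a) h.
have p2 := pos_part_sqr_taylor (t - a - d) h.
have p3 := pos_part_sqr_taylor (t - a - 2 * d) h.
rewrite /ramp /bump.
rewrite (_ : t + h - a = t - a + h); last by ring.
rewrite (_ : t - a + h - d = t - a - d + h); last by ring.
rewrite (_ : t - a + h - 2 * d = t - a - 2 * d + h); last by ring.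
move: p1 p2 p3.
set A := pos_part (_ + h); set A' := pos_part (t - a).
set B := pos_part (_ + h); set B' := pos_part (t - a - d).
set C := pos_part (_ + h); set C' := pos_part (t - a - 2 * d).
move=> p1 p2 p3.
have d2 : 0 < 2 * d ^+ 2 by rewrite mulr_gt0 // exprn_gt0.
rewrite (_ : _ - _ - _ = ((A ^+ 2 - A' ^+ 2 - 2 * A' * h) - 2 * (B ^+ 2 - B' ^+ 2 - 2 * B' * h)
   + (C ^+ 2 - C' ^+ 2 - 2 * C' * h)) / (2 * d ^+ 2)); last by field.
rewrite normrM normfV (gtr0_norm d2) ler_pdivrMr //.
rewrite (_ : _ * (2 * _) = 4 * h ^+ 2); last by field.
move: p1 p2 p3; rewrite !ler_norml => /andP[? ?] /andP[? ?] /andP[? ?].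
by apply/andP; split; lra.
Qed.

Lemma bump_continuous a d : 0 < d -> continuous (bump a d).
Proof.
move=> d0; apply: (@continuous_lipschitz _ (4 / d ^+ 2)) => s t.
have p1 := pos_part_lipschitz (s - a) (t - a).
have p2 := pos_part_lipschitz (s - a - d) (t - a - d).
have p3 := pos_part_lipschitz (s - a - 2 * d) (t - a - 2 * d).
move: p1 p2 p3.
rewrite (_ : t - a - (s - a) = t - s); last by ring.
rewrite (_ : t - a - d - (s - a - d) = t - s); last by ring.
rewrite (_ : t - a - 2 * d - (s - a - 2 * d) = t - s); last by ring.
rewrite /bump -mulrBl normrM mulrAC.
set A := pos_part _; set A' := pos_part (s - a).
set B := pos_part _; set B' := pos_part (s - a - d).
set C := pos_part _; set C' := pos_part (s - a - 2 * d).
move=> p1 p2 p3; have d2 : 0 < (d ^+ 2)^-1 by rewrite invr_gt0 exprn_gt0.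
rewrite (gtr0_norm d2) ler_pM2r //.
move: p1 p2 p3; rewrite !ler_norml => /andP[? ?] /andP[? ?] /andP[? ?].
by apply/andP; split; lra.
Qed.
End SplineBump.

Section Bridge.
Context {R : realType} (T : R) (T_gt0 : 0 < T).
Notation mu := (@lebesgue_measure R).
Notation D := (`]0, T[%classic : set (measurableTypeR R)).
Notation prim := (prim T).
Notation ip := (ip T).
Notation iD := (iD T).
Notation sqint := (sqint T).
Implicit Types (f u w z psi : R -> R) (t s x : R).

Lemma within_continuous_bounded f : {within `[0, T], continuous f} ->
  exists K, forall t, D t -> `|f t| <= K.
Proof.
move=> cf; have [c _ cM] := EVT_max (ltW T_gt0) cf; have [d _ dM] := EVT_min (ltW T_gt0) cf.
exists (`|f c| + `|f d|) => t; rewrite /= in_itv /= => /andP[t0 tT].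
have tT' : t \in `[0, T] by rewrite in_itv /= (ltW t0) (ltW tT).
have := cM _ tT'; have := dM _ tT'; have := ler_norm (f c); have := ler_norm (- f d).
have := normr_ge0 (f c); have := normr_ge0 (f d); rewrite normrN ler_norml => *.
by apply/andP; split; lra.
Qed.

Lemma within_continuous_sqint f : {within `[0, T], continuous f} -> sqint f.
Proof.
move=> cf; have [K fK] := within_continuous_bounded cf; apply: sqint_bounded fK => //.
apply: (@measurable_funS _ _ _ _ `[0, T]%classic); first exact: measurable_itv.
  by apply: subset_itvScc; rewrite bnd_simp.
exact: subspace_continuous_measurable_fun.
Qed.

Lemma within_continuousP f : {within `[0, T], continuous f} <->
  forall p, 0 <= p <= T -> forall e, 0 < e -> exists2 d, 0 < d &
    forall s, 0 <= s <= T -> `|s - p| < d -> `|f s - f p| <= e.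
Proof.
rewrite subspace_continuousP; split=> H p pT.
  move=> e e0; have := H p; rewrite /= in_itv /= => /(_ pT) /cvgrPdist_le /(_ _ e0).
  rewrite near_withinE => /nbhs_ballP[d d0 dP]; exists d => // s sT sd.
  rewrite distrC; apply: (dP s); last by rewrite /= in_itv.
  by rewrite /ball /= distrC.
move: pT; rewrite /= in_itv /= => pT; apply/cvgrPdist_le => e e0.
have [d d0 dP] := H _ pT _ e0; rewrite near_withinE; apply/nbhs_ballP; exists d => // s sd.
by rewrite /= in_itv /= => sT; rewrite distrC; apply: dP => //; rewrite distrC.
Qed.


Lemma test_function_facts psi : test_function T psi ->
  [/\ continuous (derive1 psi), sqint psi, sqint (derive1 psi), iD (derive1 psi) = 0 &
      forall t, 0 <= t <= T -> prim (derive1 psi) t = psi t].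
Proof.
case=> dpsi cpsi [a [b [a0 bT ab0]]].
have dp t : is_derive t 1 psi (derive1 psi t).
  by rewrite derive1E; apply: DeriveDef => //; exact: dpsi.
have p0 : psi 0 = 0.
  by apply: ab0; rewrite in_itv /= negb_and -ltNge a0.
have pT : psi T = 0.
  by apply: ab0; rewrite in_itv /= negb_and -!ltNge bT orbT.
have P t : 0 <= t <= T -> prim (derive1 psi) t = psi t.
  by move=> tT; rewrite (prim_ftc2 T_gt0 cpsi dp tT) p0 subr0.
split=> //.
- apply: within_continuous_sqint; apply: continuous_subspaceT => x.
  by apply/differentiable_continuous/derivable1_diffP; exact: dpsi.
- by apply: within_continuous_sqint; exact: continuous_subspaceT.
- by rewrite -primT P ?pT // lexx ltW.
Qed.

(** The derivative of [psi] has mean zero, so its tail is [- psi], and adjointness says that [u] is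
    the weak derivative of [prim u]. *)
Lemma ip_derive1_prim psi u : test_function T psi -> sqint u ->
  ip (prim u) (derive1 psi) = - ip u psi.
Proof.
move=> /test_function_facts[_ sp sd i0 P] su.
rewrite ipC ip_prim //; transitivity (ip u (fun t => -1 * psi t)); last first.
  by rewrite ipC ipZl // ipC mulN1r.
apply: eq_iD => t Dt.
have tT : 0 <= t <= T by move: Dt; rewrite /= in_itv /= => /andP[/ltW -> /ltW ->].
by rewrite tailE // i0 P // sub0r mulN1r.
Qed.

Lemma H1_prim x u : sqint u -> H1 T (fun t => x + prim u t).
Proof.
move=> su; have cz : continuous (fun t => x + prim u t).
  by move=> t; apply: cvgD; [exact: cvg_cst|exact: prim_continuous].
have cz' : {within `[0, T], continuous (fun t => x + prim u t)} by exact: continuous_subspaceT.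
split=> //; first by apply/L2_sqint; exact: within_continuous_sqint.
exists u; split; first exact/L2_sqint.
move=> psi tp; have [_ sp sd i0 P] := test_function_facts tp.
rewrite -/(iD _) -/(iD (fun t => u t * psi t)) -/(ip u psi) -ip_derive1_prim //.
rewrite -[LHS]/(ip (fun t => x + prim u t) (derive1 psi)).
have sx := sqint_cst T_gt0 x; have spr := prim_sqint T_gt0 su.
rewrite ipDl // -[ip (fun=> x) _]/(iD (fun t => x * derive1 psi t)).
by rewrite (iDZ _ (sqint_intg T_gt0 sd)) i0 mulr0 add0r.
Qed.

(** The support is put on the side of [p] facing the middle of the interval, at distances between
    m/8 and 3m/8 from [p]. It thus stays inside ]0, T[ even when [p] is 0 or [T]. *)
Lemma bump_near p d0 : 0 <= p <= T -> 0 < d0 -> exists a d, [/\ 0 < d, 0 < a, a + 2 * d < T &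
  forall s, a <= s <= a + 2 * d -> `|s - p| < d0].
Proof.
move=> /andP[p0 pT] d00; set m := Num.min d0 T.
have m0 : 0 < m by rewrite lt_min d00.
have md : m <= d0 by rewrite ge_min lexx.
have mT : m <= T by rewrite ge_min lexx orbT.
have [pT2|pT2] := lerP p (T / 2).
  exists (p + m / 8), (m / 8); split; move: p0 pT d00 m0 md mT pT2 T_gt0; clear; try lra.
  move=> p0 pT d00 m0 md mT pT2 T0 s /andP[? ?]; rewrite ltr_norml; apply/andP; split; lra.
exists (p - 3 * (m / 8)), (m / 8); split; move: p0 pT d00 m0 md mT pT2 T_gt0; clear; try lra.
move=> p0 pT d00 m0 md mT pT2 T0 s /andP[? ?]; rewrite ltr_norml; apply/andP; split; lra.
Qed.

(** The bump is a nonnegative weight of mass 1, the rise of [ramp] from 0 to 1, so pairing with it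
    averages values that are all close to f(p). *)
Lemma ip_bump f p e a d : sqint f -> 0 < d -> 0 < a -> a + 2 * d < T ->
  (forall s, a <= s <= a + 2 * d -> `|f s - f p| <= e) ->
  `|ip f (bump a d) - f p| <= e.
Proof.
move=> sf d0 a0 adT H.
have sb : sqint (bump a d).
  by apply: within_continuous_sqint; apply: continuous_subspaceT; exact: bump_continuous.
have i1 : iD (bump a d) = 1.
  rewrite -primT (prim_ftc2 T_gt0 (@bump_continuous _ a d d0) (fun s => ramp_derive a s d0)) ?lexx ?ltW //.
  by rewrite ramp_eq1 ?ramp_eq0 ?subr0 // ltW.
have sc := sqint_cst T_gt0 (f p).
have E : f p = ip (fun=> f p) (bump a d).
  by rewrite !ipE (iDZ _ (sqint_intg T_gt0 sb)) i1 mulr1.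
rewrite [X in _ - X]E -ipBl //; have sd := sqintB sf sc.
apply: le_trans (norm_iD (sqint_mul sd sb)) _.
rewrite -[leRHS]mulr1 -i1 -iDZ; last exact: sqint_intg.
apply: le_iD; first by apply: intg_norm; exact: sqint_mul.
  by apply: intgZ; exact: sqint_intg.
move=> t Dt; rewrite normrM (ger0_norm (bump_ge0 _ _ d0)).
have [tb|tb] := boolP (a <= t <= a + 2 * d); last by rewrite bump_eq0 // !mulr0.
by rewrite ler_wpM2r ?bump_ge0 // H.
Qed.

(* du Bois-Reymond: test against the derivative of a difference of two ramps. *)
Lemma H1_primitive z : H1 T z ->
  exists2 u, sqint u & forall t, 0 <= t <= T -> z t = z 0 + prim u t.
Proof.
case=> cz _ [u [/L2_sqint su wu]]; exists u => //.
pose f t := z t - prim u t.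
have cf : {within `[0, T], continuous f}.
  have cp : {within `[0, T], continuous (prim u)}.
    by apply: continuous_subspaceT; exact: prim_continuous.
  by move=> t; apply: cvgB; [exact: cz|exact: cp].
have sf := within_continuous_sqint cf.
have f0 psi : test_function T psi -> ip f (derive1 psi) = 0.
  move=> tp; have [_ sp sd _ _] := test_function_facts tp.
  rewrite ipBl //; [|exact: within_continuous_sqint|exact: prim_sqint].
  by rewrite ip_derive1_prim // -[ip z _]/(\int[mu]_(t in `]0, T[) (z t * derive1 psi t)) wu // subrr.
have close p q e : 0 <= p <= T -> 0 <= q <= T -> 0 < e -> `|f p - f q| <= 2 * e.
  move=> pT qT e0.
  have [dp dp0 Hp] := (within_continuousP f).1 cf p pT e e0.
  have [dq dq0 Hq] := (within_continuousP f).1 cf q qT e e0.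
  have [a [d [d0 a0 adT ad]]] := bump_near pT dp0.
  have [b [c [c0 b0 bcT bc]]] := bump_near qT dq0.
  pose psi t := ramp a d t - ramp b c t.
  have dpsi t : is_derive t 1 psi (bump a d t - bump b c t).
    have := ramp_derive a t d0; have := ramp_derive b t c0 => *; exact: is_deriveB.
  have Epsi : derive1 psi = (fun t => bump a d t - bump b c t).
    by apply/funext => t; rewrite derive1E; case: (dpsi t).
  have tp : test_function T psi.
    split; first by move=> t; case: (dpsi t).
      by rewrite Epsi => t; apply: cvgB; exact: bump_continuous.
    exists (Num.min a b), (Num.max (a + 2 * d) (b + 2 * c)); split.
    - by rewrite lt_min a0.
    - by rewrite gt_max adT.
    move=> t; rewrite in_itv /= negb_and -!ltNge lt_min gt_max => /orP[/andP[ta tb]|/andP[ta tb]].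
      by rewrite /psi !ramp_eq0 ?subr0 // ltW.
    by rewrite /psi !ramp_eq1 ?subrr // ltW.
  have sba : sqint (bump a d).
    by apply: within_continuous_sqint; apply: continuous_subspaceT; exact: bump_continuous.
  have sbb : sqint (bump b c).
    by apply: within_continuous_sqint; apply: continuous_subspaceT; exact: bump_continuous.
  have := f0 _ tp; rewrite Epsi ipC ipBl // !(ipC _ _ f) => Ez.
  have sub r x y h : 0 < x -> x + 2 * y < T -> 0 < y ->
     (forall s, x <= s <= x + 2 * y -> `|s - r| < h) -> (forall s, 0 <= s <= T -> `|s - r| < h -> `|f s - f r| <= e) ->
     forall s, x <= s <= x + 2 * y -> `|f s - f r| <= e.
    move=> x0 xyT y0 H1 H2 s sxy; apply: H2; last exact: H1.
    by move: sxy x0 xyT; clear; move=> /andP[? ?] ? ?; apply/andP; split; lra.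
  have := ip_bump sf d0 a0 adT (sub _ _ _ _ a0 adT d0 ad Hp).
  have := ip_bump sf c0 b0 bcT (sub _ _ _ _ b0 bcT c0 bc Hq).
  rewrite !ler_norml => /andP[? ?] /andP[? ?]; apply/andP; split; lra.
move=> t tT; have T0 : 0 <= (0 : R) <= T by rewrite lexx ltW.
apply/eqP; rewrite -subr_eq0; have E : f t - f 0 = z t - (z 0 + prim u t).
  by rewrite /f prim0 //; ring.
rewrite -E -normr_eq0 eq_le normr_ge0 andbT; apply/ler_addgt0Pr => e e0; rewrite add0r.
have := close t 0 (e / 2) tT T0; rewrite mulrCA divff ?mulr1 //; apply; exact: divr_gt0.
Qed.

Section Action.
Variables (c : R) (V g : R -> R).

Definition lagr w x u t := c / 2 * u t ^+ 2 + u t * w t + V (x + prim u t).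
Definition act w x u := iD (lagr w x u) + g (x + prim u T).

Lemma lagrE w x u t : lagr w x u t = c / 2 * u t ^+ 2 + u t * w t + V (x + prim u t).
Proof. by []. Qed.

Lemma action_prim w x u z : continuous V -> sqint w -> sqint u ->
  (forall t, 0 <= t <= T -> z t = x + prim u t) -> action T c V g w z = act w x u.
Proof.
move=> cV sw su zE; rewrite /action /act zE ?lexx ?ltW //; congr (_ + _).
have ml : measurable_fun D (lagr w x u).
  apply: measurable_funD; first apply: measurable_funD.
  - by apply: measurable_funM => //; apply: measurable_funX; case: su.
  - by apply: measurable_funM; [case: su|case: sw].
  apply: measurable_continuous => t; apply: (@continuous_comp _ _ _ (fun t => x + prim u t) V).
    by apply: cvgD; [exact: cvg_cst|exact: prim_continuous].
  exact: cV.
rewrite iDE /Rintegral; congr fine; apply: ae_eq_integral_nonmeas.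
- exact: mD.
- exact: measurable_EFin_comp.
have := ftc_ae T_gt0 su; apply: filterS; first exact: (ae_filter_ringOfSetsType mu).
move=> t [dt Et] Dt.
have tT : 0 < t < T by move: Dt; rewrite /= in_itv.
have zt : derive1 z t = u t.
  have d1 : is_derive t 1 (fun s => x + prim u s) (u t).
    have Ep : is_derive t 1 (prim u) (u t).
      apply: DeriveDef => //; rewrite -derive1E Et patchE mem_set //.
    have -> : u t = 0 + u t by rewrite add0r.
    exact: is_deriveD.
  rewrite derive1E; suff [_ ->] : is_derive t 1 z (u t) by [].
  (* [z] is prescribed on [0, T] only, which is enough near an interior time. *)
  apply: near_eq_is_derive d1; have : \forall s \near t, s \in `]0, T[.
    by apply: near_in_itvoo; rewrite in_itv.
  apply: filterS => s; rewrite in_itv /= => /andP[/ltW s0 /ltW sT].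
  by rewrite zE // s0.
by rewrite /lagr zt zE //; move: tT => /andP[/ltW -> /ltW ->].
Qed.

Lemma phi_act w x : continuous V -> sqint w ->
  phi T c V g w x = ereal_inf [set (act w x u)%:E | u in sqint].
Proof.
move=> cV sw; rewrite /phi; congr ereal_inf; apply/seteqP; split=> r /=.
  case=> z [Hz z0] <-; have [u su zE] := H1_primitive Hz; exists u => //.
  by rewrite (@action_prim w x u z) // => t tT; rewrite zE // z0.
case=> u su <-; exists (fun t => x + prim u t); last by rewrite (@action_prim w x u).
by split; [exact: H1_prim|rewrite prim0 // addr0].
Qed.

End Action.
End Bridge.

(** * Near-critical trajectories *)

Section Gronwall.
Context {R : realType} (T : R) (T_gt0 : 0 < T).
Notation D := (`]0, T[%classic : set (measurableTypeR R)).
Notation prim := (prim T).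
Notation tail := (tail T).
Notation iD := (iD T).
Notation sqint := (sqint T).
Notation nrm := (nrm T).

Lemma continuous_sqint (f : R -> R) : continuous f -> sqint f.
Proof. by move=> cf; apply: within_continuous_sqint => //; exact: continuous_subspaceT. Qed.

Lemma ip_sqrB (f h : R -> R) : sqint f -> sqint h ->
  ip T (fun t => f t - h t) (fun t => f t - h t) = ip T f f - 2 * ip T f h + ip T h h.
Proof.
move=> sf sh; set k := fun t => f t - h t; have sk : sqint k by exact: sqintB.
rewrite {1}/k (ipBl sf sh sk) (ipC T f k) (ipC T h k) (ipBl sf sh sf) (ipBl sf sh sh).
by rewrite (ipC T h f); ring.
Qed.

Lemma tail_continuous (f : R -> R) : sqint f -> continuous (tail f).
Proof.
move=> sf; rewrite (_ : tail f = fun t => iD f - prim f t).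
  by move=> t; apply: cvgB; [exact: cvg_cst|exact: prim_continuous].
by apply/funext => t; rewrite tailE.
Qed.

Lemma le_tail (f h : R -> R) t : sqint f -> sqint h ->
  (forall s, D s -> t < s -> f s <= h s) -> tail f t <= tail h t.
Proof.
move=> sf sh fh; apply: le_iD; [by apply: sqint_mul => //; exact: sqint_after..|].
move=> s Ds; rewrite /after; case: ltP => ts; last by rewrite !mulr0.
by rewrite !mulr1; exact: fh.
Qed.

Lemma norm_tail (f : R -> R) t : sqint f -> `|tail f t| <= tail (fun s => `|f s|) t.
Proof.
move=> sf; have sa := sqint_after T_gt0 t.
apply: le_trans (norm_iD (sqint_mul sf sa)) _; rewrite le_eqVlt; apply/orP; left.
apply/eqP; apply: eq_iD => s _; rewrite normrM; congr (_ * _).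
by rewrite /after; case: (t < s); rewrite ?normr1 ?normr0.
Qed.

Lemma sqint_norm (f : R -> R) : sqint f -> sqint (fun s => `|f s|).
Proof.
move=> [mf f2]; split; first by apply: measurableT_comp.
apply: eq_integrable f2; first exact: mD.
by move=> s _ /=; rewrite real_normK // num_real.
Qed.

Lemma tail_cst_le (k t : R) : 0 <= k -> 0 <= t <= T -> tail (fun=> k) t <= k * T.
Proof.
move=> k0 tT; rewrite tailE //; last exact: sqint_cst.
rewrite iD_cst // prim_cst // lerBlDr lerDl mulr_ge0 //.
by case/andP: tT.
Qed.

Lemma tail_nrm (f : R -> R) t : sqint f -> `|tail f t| <= nrm f * Num.sqrt T.
Proof.
move=> sf; apply: le_trans (cauchy_schwarz sf (sqint_after T_gt0 t)) _.
rewrite ler_wpM2l ?nrm_ge0 // -[leRHS]mul1r; apply: nrm_bounded => //.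
  exact: measurable_after.
by move=> s _; exact: after_le1.
Qed.

Lemma tail_expR (l t : R) : 0 < l -> 0 <= t <= T ->
  l * tail (fun s => expR (- l * s)) t <= expR (- l * t).
Proof.
move=> l0 tT; have ln : l != 0 by rewrite lt0r_neq0.
have ce : continuous (fun s : R => expR (- l * s)).
  move=> s; apply: (@continuous_comp _ _ _ (fun s => - l * s) expR); last exact: continuous_expR.
  by apply: cvgM; [exact: cvg_cst|exact: cvg_id].
have dF (s : R) : is_derive s 1 (fun s => - l^-1 * expR (- l * s)) (expR (- l * s)).
  have d1 : is_derive s 1 (fun s => - l * s) (- l).
    have := @is_deriveZ R R R id (- l) s 1 1 (is_derive_id _ _).
    by move=> [d e]; apply: DeriveDef => //; rewrite e /GRing.scale /= mulr1.
  have d2 := @is_derive1_comp R expR (fun s => - l * s) s _ _ (is_derive_expR _) d1.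
  have := @is_deriveZ R R R (expR \o (fun s => - l * s)) (- l^-1) s 1 _ d2.
  move=> [d e]; apply: DeriveDef => //; rewrite e /GRing.scale /=.
  by rewrite mulrCA mulrNN mulVf // mulr1.
have T0 : 0 <= T <= T by rewrite lexx ltW.
rewrite tailE //; last exact: continuous_sqint.
rewrite -primT !(prim_ftc2 T_gt0 ce dF) //.
rewrite (_ : l * _ = expR (- l * t) - expR (- l * T)); last by field.
by rewrite lerBlDr lerDl expR_ge0.
Qed.

(** Let S be the maximum of e(t) exp(2 L t), reached at p. With this weight, L times the tail at p
    is at most S exp(- 2 L p) / 2, so half of the maximum is absorbed and S <= 2 A exp(2 L p). The
    factor 2 is the price of avoiding iteration. *)
Lemma gronwall (e : R -> R) (A L : R) : continuous e -> (forall t, 0 <= e t) -> 0 < L ->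
  (forall t, 0 <= t <= T -> e t <= A + L * tail e t) ->
  forall t, 0 <= t <= T -> e t <= 2 * A * expR (2 * L * T).
Proof.
move=> ce e0 L0 H; set l := 2 * L.
have l0 : 0 < l by rewrite mulr_gt0.
have ce' : continuous (fun s : R => expR (- l * s)).
  move=> s; apply: (@continuous_comp _ _ _ (fun s => - l * s) expR); last exact: continuous_expR.
  by apply: cvgM; [exact: cvg_cst|exact: cvg_id].
have cl : continuous (fun t => e t * expR (l * t)).
  move=> t; apply: cvgM; first exact: ce.
  apply: (@continuous_comp _ _ _ (fun s => l * s) expR); last exact: continuous_expR.
  by apply: cvgM; [exact: cvg_cst|exact: cvg_id].
have [p pT pmax] := EVT_max (ltW T_gt0) (continuous_subspaceT (A := `[0, T]) cl).
move: pT; rewrite in_itv /= => pT; set S := e p * expR (l * p) in pmax.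
have eS t : 0 <= t <= T -> e t <= S * expR (- l * t).
  move=> tT; have := pmax t; rewrite in_itv /= => /(_ tT) h.
  by rewrite mulNr expRN ler_pdivlMr ?expR_gt0.
have S0 : 0 <= S by rewrite mulr_ge0 // expR_ge0.
have se := continuous_sqint ce; have sexp := continuous_sqint ce'.
have h1 : tail e p <= S * tail (fun s => expR (- l * s)) p.
  rewrite !tail_ip -ipZl //; last exact: sqint_after.
  apply: le_tail => //; first exact: sqintZ.
  by move=> s; rewrite /= in_itv /= => /andP[/ltW s0 /ltW sT] _; apply: eS; rewrite s0.
have h2 := tail_expR l0 pT.
have h3 : L * tail e p <= S * expR (- l * p) / 2.
  apply: le_trans (ler_wpM2l (ltW L0) h1) _.
  have := ler_wpM2l S0 h2; rewrite /l; lra.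
have A0 : S <= 2 * A * expR (l * p).
  have h4 := H p pT; have ep : 0 < expR (l * p) by exact: expR_gt0.
  have h5 : e p <= A + S * expR (- l * p) / 2 by lra.
  have h6 : e p = S * expR (- l * p).
    by rewrite mulNr expRN /S mulfK // lt0r_neq0.
  rewrite -ler_pdivrMr // -expRN -mulNr -h6; lra.
move=> t tT; apply: le_trans (eS t tT) _.
have A1 : 0 <= A.
  by move: (le_trans S0 A0); rewrite pmulr_lge0 ?expR_gt0 // pmulr_rge0.
apply: le_trans (_ : S * 1 <= _).
  have t0 : 0 <= t by case/andP: tT.
  by rewrite ler_wpM2l // -[leRHS]expR0 ler_expR mulNr oppr_le0 mulr_ge0 // ltW.
rewrite mulr1; apply: le_trans A0 _; rewrite ler_wpM2l ?mulr_ge0 // ler_expR ler_wpM2l ?(ltW l0) //.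
by case/andP: pT.
Qed.
End Gronwall.

(** * The gradient of the action with respect to the velocity *)

Section Variational.
Context {R : realType} (T : R) (T_gt0 : 0 < T) (c : R) (c_gt0 : 0 < c).
Variables (V g : R -> R) (M : R).
Hypotheses (HV : smooth_bound M V) (Hg : smooth_bound M g).
Notation prim := (prim T).
Notation tail := (tail T).
Notation ip := (ip T).
Notation iD := (iD T).
Notation intg := (intg T).
Notation sqint := (sqint T).
Notation nrm := (nrm T).
Notation lagr := (lagr T c V).
Notation act := (act T c V g).
Implicit Types (u w h : R -> R) (x t : R).
Notation V' := (derive1 V).
Notation g' := (derive1 g).

Lemma M_ge0 : 0 <= M. Proof. by case: HV. Qed.

Lemma V_continuous : continuous V.
Proof. by case: HV => _ _ lV _ _; apply: (@continuous_lipschitz _ _ M) => s t; exact: lV. Qed.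

Lemma V'_continuous : continuous V'.
Proof. by case: HV => _ _ _ lV _; apply: (@continuous_lipschitz _ _ M) => s t; exact: lV. Qed.

Definition path x u t := x + prim u t.
Definition force x u t := V' (path x u t).
(** Up to the factor - 1 / c, the L^2 gradient in [u] of the potential part of [act]; see
    [costate_prim]. *)
Definition costate x u t := - (g' (path x u T) + tail (force x u) t) / c.
(** [c] times this is the L^2 gradient of [act]. Its vanishing is the Euler-Lagrange equation
    integrated once, with the transversality condition at [T] built in. *)
Definition resid w x u t := u t + w t / c - costate x u t.

Lemma pathE x u t : path x u t = x + prim u t. Proof. by []. Qed.

Lemma costateE x u t : costate x u t = - (g' (path x u T) + tail (force x u) t) / c.
Proof. by []. Qed.

Lemma residE w x u t : resid w x u t = u t + w t / c - costate x u t.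
Proof. by []. Qed.

Lemma act_lagr w x u : act w x u = iD (lagr w x u) + g (path x u T).
Proof. by []. Qed.

Lemma path_continuous x u : sqint u -> continuous (path x u).
Proof. by move=> su t; apply: cvgD; [exact: cvg_cst|exact: prim_continuous]. Qed.

Lemma comp_path_continuous (F : R -> R) x u : continuous F -> sqint u ->
  continuous (fun t => F (path x u t)).
Proof.
move=> cF su t; apply: (@continuous_comp _ _ _ (path x u) F); last exact: cF.
exact: path_continuous.
Qed.

Lemma force_sqint x u : sqint u -> sqint (force x u).
Proof. by move=> su; apply: continuous_sqint => //; apply: comp_path_continuous => //; exact: V'_continuous. Qed.

Lemma costate_continuous x u : sqint u -> continuous (costate x u).
Proof.
move=> su t; apply: cvgM; last exact: cvg_cst.
apply: cvgN; apply: cvgD; first exact: cvg_cst.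
by apply: tail_continuous => //; exact: force_sqint.
Qed.

(** Free of [x] and [u]: it bounds optimal velocities uniformly over all starting points. *)
Definition costate_bound := M * (1 + T) / c.

Lemma costate_le x u t : sqint u -> `|costate x u t| <= costate_bound.
Proof.
move=> su; rewrite /costate /costate_bound normrM normrN normfV (gtr0_norm c_gt0).
rewrite ler_pM2r ?invr_gt0 // mulrDr mulr1; apply: le_trans (ler_normD _ _) _.
apply: lerD; first by case: Hg.
have sa := sqint_after T_gt0 t.
apply: norm_iD_le => //.
  by apply: measurable_funM; [case: (force_sqint x su)|case: sa].
move=> s _; rewrite normrM -[leRHS]mulr1; apply: ler_pM => //; last exact: after_le1.
by case: HV => _ h _ _ _; exact: h.
Qed.

Lemma costate_sqint x u : sqint u -> sqint (costate x u).
Proof. by move=> su; apply: continuous_sqint => //; exact: costate_continuous. Qed.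

Lemma sqint_divc w : sqint w -> sqint (fun t => w t / c).
Proof. by move=> sw; under eq_fun do rewrite mulrC; exact: sqintZ. Qed.

Lemma resid_sqint w x u : sqint w -> sqint u -> sqint (resid w x u).
Proof.
move=> sw su; apply: sqintB; last exact: costate_sqint.
by apply: sqintD => //; exact: sqint_divc.
Qed.

Lemma intg_comp_path (F : R -> R) x u : continuous F -> sqint u -> intg (fun t => F (path x u t)).
Proof.
by move=> cF su; apply: sqint_intg => //; apply: continuous_sqint => //; exact: comp_path_continuous.
Qed.

Lemma intg_lagr w x u : sqint w -> sqint u -> intg (lagr w x u).
Proof.
move=> sw su; apply: intgD; last by apply: intg_comp_path => //; exact: V_continuous.
by apply: intgD; [apply: intgZ; case: su|exact: sqint_mul].
Qed.

Lemma actE w x u : sqint w -> sqint u ->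
  act w x u = c / 2 * ip u u + ip u w + iD (fun t => V (path x u t)) + g (path x u T).
Proof.
move=> sw su; rewrite !act_lagr; congr (_ + _).
have i1 : intg (fun t => c / 2 * u t ^+ 2) by apply: intgZ; case: su.
have i2 := sqint_mul su sw.
have i3 : intg (fun t => V (path x u t)) by apply: intg_comp_path => //; exact: V_continuous.
rewrite -[LHS]/(iD (fun t => c / 2 * u t ^+ 2 + u t * w t + V (path x u t))).
rewrite iDD // ?iDD //; last exact: intgD.
by rewrite iDZ //; case: su.
Qed.

Lemma costate_prim x u r : sqint u -> sqint r ->
  ip (force x u) (prim r) + g' (path x u T) * prim r T = - c * ip (costate x u) r.
Proof.
move=> su sr; rewrite (ip_prim T_gt0 (force_sqint x su) sr) primT // -iDZ; last exact: sqint_intg.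
have st : sqint (tail (force x u)).
  by apply: continuous_sqint => //; apply: tail_continuous => //; exact: force_sqint.
rewrite !ipE -iDD; [|exact: sqint_mul|by apply: intgZ; exact: sqint_intg].
rewrite -iDZ; last by apply: sqint_mul => //; exact: costate_sqint.
by apply: eq_iD => t _; rewrite /costate; field; rewrite lt0r_neq0.
Qed.

(** Second-order coefficient of a gradient step: c / 2 is kinetic, and since |prim r|^2 <= T |r|^2
    the potentials [V], integrated over a time [T], and [g] contribute M T T and M T. *)
Definition step_cst := c / 2 + M * (T * T + T).

Lemma gradient_step w x u (th : R) : sqint w -> sqint u ->
  act w x (fun t => u t - th * resid w x u t)
  <= act w x u - th * c * nrm (resid w x u) ^+ 2 + th ^+ 2 * (step_cst * nrm (resid w x u) ^+ 2).
Proof.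
move=> sw su; set r := resid w x u; have sr : sqint r by exact: resid_sqint.
have str := sqintZ th sr; have sv := sqintB su str.
have Rb t : prim r t ^+ 2 <= T * nrm r ^+ 2.
  rewrite -[leLHS](real_normK (num_real _)) -[X in X * _](sqr_sqrtr (ltW T_gt0)) -exprMn.
  by rewrite ler_sqr ?nnegrE ?mulr_ge0 ?sqrtr_ge0 ?nrm_ge0 // mulrC prim_le.
have pE t : path x (fun t => u t - th * r t) t = path x u t + - th * prim r t.
  by rewrite /path primB // primZ //; ring.
have spr := prim_sqint T_gt0 sr; have sf := force_sqint x su.
have hV : iD (fun t => V (path x (fun t => u t - th * r t) t)) <=
    iD (fun t => V (path x u t)) - th * ip (force x u) (prim r) + M * th ^+ 2 * (T * nrm r ^+ 2) * T.
  have iV : intg (fun t => V (path x u t)) by apply: intg_comp_path => //; exact: V_continuous.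
  have iF := sqint_mul sf spr.
  rewrite -(iD_cst T_gt0 (M * th ^+ 2 * (T * nrm r ^+ 2))) -[th * _](iDZ _ iF) -iDB //; last exact: intgZ.
  rewrite -iDD; [|by apply: intgB => //; exact: intgZ|exact: intg_cst].
  apply: le_iD.
  - by apply: intg_comp_path => //; exact: V_continuous.
  - by apply: intgD; [apply: intgB => //; exact: intgZ|exact: intg_cst].
  move=> t _; rewrite pE; case: HV => M0 _ _ _ tV.
  apply: le_trans (tV _ _) _; rewrite /force.
  have := ler_wpM2l (mulr_ge0 M0 (sqr_ge0 th)) (Rb t).
  rewrite exprMn sqrrN mulrA; lra.
have hg : g (path x (fun t => u t - th * r t) T) <=
    g (path x u T) - th * (g' (path x u T) * prim r T) + M * th ^+ 2 * (T * nrm r ^+ 2).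
  rewrite pE; case: Hg => M0 _ _ _ tg; apply: le_trans (tg _ _) _.
  have := ler_wpM2l (mulr_ge0 M0 (sqr_ge0 th)) (Rb T).
  rewrite exprMn sqrrN mulrA; lra.
have e1 : ip (fun t => u t - th * r t) (fun t => u t - th * r t) =
    ip u u - 2 * th * ip u r + th ^+ 2 * nrm r ^+ 2.
  rewrite (ip_sqrB su str) (ipZl th sr str) (ipC T r) (ipZl th sr sr) (ipC T u) (ipZl th sr su).
  by rewrite nrm_sqr (ipC T r u); ring.
have e2 : ip (fun t => u t - th * r t) w = ip u w - th * ip r w by rewrite ipBl // ipZl.
have e3 : nrm r ^+ 2 = ip u r + ip w r / c - ip (costate x u) r.
  have swc := sqint_divc sw; have suw := sqintD su swc; have sk := costate_sqint x su.
  rewrite nrm_sqr {1}/r [ip _ r](ipBl suw sk sr) ipDl //.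
  by rewrite (_ : (fun t => w t / c) = (fun t => c^-1 * w t)) ?ipZl 1?mulrC //; apply/funext => t; rewrite mulrC.
have e4 := costate_prim x su sr.
have e5 : c * nrm r ^+ 2 = c * ip u r + ip r w + ip (force x u) (prim r) + g' (path x u T) * prim r T.
  by rewrite -addrA e4 e3 (ipC _ r w); field; rewrite lt0r_neq0.
rewrite !actE // e1 e2 -[th * c * _]mulrA e5 /step_cst; move: hV hg.
set X := iD _; set Y := iD _; set N := nrm r ^+ 2; lra.
Qed.

Lemma step_cst_gt0 : 0 < step_cst.
Proof.
rewrite /step_cst ltr_pwDl ?divr_gt0 // mulr_ge0 ?M_ge0 // addr_ge0 ?mulr_ge0 ?ltW //.
Qed.

Lemma near_min_resid w x u (m d : R) : sqint w -> sqint u ->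
  (forall u', sqint u' -> m <= act w x u') -> act w x u <= m + d ->
  nrm (resid w x u) ^+ 2 <= 4 * step_cst / c ^+ 2 * d.
Proof.
move=> sw su mlb ud; have K0 := step_cst_gt0; set K := step_cst in K0 *.
(* This step length maximises the guaranteed decrease (th c - th^2 K) N, whose maximum is N c^2 / (4
   K). As the action cannot fall below [m], this decrease is at most [d]. *)
have := gradient_step x (c / (2 * K)) sw su => /=.
set r := resid w x u; set N := nrm r ^+ 2.
have sr : sqint r by exact: resid_sqint.
have := mlb _ (sqintB su (sqintZ (c / (2 * K)) sr)) => h1 h2.
have : c / (2 * K) * c * N - (c / (2 * K)) ^+ 2 * (K * N) <= d.
  by move: h1 h2 ud; rewrite -/K; set A := act _ _ _; set B := act _ _ _; lra.
rewrite (_ : _ - _ = N / (4 * K / c ^+ 2)); last by field; rewrite !lt0r_neq0.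
by rewrite ler_pdivrMr 1?mulrC // !mulr_gt0 // invr_gt0 exprn_gt0.
Qed.

End Variational.

(** * Backward stability and compactness of minimising sequences *)

Section Stability.
Context {R : realType} (T : R) (T_gt0 : 0 < T) (c : R) (c_gt0 : 0 < c).
Variables (V g : R -> R) (M : R).
Hypotheses (HV : smooth_bound M V) (Hg : smooth_bound M g).
Notation D := (`]0, T[%classic : set (measurableTypeR R)).
Notation tail := (tail T).
Notation ip := (ip T).
Notation iD := (iD T).
Notation sqint := (sqint T).
Notation nrm := (nrm T).
Notation act := (act T c V g).
Notation path := (path T).
Notation force := (force T V).
Notation costate := (costate T c V g).
Notation resid := (resid T c V g).
Implicit Types (u w h : R -> R) (x t : R).
Notation g' := (derive1 g).

(** M T / c is the coefficient that the estimate produces; adding 1 keeps it positive when M = 0, as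
    [gronwall] requires. *)
Definition rate := M * T / c + 1.
(** The [gronwall] factor times the sum of the coefficients 1 + M T / c of the endpoint gap and sqrt
    T of the residuals. *)
Definition path_cst := 2 * expR (2 * rate * T) * (1 + M * T / c + Num.sqrt T).
Definition costate_cst := (M + M * T * path_cst) / c.

Lemma rate_gt0 : 0 < rate.
Proof. by rewrite ltr_wpDl // divr_ge0 ?mulr_ge0 ?(M_ge0 HV) ?ltW. Qed.

Lemma path_cst_ge0 : 0 <= path_cst.
Proof.
have := sqrtr_ge0 T; have := expR_ge0 (2 * rate * T).
have : 0 <= M * T / c by rewrite divr_ge0 ?mulr_ge0 ?(M_ge0 HV) ?ltW.
by move=> h1 h2 h3; rewrite /path_cst mulr_ge0 ?mulr_ge0 // !addr_ge0.
Qed.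

Lemma tail_ge0 (f : R -> R) t : (forall s, 0 <= f s) -> 0 <= tail f t.
Proof. by move=> f0; apply: iD_ge0 => s _; rewrite mulr_ge0 // /after. Qed.

Lemma tail_nonincr (f : R -> R) s t : sqint f -> (forall s, 0 <= f s) -> t <= s -> tail f s <= tail f t.
Proof.
move=> sf f0 ts; apply: le_iD; [by apply: sqint_mul => //; exact: sqint_after..|].
move=> r _; rewrite ler_wpM2l // /after; case: (ltP s r) => sr; last exact: ler0n.
by rewrite (le_lt_trans ts sr).
Qed.

Section Pair.
Variables (w : R -> R) (x1 x2 : R) (u1 u2 : R -> R).
Hypotheses (sw : sqint w) (su1 : sqint u1) (su2 : sqint u2).
Let a : R := `|path x1 u1 T - path x2 u2 T|.
Let rho : R := nrm (resid w x1 u1) + nrm (resid w x2 u2).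
Let e (t : R) : R := `|path x1 u1 t - path x2 u2 t|.

Let e_continuous : continuous e.
Proof.
move=> t; apply: (@continuous_comp _ _ _ (fun t => path x1 u1 t - path x2 u2 t) Num.norm).
  by apply: cvgB; exact: path_continuous.
exact: norm_continuous.
Qed.

Let costate_diff t : `|costate x1 u1 t - costate x2 u2 t| <= (M * a + M * tail e t) / c.
Proof.
have sf1 := force_sqint T_gt0 HV x1 su1; have sf2 := force_sqint T_gt0 HV x2 su2.
have se := continuous_sqint T_gt0 e_continuous.
have -> : costate x1 u1 t - costate x2 u2 t = - ((g' (path x1 u1 T) - g' (path x2 u2 T)) +
   tail (fun s => force x1 u1 s - force x2 u2 s) t) / c.
  rewrite [tail (fun s => _ - _) t](ipBl sf1 sf2 (sqint_after T_gt0 t)).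
  have alg (p q r s : R) : - (p + r) / c - (- (q + s) / c) = - ((p - q) + (r - s)) / c by ring.
  exact: alg.
rewrite normrM normrN normfV (gtr0_norm c_gt0) ler_pM2r ?invr_gt0 //.
apply: le_trans (ler_normD _ _) _; apply: lerD.
  by case: Hg => _ _ _ l _; exact: l.
apply: le_trans (norm_tail T_gt0 _ (sqintB sf1 sf2)) _.
rewrite -[leRHS](ipZl M se (sqint_after T_gt0 t)); apply: le_tail => //.
- by apply: sqint_norm; exact: sqintB.
- exact: sqintZ.
by move=> s _ _; case: HV => _ _ _ l _; exact: l.
Qed.

Let path_diff t : 0 <= t <= T -> e t <= (a * (1 + M * T / c) + rho * Num.sqrt T) + rate * tail e t.
Proof.
move=> tT; have se := continuous_sqint T_gt0 e_continuous.
have sr1 : sqint (resid w x1 u1) by apply: resid_sqint; try exact: HV.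
have sr2 : sqint (resid w x2 u2) by apply: resid_sqint; try exact: HV.
have sk1 : sqint (costate x1 u1) by apply: costate_sqint; try exact: HV.
have sk2 : sqint (costate x2 u2) by apply: costate_sqint; try exact: HV.
have sr := sqintB sr1 sr2; have sk := sqintB sk1 sk2; have sa := sqint_after T_gt0 t.
(* Read backward from [T]. Since [w / c] is common to both, the velocities differ by residuals and
   costates only. *)
have E : path x1 u1 t - path x2 u2 t = path x1 u1 T - path x2 u2 T
    - (tail (fun s => resid w x1 u1 s - resid w x2 u2 s) t
      + tail (fun s => costate x1 u1 s - costate x2 u2 s) t).
  rewrite !tail_ip -(ipDl sr sk sa).
  rewrite -[ip _ _]/(tail _ t).
  rewrite (_ : tail _ t = tail u1 t - tail u2 t).
    by rewrite !tailE // -!primT !pathE; ring.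
  have alg (p q k l1 l2 : R) : (p + k - l1) - (q + k - l2) + (l1 - l2) = p - q by ring.
  by rewrite !tail_ip -ipBl //; apply: eq_iD => s _; congr (_ * _); exact: alg.
rewrite /e E; apply: le_trans (ler_normB _ _) _; apply: le_trans (lerD (lexx _) (ler_normD _ _)) _.
have h1 : `|tail (fun s => resid w x1 u1 s - resid w x2 u2 s) t| <= rho * Num.sqrt T.
  apply: le_trans (tail_nrm T_gt0 t sr) _.
  by rewrite ler_wpM2r ?sqrtr_ge0 //; exact: nrmB.
have e0 s : 0 <= e s by rewrite normr_ge0.
have te0 := tail_ge0 t e0.
have a0 : 0 <= a by rewrite normr_ge0.
have M0 := M_ge0 HV.
have k0 : 0 <= (M * a + M * tail e t) / c by rewrite divr_ge0 ?(ltW c_gt0) // addr_ge0 ?mulr_ge0.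
(* For s > t the tail of [e] at s is at most its tail at t, so the double integral is bounded by [T]
   times a single one. *)
have h2 : `|tail (fun s => costate x1 u1 s - costate x2 u2 s) t| <= (M * a + M * tail e t) / c * T.
  apply: le_trans (norm_tail T_gt0 t sk) _; apply: le_trans (tail_cst_le T_gt0 k0 tT).
  apply: le_tail => //; [exact: sqint_norm|exact: sqint_cst|].
  move=> s _ /ltW ts; apply: le_trans (costate_diff s) _.
  rewrite ler_pM2r ?invr_gt0 // lerD2l ler_wpM2l //; exact: tail_nonincr.
have -> : a * (1 + M * T / c) + rho * Num.sqrt T + rate * tail e t =
  a + (rho * Num.sqrt T + (M * a + M * tail e t) / c * T) + tail e t by rewrite /rate; ring.
apply: ler_wpDr => //; apply: lerD => //; exact: lerD.
Qed.

Lemma path_stability t : 0 <= t <= T ->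
  `|path x1 u1 t - path x2 u2 t| <= path_cst * (`|path x1 u1 T - path x2 u2 T|
     + (nrm (resid w x1 u1) + nrm (resid w x2 u2))).
Proof.
move=> tT; have e0 s : 0 <= e s by rewrite normr_ge0.
apply: le_trans (gronwall T_gt0 e_continuous e0 rate_gt0 path_diff tT) _.
rewrite -/a -/rho /path_cst.
have a0 : 0 <= a by rewrite normr_ge0.
have r0 : 0 <= rho by rewrite addr_ge0 ?nrm_ge0.
have s0 := sqrtr_ge0 T.
have m0 : 0 <= M * T / c by rewrite divr_ge0 ?mulr_ge0 ?(M_ge0 HV) ?ltW.
have E0 := expR_ge0 (2 * rate * T).
rewrite [leLHS]mulrAC -[leRHS]mulrA; apply: ler_wpM2l; first by rewrite mulr_ge0.
move: m0 s0; set m := M * T / c; set s := Num.sqrt T => m0 s0.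
rewrite -subr_ge0 (_ : _ - _ = rho + m * rho + s * a); last by ring.
by apply: addr_ge0; [apply: addr_ge0 => //; exact: mulr_ge0|exact: mulr_ge0].
Qed.

(** The bound is uniform over all real [t]; this turns convergence of endpoints into uniform
    convergence of costates. *)
Lemma costate_stability t :
  `|costate x1 u1 t - costate x2 u2 t| <= costate_cst * (`|path x1 u1 T - path x2 u2 T|
     + (nrm (resid w x1 u1) + nrm (resid w x2 u2))).
Proof.
apply: le_trans (costate_diff t) _; rewrite -/a -/rho /costate_cst mulrAC.
rewrite ler_pM2r ?invr_gt0 // mulrDl; have M0 := M_ge0 HV.
have r0 : 0 <= rho by rewrite addr_ge0 ?nrm_ge0.
apply: lerD; first by rewrite ler_wpM2l // lerDl.
have -> : M * T * path_cst * (a + rho) = M * (path_cst * (a + rho) * T).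
  by move: path_cst => pc; ring.
rewrite ler_wpM2l //; apply: le_trans (ler_norm _) _; apply: norm_iD_le => //.
  apply: measurable_funM; first by case: (continuous_sqint T_gt0 e_continuous).
  exact: measurable_after.
move=> s; rewrite /= in_itv /= => /andP[/ltW s0 /ltW sT].
rewrite normrM -[leRHS]mulr1; apply: ler_pM => //; last exact: after_le1.
by rewrite normr_id; apply: path_stability; rewrite s0.
Qed.
End Pair.


Lemma potential_lipschitz x1 x2 u1 u2 (B : R) : sqint u1 -> sqint u2 ->
  (forall t, 0 <= t <= T -> `|path x1 u1 t - path x2 u2 t| <= B) ->
  iD (fun t => V (path x1 u1 t)) + g (path x1 u1 T)
  <= iD (fun t => V (path x2 u2 t)) + g (path x2 u2 T) + M * (T + 1) * B.
Proof.
move=> su1 su2 H; have M0 := M_ge0 HV.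
have i1 := intg_comp_path T_gt0 x1 (V_continuous HV) su1.
have i2 := intg_comp_path T_gt0 x2 (V_continuous HV) su2.
have lip f p q : smooth_bound M f -> `|p - q| <= B -> f p <= f q + M * B.
  case=> _ _ l _ _ pq; rewrite -lerBlDl; apply: le_trans (ler_norm _) _.
  by apply: le_trans (l _ _) _; rewrite ler_wpM2l.
have h1 : iD (fun t => V (path x1 u1 t)) <= iD (fun t => V (path x2 u2 t)) + M * B * T.
  rewrite -(iD_cst T_gt0) -iDD //; last exact: intg_cst.
  apply: le_iD => //; first by apply: intgD => //; exact: intg_cst.
  move=> t; rewrite /= in_itv /= => /andP[/ltW t0 /ltW tT].
  by apply: lip => //; apply: H; rewrite t0.
have h2 : g (path x1 u1 T) <= g (path x2 u2 T) + M * B.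
  by apply: lip => //; apply: H; rewrite lexx ltW.
by move: h1 h2; set X := iD _; set Y := iD _; lra.
Qed.

Lemma act_lipschitz w x1 x2 u : sqint w -> sqint u ->
  act w x1 u <= act w x2 u + M * (T + 1) * `|x1 - x2|.
Proof.
move=> sw su; rewrite !(actE T_gt0 c g HV) //.
have := @potential_lipschitz x1 x2 u u `|x1 - x2| su su.
set X := iD _; set Y := iD _; move: (g _) (g _) => p q H.
suff : X + q <= Y + p + M * (T + 1) * `|x1 - x2| by lra.
by apply: H => t _; rewrite !pathE opprD addrACA subrr addr0.
Qed.

Lemma act_continuous w x u1 u2 : sqint w -> sqint u1 -> sqint u2 ->
  act w x u1 <= act w x u2 + nrm (fun t => u1 t - u2 t) *
    (c / 2 * (nrm u1 + nrm u2) + nrm w + M * (T + 1) * Num.sqrt T).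
Proof.
move=> sw su1 su2; rewrite !(actE T_gt0 c g HV) //; have sd := sqintB su1 su2.
set n := nrm (fun t => _).
have h1 : ip u1 u1 - ip u2 u2 <= n * (nrm u1 + nrm u2).
  have -> : ip u1 u1 - ip u2 u2 = ip (fun t => u1 t - u2 t) (fun t => u1 t + u2 t).
    have ss := sqintD su1 su2.
    rewrite (ipBl su1 su2 ss) (ipC T u1 (fun t => u1 t + u2 t)) (ipC T u2 (fun t => u1 t + u2 t)).
    by rewrite (ipDl su1 su2 su1) (ipDl su1 su2 su2) (ipC T u2 u1); ring.
  apply: le_trans (ler_norm _) _; apply: le_trans (cauchy_schwarz sd (sqintD su1 su2)) _.
  by rewrite ler_wpM2l ?nrm_ge0 // nrmD.
have h2 : ip u1 w - ip u2 w <= n * nrm w.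
  rewrite -ipBl //; apply: le_trans (ler_norm _) _; exact: cauchy_schwarz.
have h3 : iD (fun t => V (path x u1 t)) + g (path x u1 T)
  <= iD (fun t => V (path x u2 t)) + g (path x u2 T) + M * (T + 1) * (n * Num.sqrt T).
  apply: potential_lipschitz => // t _.
  rewrite !pathE opprD addrACA subrr add0r -primB //; exact: prim_le.
have h4 := ler_wpM2l (ltW (divr_gt0 c_gt0 (ltr0n R 2))) h1.
move: h2 h3 h4; set X := iD _; set Y := iD _.
move: (ip u1 u1) (ip u2 u2) (ip u1 w) (ip u2 w) (g _) (g _) (Num.sqrt T) => *; lra.
Qed.

Lemma act_lower_bound w x : sqint w -> exists m, forall u, sqint u -> m <= act w x u.
Proof.
move=> sw; have M0 := M_ge0 HV.
pose b := nrm w + M * (T + 1) * Num.sqrt T.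
have s0 : sqint (fun=> 0) by exact: sqint_cst.
pose v0 := iD (fun t => V (path x (fun=> 0) t)) + g (path x (fun=> 0) T).
exists (v0 - b ^+ 2 / (2 * c)) => u su; rewrite (actE T_gt0 c g HV) //.
have h1 : v0 <= iD (fun t => V (path x u t)) + g (path x u T) + M * (T + 1) * (nrm u * Num.sqrt T).
  apply: potential_lipschitz => // t _; rewrite !pathE opprD addrACA subrr add0r.
  rewrite -primB // (eq_prim (w := fun t => - 1 * u t)); last by move=> s _; rewrite sub0r mulN1r.
  by rewrite primZ // mulN1r normrN; exact: prim_le.
have h2 : - (nrm u * nrm w) <= ip u w.
  have := cauchy_schwarz su sw; rewrite ler_norml => /andP[] //.
(* Completing the square: the kinetic term absorbs the pairing with [w] and the potentials, both at
   most linear in the norm of [u]. *)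
have h3 : 0 <= (c * nrm u - b) ^+ 2 / (2 * c) by rewrite divr_ge0 ?sqr_ge0 // mulr_ge0 // ltW.
have E : (c * nrm u - b) ^+ 2 / (2 * c) = c / 2 * ip u u - b * nrm u + b ^+ 2 / (2 * c).
  by rewrite -nrm_sqr; field; rewrite lt0r_neq0.
move: h1 h2 h3; rewrite E /b; set X := iD _.
move: (ip u u) (ip u w) (g _) (Num.sqrt T) (_ / (2 * c)) => *; lra.
Qed.

Lemma bounded_cluster (a : nat -> R) (K : R) : (forall n, `|a n| <= K) ->
  exists p, forall e, 0 < e -> forall N, exists2 n, (N <= n)%N & `|a n - p| < e.
Proof.
move=> aK; have /(_ (a @ \oo) _) := @segment_compact R (- K) K.
case.
  by exists 0%N => // n _; rewrite /= in_itv /= -ler_norml.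
move=> p [_ cp]; exists p => e e0 N.
have [|y [[n /= Nn <-] /= ye]] := cp [set a n | n in [set n | (N <= n)%N]] (ball p e) _ (nbhsx_ballx p e e0).
  by exists N => // n Nn; exists n.
by exists n => //; rewrite distrC.
Qed.

Lemma uniform_cauchy_limit (k : nat -> R -> R) (d : nat -> R) :
  (forall i j t, `|k i t - k j t| <= d i + d j) ->
  (forall e, 0 < e -> exists N, forall i, (N <= i)%N -> d i <= e) ->
  exists l : R -> R, (forall t, k ^~ t @ \oo --> l t) /\ forall i t, `|k i t - l t| <= d i.
Proof.
move=> kd d0; have cv t : cvg (k ^~ t @ \oo).
  apply: cauchy_cvg; apply/cauchy_ballP => e e0.
  have [N Ne] := d0 _ (divr_gt0 e0 (ltr0n R 4)).
  rewrite near_simpl /=.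
  exists ([set i | (N <= i)%N], [set i | (N <= i)%N]); first by split; exists N.
  move=> [i j] [/= Ni Nj]; rewrite /ball /=.
  by apply: le_lt_trans (kd i j t) _; have := Ne _ Ni; have := Ne _ Nj; lra.
exists (fun t => lim (k ^~ t @ \oo)); split=> // i t.
apply/ler_addgt0Pr => e e0; have [N Ne] := d0 _ (divr_gt0 e0 (ltr0n R 2)).
have /cvgrPdist_le/(_ _ (divr_gt0 e0 (ltr0n R 2)))[N' _ N'e] := cv t.
pose j := maxn N N'; have := N'e j; rewrite /= leq_maxr => /(_ isT) h1.
have h2 := Ne j (leq_maxl _ _); have h3 := kd i j t.
rewrite (_ : k i t - _ = (k i t - k j t) - (lim (k ^~ t @ \oo) - k j t)); last by ring.
by apply: le_trans (ler_normB _ _) _; lra.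
Qed.

(** Each [u_ n] is its residual, minus the fixed [w / c], plus its costate. The residuals tend to 0
    and the costates converge uniformly along a subsequence with convergent endpoints, so the
    cluster point is strong and [act] passes to the limit by continuity. Existence and
    well-posedness both rest on this. *)
Lemma minimizing_cluster w x (m : R) (u_ : nat -> R -> R) : sqint w -> (forall n, sqint (u_ n)) ->
  (forall u, sqint u -> m <= act w x u) ->
  (forall n, act w x (u_ n) <= m + n.+1%:R^-1) ->
  exists u, [/\ sqint u, act w x u = m &
    forall e, 0 < e -> forall N, exists2 n, (N <= n)%N & nrm (fun t => u_ n t - u t) <= e].
Proof.
move=> sw su mlb mub.
pose K0 := 4 * step_cst T c M / c ^+ 2.
have K00 : 0 <= K0.
  rewrite divr_ge0 ?exprn_ge0 ?(ltW c_gt0) // mulr_ge0 //.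
  exact: ltW (step_cst_gt0 T_gt0 c_gt0 HV).
pose rho n := nrm (resid w x (u_ n)).
have rho0 n : 0 <= rho n by exact: nrm_ge0.
have rho2 n : rho n ^+ 2 <= K0 * n.+1%:R^-1 := near_min_resid T_gt0 c_gt0 HV Hg sw (su n) mlb (mub n).
have rhoe e : 0 < e -> exists N, forall n, (N <= n)%N -> rho n <= e.
  move=> e0; have d0 : 0 < e ^+ 2 / (K0 + 1) by rewrite divr_gt0 ?exprn_gt0 // ltr_wpDl.
  have [N _ Ne] := near_infty_natSinv_lt (PosNum d0).
  exists N => n Nn; rewrite -ler_sqr ?nnegrE ?(ltW e0) //; apply: le_trans (rho2 n) _.
  apply: le_trans (ler_wpM2l K00 (ltW (Ne n Nn))) _ => /=.
  by rewrite mulrCA ler_piMr ?sqr_ge0 // ler_pdivrMr ?mul1r ?lerDl // ltr_wpDl.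
have swc := sqint_divc c sw.
have sk n : sqint (costate x (u_ n)) by apply: costate_sqint; try exact: HV.
have sr n : sqint (resid w x (u_ n)) by apply: resid_sqint; try exact: HV.
pose B := costate_bound T c M.
have kB n t : `|costate x (u_ n) t| <= B by exact: (costate_le T_gt0 c_gt0 HV Hg).
(* The bound 1 + K0 for a residual r comes from r^2 <= K0 and (r - 1)^2 >= 0, which avoids a square
   root. *)
pose U := (1 + K0) + nrm (fun t => w t / c) + B * Num.sqrt T.
have uU n : nrm (u_ n) <= U.
  rewrite (@eq_nrm _ _ _ (fun t => (resid w x (u_ n) t - w t / c) + costate x (u_ n) t)); last first.
    have alg (p q r : R) : p = (p + q - r) - q + r by ring.
    by move=> t _; exact: alg.
  apply: le_trans (nrmD (sqintB (sr n) swc) (sk n)) _; apply: lerD.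
    apply: le_trans (nrmB (sr n) swc) _; rewrite lerD2r -/(rho n).
    have n1 : n.+1%:R^-1 <= 1 :> R by rewrite invf_le1 // ler1n.
    have alg (r k0 k : R) : 0 <= k0 -> r ^+ 2 <= k -> k <= k0 * 1 -> r <= 1 + k0.
      by have := sqr_ge0 (r - 1); move=> *; lra.
    exact: alg K00 (rho2 n) (ler_wpM2l K00 n1).
  by apply: nrm_bounded => //; case: (sk n).
pose a n := path x (u_ n) T.
have [|p pP] := @bounded_cluster a (`|x| + U * Num.sqrt T).
  move=> n; apply: le_trans (ler_normD _ _) _; rewrite lerD2l.
  by apply: le_trans (prim_le T_gt0 _ (su n)) _; rewrite ler_wpM2r ?sqrtr_ge0.
have /choice[nu nuP] : forall k : nat, exists n, (k <= n)%N /\ `|a n - p| < k.+1%:R^-1.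
  move=> k; have k0 : 0 < k.+1%:R^-1 :> R by rewrite invr_gt0.
  by have [n kn an] := pP _ k0 k; exists n.
have C0 : 0 <= costate_cst.
  have M0 := M_ge0 HV; rewrite /costate_cst divr_ge0 ?(ltW c_gt0) // addr_ge0 //.
  by apply: mulr_ge0; [apply: mulr_ge0 => //; exact: ltW|exact: path_cst_ge0].
(* Comparing both endpoints with the cluster point [p] splits the bound of [costate_stability] into
   one term per index. *)
pose d k := costate_cst * (`|a (nu k) - p| + rho (nu k)).
have de e : 0 < e -> exists N, forall i, (N <= i)%N -> d i <= e.
  move=> e0; have e1 : 0 < e / (2 * (costate_cst + 1)) by rewrite divr_gt0 // mulr_gt0 // ltr_wpDl.
  have [N1 N1e] := rhoe _ e1; have [N2 _ N2e] := near_infty_natSinv_lt (PosNum e1).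
  exists (maxn N1 N2) => i; rewrite geq_max => /andP[N1i N2i].
  have [inu ai] := nuP i; have h1 := N1e _ (leq_trans N1i inu); have := N2e _ N2i => /= h2.
  have h3 : `|a (nu i) - p| + rho (nu i) <= e / (costate_cst + 1).
    have -> : e / (costate_cst + 1) = e / (2 * (costate_cst + 1)) + e / (2 * (costate_cst + 1)).
      by field; rewrite lt0r_neq0 // ltr_wpDl.
    by apply: lerD => //; apply: le_trans (ltW ai) (ltW h2).
  apply: le_trans (ler_wpM2l C0 h3) _.
  by rewrite mulrCA ler_piMr ?(ltW e0) // ler_pdivrMr ?mul1r ?lerDl // ltr_wpDl.
have [|l [lcv ld]] := @uniform_cauchy_limit (fun k => costate x (u_ (nu k))) d _ de.
  move=> i j t; apply: le_trans (costate_stability _ _ sw (su _) (su _) t) _.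
  have alg (C y q r s1 s2 : R) : 0 <= C -> y <= q + r -> C * (y + (s1 + s2)) <= C * (q + s1) + C * (r + s2).
    by move=> C1 yqr; rewrite -mulrDr ler_wpM2l //; lra.
  apply: (alg _ _ `|a (nu i) - p| `|a (nu j) - p| _ _ C0).
  have alg2 (y z : R) : `|y - z| <= `|y - p| + `|z - p|.
    by rewrite (distrC z) ler_distD.
  exact: alg2.
have ml : measurable_fun D l.
  apply: (@measurable_fun_cvg _ _ _ _ (fun k => costate x (u_ (nu k)))).
    by move=> k; case: (sk (nu k)).
  by move=> t _; exact: lcv.
have sl : sqint l.
  apply: (@sqint_bounded _ _ T_gt0 _ (B + d 0)) => // t _.
  rewrite (_ : l t = costate x (u_ (nu 0)) t - (costate x (u_ (nu 0)) t - l t)); last by ring.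
  by apply: le_trans (ler_normB _ _) _; apply: lerD.
have sul := sqintB sl swc.
have conv e : 0 < e -> forall N, exists2 n, (N <= n)%N & nrm (fun t => u_ n t - (l t - w t / c)) <= e.
  move=> e0 N; have e1 : 0 < e / 2 by rewrite divr_gt0.
  have e2 : 0 < e / 2 / (Num.sqrt T + 1) by rewrite divr_gt0 // ltr_wpDl // sqrtr_ge0.
  have [N1 N1e] := rhoe _ e1; have [N2 N2e] := de _ e2.
  pose k := maxn N (maxn N1 N2); have [knu _] := nuP k.
  have Nk : (N <= k)%N by rewrite leq_maxl.
  have N1k : (N1 <= k)%N by rewrite (leq_trans (leq_maxl N1 N2)) // leq_maxr.
  have N2k : (N2 <= k)%N by rewrite (leq_trans (leq_maxr N1 N2)) // leq_maxr.
  exists (nu k); first exact: leq_trans knu.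
  have sD := sqintB (sk (nu k)) sl.
  rewrite (@eq_nrm _ _ _ (fun t => resid w x (u_ (nu k)) t + (costate x (u_ (nu k)) t - l t))); last first.
    have alg (p1 q r s : R) : p1 - (s - q) = (p1 + q - r) + (r - s) by ring.
    by move=> t _; exact: alg.
  apply: le_trans (nrmD (sr _) sD) _.
  have h1 := N1e _ (leq_trans N1k knu).
  have h2 : nrm (fun t => costate x (u_ (nu k)) t - l t) <= d k * Num.sqrt T.
    by apply: nrm_bounded => //; case: sD.
  have h3 : d k * Num.sqrt T <= e / 2.
    apply: le_trans (ler_wpM2r (sqrtr_ge0 T) (N2e _ N2k)) _.
    rewrite mulrAC ler_pdivrMr ?ltr_wpDl ?sqrtr_ge0 // ler_wpM2l ?(ltW e1) //.
    by rewrite lerDl.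
  by rewrite -/(rho _); lra.
(* The limit velocity is read off from a vanishing residual. *)
exists (fun t => l t - w t / c); split=> //.
apply/eqP; rewrite eq_le mlb // andbT; apply/ler_addgt0Pr => e e0.
pose Q := c / 2 * (nrm (fun t => l t - w t / c) + U) + nrm w + M * (T + 1) * Num.sqrt T.
have Q0 : 0 <= Q.
  have M0 := M_ge0 HV; have U0 : 0 <= U := le_trans (nrm_ge0 _ _) (uU 0).
  have c2 : 0 <= c / 2 by rewrite divr_ge0 // ltW.
  have T1 : 0 <= T + 1 by rewrite addr_ge0 // ltW.
  by rewrite /Q; apply: addr_ge0; [apply: addr_ge0; [apply: mulr_ge0 => //; apply: addr_ge0|]|apply: mulr_ge0; [exact: mulr_ge0|]]; rewrite ?nrm_ge0 ?sqrtr_ge0.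
have e1 : 0 < e / 2 / (Q + 1) by rewrite divr_gt0 ?divr_gt0 // ltr_wpDl.
have [N _ Ne] := near_infty_natSinv_lt (PosNum (divr_gt0 e0 (ltr0n R 2))).
have [n Nn ne] := conv _ e1 N.
apply: le_trans (act_continuous x sw sul (su n)) _.
have ne' : nrm (fun t => (l t - w t / c) - u_ n t) <= e / 2 / (Q + 1).
  rewrite (@eq_nrm _ _ _ (fun t => -1 * (u_ n t - (l t - w t / c)))); last by move=> t _; ring.
  by rewrite nrmZ ?normrN1 ?mul1r //; exact: sqintB.
have h1 : c / 2 * (nrm (fun t => l t - w t / c) + nrm (u_ n)) + nrm w + M * (T + 1) * Num.sqrt T <= Q.
  by rewrite /Q !lerD2r ler_pM2l ?divr_gt0 // lerD2l.
have h2 : nrm (fun t => (l t - w t / c) - u_ n t) *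
   (c / 2 * (nrm (fun t => l t - w t / c) + nrm (u_ n)) + nrm w + M * (T + 1) * Num.sqrt T) <= e / 2.
  apply: le_trans (ler_wpM2l (nrm_ge0 _ _) h1) _; apply: le_trans (ler_wpM2r Q0 ne') _.
  rewrite mulrAC ler_pdivrMr ?ltr_wpDl // ler_wpM2l ?divr_ge0 ?(ltW e0) //.
  by rewrite lerDl.
have h3 := mub n; have := Ne n Nn => /= h4.
have alg (q k r : R) : k < r / 2 -> q + k + r / 2 <= q + r by move=> *; lra.
by apply: le_trans (lerD h3 h2) _; exact: alg.
Qed.

End Stability.

(** * Existence, uniqueness and monotonicity of minimisers *)

Section Optimal.
#[local] Opaque nrm iD act.
Context {R : realType} (T : R) (T_gt0 : 0 < T) (c : R) (c_gt0 : 0 < c).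
Variables (V g : R -> R) (M : R).
Hypotheses (HV : smooth_bound M V) (Hg : smooth_bound M g).
Notation D := (`]0, T[%classic : set (measurableTypeR R)).
Notation prim := (prim T).
Notation iD := (iD T).
Notation intg := (intg T).
Notation sqint := (sqint T).
Notation nrm := (nrm T).
Notation lagr := (lagr T c V).
Notation act := (act T c V g).
Notation path := (path T).
Notation costate := (costate T c V g).
Notation resid := (resid T c V g).
Implicit Types (u w h : R -> R) (x t : R).

Definition value w x : R := inf [set act w x u | u in sqint].
Definition optimal w x u := sqint u /\ act w x u = value w x.

Let costs_nonempty w x : [set act w x u | u in sqint] !=set0.
Proof. by exists (act w x (fun=> 0)), (fun=> 0) => //; exact: sqint_cst. Qed.

Let costs_lbound w x : sqint w -> has_lbound [set act w x u | u in sqint].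
Proof.
move=> sw; have [m Hm] := act_lower_bound T_gt0 c_gt0 HV Hg x sw.
by exists m => _ [u su <-]; exact: Hm.
Qed.

Lemma value_le w x u : sqint w -> sqint u -> value w x <= act w x u.
Proof. by move=> sw su; apply: ge_inf; [exact: costs_lbound|exists u]. Qed.

Lemma le_value w x (m : R) : sqint w -> (forall u, sqint u -> m <= act w x u) -> m <= value w x.
Proof.
by move=> sw H; apply: lb_le_inf; [exact: costs_nonempty|move=> _ [u su <-]; exact: H].
Qed.

Lemma phi_value w x : sqint w -> phi T c V g w x = (value w x)%:E.
Proof.
move=> sw; rewrite (phi_act T_gt0 _ _ _ (V_continuous HV) sw) -ereal_inf_EFin.
- congr ereal_inf; apply/seteqP; split=> [_ [u su <-]|_ [_ [u su <-] <-]]; last by exists u.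
  by exists (act w x u) => //; exists u.
- exact: costs_lbound.
- exact: costs_nonempty.
Qed.

Lemma near_optimal w x (d : R) : sqint w -> 0 < d ->
  exists2 u, sqint u & act w x u <= value w x + d.
Proof.
move=> sw d0; have [|_ [u su <-] h] := @inf_adherent _ [set act w x u | u in sqint] _ d0.
  by split; [exact: costs_nonempty|exact: costs_lbound].
by exists u => //; exact: ltW.
Qed.

Lemma exists_optimal w x : sqint w -> exists u, optimal w x u.
Proof.
move=> sw; have /choice[u_ uP] : forall n : nat, exists u, sqint u /\ act w x u <= value w x + n.+1%:R^-1.
  move=> n; have n0 : 0 < n.+1%:R^-1 :> R by rewrite invr_gt0.
  by have [u su h] := near_optimal x sw n0; exists u.
have [||u [su uE _]] := @minimizing_cluster _ _ T_gt0 _ c_gt0 _ _ _ HV Hg w x (value w x) u_ sw (fun n => (uP n).1).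
- by move=> u su; exact: value_le.
- by move=> n; case: (uP n).
by exists u.
Qed.

Lemma optimal_resid w x u : sqint w -> optimal w x u -> nrm (resid w x u) = 0.
Proof.
move=> sw [su uE].
have := @near_min_resid _ _ T_gt0 _ c_gt0 _ _ _ HV Hg w x u (value w x) 0 sw su.
rewrite uE addr0 mulr0 lexx => /(_ (fun u' su' => value_le x sw su') isT) h.
by apply/eqP; rewrite -sqrf_eq0 eq_le h sqr_ge0.
Qed.

Lemma nrm0_prim u t : sqint u -> nrm u = 0 -> prim u t = 0.
Proof.
move=> su u0; have := prim_le T_gt0 t su; rewrite u0 mul0r normr_le0 => /eqP //.
Qed.

(** The residual vanishes only almost everywhere, but its primitive vanishes at every time. This
    gives an identity valid for each [t], which can then be differentiated. *)
Lemma optimal_prim w x u t : sqint w -> optimal w x u ->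
  prim u t = prim (costate x u) t - prim w t / c.
Proof.
move=> sw ou; have [su _] := ou; have swc := sqint_divc c sw.
have sk : sqint (costate x u) by apply: costate_sqint; try exact: HV.
have sr : sqint (resid w x u) by apply: resid_sqint; try exact: HV.
have E : prim (resid w x u) t = prim u t + prim (fun t => w t / c) t - prim (costate x u) t.
  by rewrite -(primD T_gt0 t su swc) -(primB T_gt0 t (sqintD su swc) sk).
have := nrm0_prim t sr (optimal_resid sw ou); rewrite E.
rewrite (@eq_prim _ _ (fun t => w t / c) (fun t => c^-1 * w t)); last by move=> s _; rewrite mulrC.
rewrite primZ // [c^-1 * _]mulrC; move: (prim u t) (prim w t / c) (prim _ t) => p q r; lra.
Qed.

Definition speed_bound w := costate_bound T c M * Num.sqrt T + nrm w / c.

Lemma optimal_nrm w x u : sqint w -> optimal w x u -> nrm u <= speed_bound w.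
Proof.
move=> sw ou; have [su _] := ou; have swc := sqint_divc c sw.
have sk : sqint (costate x u) by apply: costate_sqint; try exact: HV.
have sr : sqint (resid w x u) by apply: resid_sqint; try exact: HV.
rewrite (@eq_nrm _ _ _ (fun t => (resid w x u t - w t / c) + costate x u t)); last first.
  have alg (p q r : R) : p = (p + q - r) - q + r by ring.
  by move=> t _; exact: alg.
apply: le_trans (nrmD (sqintB sr swc) sk) _; rewrite addrC; apply: lerD.
  by apply: nrm_bounded => //; [case: sk|move=> t _; exact: (costate_le T_gt0 c_gt0 HV Hg)].
apply: le_trans (nrmB sr swc) _; rewrite (optimal_resid sw ou) add0r.
rewrite (@eq_nrm _ _ _ (fun t => c^-1 * w t)); last by move=> s _; rewrite mulrC.
by rewrite nrmZ // gtr0_norm ?invr_gt0 // mulrC.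
Qed.

Let stable0 (y C a r1 r2 : R) : y <= C * (a + (r1 + r2)) -> a = 0 -> r1 = 0 -> r2 = 0 -> y <= 0.
Proof. by move=> h a0 r10 r20; move: h; rewrite a0 r10 r20 !addr0 mulr0. Qed.

Lemma optimal_path_unique w x1 x2 u1 u2 : sqint w -> optimal w x1 u1 -> optimal w x2 u2 ->
  path x1 u1 T = path x2 u2 T -> forall t, 0 <= t <= T -> path x1 u1 t = path x2 u2 t.
Proof.
move=> sw o1 o2 E t tT; have [s1 _] := o1; have [s2 _] := o2.
have a0 : `|path x1 u1 T - path x2 u2 T| = 0 by rewrite E subrr normr0.
have := stable0 (path_stability T_gt0 c_gt0 HV Hg x1 x2 sw s1 s2 tT) a0
  (optimal_resid sw o1) (optimal_resid sw o2).
by rewrite normr_le0 subr_eq0 => /eqP.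
Qed.

Lemma optimal_x_unique w x1 x2 u1 u2 : sqint w -> optimal w x1 u1 -> optimal w x2 u2 ->
  path x1 u1 T = path x2 u2 T -> x1 = x2.
Proof.
move=> sw o1 o2 E; have := @optimal_path_unique w x1 x2 u1 u2 sw o1 o2 E 0.
by rewrite lexx ltW // !pathE !prim0 // !addr0; exact.
Qed.

Lemma optimal_nrm_unique w x u1 u2 : sqint w -> optimal w x u1 -> optimal w x u2 ->
  path x u1 T = path x u2 T -> nrm (fun t => u1 t - u2 t) = 0.
Proof.
move=> sw o1 o2 E; have [s1 _] := o1; have [s2 _] := o2.
have sk1 : sqint (costate x u1) by apply: costate_sqint; try exact: HV.
have sr1 : sqint (resid w x u1) by apply: resid_sqint; try exact: HV.
have sr2 : sqint (resid w x u2) by apply: resid_sqint; try exact: HV.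
rewrite (@eq_nrm _ _ _ (fun t => resid w x u1 t - resid w x u2 t)).
  have := stable0 (C := 1) (a := 0) (y := nrm (fun t => resid w x u1 t - resid w x u2 t)) _ erefl
    (optimal_resid sw o1) (optimal_resid sw o2).
  rewrite mul1r add0r => /(_ (nrmB sr1 sr2)) h.
  by apply/eqP; rewrite eq_le h nrm_ge0.
move=> t _; have a0 : `|path x u1 T - path x u2 T| = 0 by rewrite E subrr normr0.
have := stable0 (costate_stability T_gt0 c_gt0 HV Hg x x sw s1 s2 t) a0
  (optimal_resid sw o1) (optimal_resid sw o2).
rewrite normr_le0 subr_eq0 => /eqP k12.
rewrite !residE k12.
have alg (p q k l : R) : p - q = (p + k - l) - (q + k - l) by ring.
exact: alg.
Qed.

Definition splice u1 u2 (s : R) r := if r < s then u1 r else u2 r.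

Lemma spliceE u1 u2 s : splice u1 u2 s = fun r => u1 r * before s r + u2 r * (1 - before s r).
Proof.
apply/funext => r; rewrite /splice /before; case: (r < s).
  by rewrite mulr1 subrr mulr0 addr0.
by rewrite mulr0 subr0 mulr1 add0r.
Qed.

Lemma splice_sqint u1 u2 s : sqint u1 -> sqint u2 -> sqint (splice u1 u2 s).
Proof.
move=> [m1 i1] [m2 i2]; have mb : measurable_fun D (before s) by exact: measurable_before.
have ms : measurable_fun D (splice u1 u2 s).
  rewrite spliceE; apply: measurable_funD; apply: measurable_funM => //.
  by apply: measurable_funB => //.
split=> //; apply: (intg_le _ _ (intgD i1 i2)); first exact: measurable_funX.
move=> t _; rewrite ger0_norm ?sqr_ge0 // /splice; case: (t < s).
  by rewrite lerDl sqr_ge0.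
by rewrite lerDr sqr_ge0.
Qed.

Lemma prim_splice u1 u2 s t : sqint u1 -> sqint u2 ->
  prim (splice u1 u2 s) t = prim u1 (Num.min s t) + (prim u2 t - prim u2 (Num.min s t)).
Proof.
move=> s1 s2; rewrite !prim_ip !(ipC T u2) -ipBl; try exact: sqint_before; try done.
rewrite (ipC T _ u2) !ipE -iDD; first last.
- by apply: sqint_mul => //; apply: sqint_beforeB.
- by apply: sqint_mul => //; apply: sqint_before.
apply: eq_iD => r _; rewrite /splice /before lt_min.
by case: (r < s); case: (r < t); rewrite /= ?mulr1 ?mulr0 ?subr0 ?subrr ?mulr0 ?addr0 ?add0r ?mulr1.
Qed.

Lemma path_splice x1 x2 u1 u2 s t : sqint u1 -> sqint u2 -> path x1 u1 s = path x2 u2 s ->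
  path x1 (splice u1 u2 s) t = if t < s then path x1 u1 t else path x2 u2 t.
Proof.
move=> s1 s2 E; rewrite !pathE prim_splice //; have [ts|st] := ltP t s.
  by rewrite subrr addr0.
by rewrite addrA -/(path x1 u1 s) E !pathE; ring.
Qed.

(** When the paths meet at [s], exchanging what follows permutes the two Lagrangians at each time
    and the two terminal costs, so the total is conserved. *)
Lemma act_splice w x1 x2 u1 u2 s : sqint w -> sqint u1 -> sqint u2 ->
  path x1 u1 s = path x2 u2 s ->
  act w x1 (splice u1 u2 s) + act w x2 (splice u2 u1 s) = act w x1 u1 + act w x2 u2.
Proof.
have alg (a1 a2 a3 a4 b1 b2 b3 b4 : R) : a1 + a2 = a3 + a4 -> b1 + b2 = b3 + b4 ->
   a1 + b1 + (a2 + b2) = a3 + b3 + (a4 + b4) by move=> *; lra.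
move=> sw s1 s2 E; have s12 := splice_sqint s s1 s2; have s21 := splice_sqint s s2 s1.
have i1 : intg (lagr w x1 (splice u1 u2 s)) by apply: intg_lagr; try exact: HV.
have i2 : intg (lagr w x2 (splice u2 u1 s)) by apply: intg_lagr; try exact: HV.
have i3 : intg (lagr w x1 u1) by apply: intg_lagr; try exact: HV.
have i4 : intg (lagr w x2 u2) by apply: intg_lagr; try exact: HV.
have EL : iD (lagr w x1 (splice u1 u2 s)) + iD (lagr w x2 (splice u2 u1 s)) =
    iD (lagr w x1 u1) + iD (lagr w x2 u2).
  rewrite -(iDD i1 i2) -(iDD i3 i4); apply: eq_iD => t _.
  rewrite !lagrE -/(path x1 _ t) -/(path x2 _ t) -/(path x1 _ t) -/(path x2 _ t).
  rewrite (path_splice t s1 s2 E) (path_splice t s2 s1 (esym E)) /splice.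
  by case: (t < s) => //; rewrite addrC.
have EG : g (path x1 (splice u1 u2 s) T) + g (path x2 (splice u2 u1 s) T) =
    g (path x1 u1 T) + g (path x2 u2 T).
  rewrite (path_splice T s1 s2 E) (path_splice T s2 s1 (esym E)).
  by case: (T < s) => //; rewrite addrC.
by rewrite !act_lagr; exact: alg EL EG.
Qed.

(* Two optimal trajectories which cross could be spliced at the crossing point: the
   spliced trajectory is again optimal, but shares its endpoint with an optimal
   trajectory from another starting point. *)
Lemma optimal_monotone w x1 x2 u1 u2 t : sqint w -> optimal w x1 u1 -> optimal w x2 u2 ->
  x1 < x2 -> 0 <= t <= T -> path x1 u1 t <= path x2 u2 t.
Proof.
move=> sw o1 o2 x12 /andP[t0 tT]; rewrite leNgt; apply/negP => tlt.
have [s1 e1] := o1; have [s2 e2] := o2.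
pose f s := path x1 u1 s - path x2 u2 s.
have cf : {within `[0, t], continuous f}.
  by apply: continuous_subspaceT => s; apply: cvgB; exact: path_continuous.
have f0 : f 0 < 0 by rewrite /f !pathE !prim0 // !addr0 subr_lt0.
have ft : 0 < f t by rewrite /f subr_gt0.
have [|s] := IVT t0 cf (v := 0).
  by rewrite ge_min (ltW f0) le_max (ltW ft) orbT.
rewrite in_itv /= => /andP[s0 st] /eqP; rewrite subr_eq0 => /eqP E.
have := act_splice sw s1 s2 E; rewrite e1 e2 => Esum.
have s12 := splice_sqint s s1 s2; have s21 := splice_sqint s s2 s1.
have h1 := value_le x1 sw s12; have h2 := value_le x2 sw s21.
have o3 : optimal w x1 (splice u1 u2 s).
  by split=> //; apply/eqP; rewrite eq_le h1 andbT; lra.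
have := optimal_x_unique sw o3 o2; rewrite (path_splice T s1 s2 E).
rewrite ltNge (le_trans st tT) /= => /(_ erefl) x12E.
by rewrite x12E ltxx in x12.
Qed.

(** Comparing endpoints is enough by [optimal_path_unique], and avoids stating uniqueness of
    velocities up to null sets. *)
Definition uniquely_optimal w x u :=
  optimal w x u /\ forall v, optimal w x v -> path x v T = path x u T.

(** At an exceptional [x], two minimisers have distinct endpoints with a rational between them. If x
    < y, every endpoint from [x] is at most every endpoint from [y], so the rationals chosen at two
    exceptional points cannot coincide. *)
Lemma nonunique_countable w (us : R -> R -> R) : sqint w -> (forall x, optimal w x (us x)) ->
  countable [set x | ~ uniquely_optimal w x (us x)].
Proof.
move=> sw os; apply/countable_injP.
have H x : exists q : rat, ~ uniquely_optimal w x (us x) ->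
   exists v1 v2, [/\ optimal w x v1, optimal w x v2 & path x v1 T < ratr q < path x v2 T].
  have [ux|] := pselect (uniquely_optimal w x (us x)); first by exists 0.
  move=> nux; have [v [ov ne]] : exists v, optimal w x v /\ path x v T != path x (us x) T.
    apply: contrapT => h; apply: nux; split=> // v ov; apply: contrapT => /eqP ne.
    by apply: h; exists v.
  have [lt|gt|eq] := ltgtP (path x v T) (path x (us x) T).
  - have [q] := rat_in_itvoo lt; rewrite in_itv /= => qP.
    by exists q => _; exists v, (us x).
  - have [q] := rat_in_itvoo gt; rewrite in_itv /= => qP.
    by exists q => _; exists (us x), v.
  - by rewrite eq eqxx in ne.
have [q qP] := choice H; exists (fun x => pickle (q x)).
have W x y : x < y -> ~ uniquely_optimal w x (us x) -> ~ uniquely_optimal w y (us y) -> q x = q y -> False.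
  move=> xy /(qP x)[v1 [v2 [p1 p2 /andP[_ h2]]]] /(qP y)[w1 [w2 [q1 q2 /andP[k1 _]]]] E.
  have TT : 0 <= T <= T by rewrite lexx ltW.
  have := optimal_monotone sw p2 q1 xy TT; rewrite leNgt => /negP; apply.
  by apply: lt_trans h2; rewrite E.
move=> x y; rewrite !inE => nx ny /(pcan_inj pickleK) E.
by have [xy|yx|//] := ltgtP x y; exfalso; [exact: W xy nx ny E|exact: W yx ny nx (esym E)].
Qed.

(** Otherwise some minimising sequence stays at distance more than [e] from [us]. Its cluster point
    is optimal, hence has the endpoint of [us] and lies at distance zero from it. *)
Lemma well_posed w x us (e : R) : sqint w -> uniquely_optimal w x us -> 0 < e ->
  exists2 d, 0 < d & forall u, sqint u -> act w x u <= value w x + d ->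
    nrm (fun t => u t - us t) <= e.
Proof.
move=> sw [[sus eus] uu] e0; apply: contrapT => H.
have /choice[u_ uP] : forall n : nat, exists u, [/\ sqint u,
    act w x u <= value w x + n.+1%:R^-1 & e < nrm (fun t => u t - us t)].
  move=> n; apply: contrapT => h; apply: H; exists n.+1%:R^-1; first by rewrite invr_gt0.
  move=> u su uv; rewrite leNgt; apply/negP => ue; apply: h; by exists u.
have su_ n : sqint (u_ n) by case: (uP n).
have [||u [su uE uc]] := @minimizing_cluster _ _ T_gt0 _ c_gt0 _ _ _ HV Hg w x (value w x) u_ sw su_.
- by move=> u su; exact: value_le.
- by move=> n; case: (uP n).
have [n _ nu] := uc _ e0 0%N.
have ou : optimal w x u by split.
have n0 := optimal_nrm_unique sw ou (conj sus eus) (uu _ ou).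
have [_ _] := uP n; rewrite ltNge => /negP; apply.
rewrite (@eq_nrm _ _ _ (fun t => (u_ n t - u t) + (u t - us t))); last first.
  by move=> t _; rewrite addrA subrK.
apply: le_trans (nrmD (sqintB (su_ n) su) (sqintB su sus)) _.
by rewrite n0 addr0.
Qed.

End Optimal.

(** * Averages against the density *)

Section Density.
Context {R : realType} (rho : R -> R) (Hrho : compactly_supported_density rho).
Notation mu := (@lebesgue_measure R).
Implicit Types (f h : R -> R) (k : R).

Definition rintg f := mu.-integrable setT (fun x => (f x * rho x)%:E).
Definition E f : R := \int[mu]_x (f x * rho x).

Lemma EE f : E f = \int[mu]_x (f x * rho x). Proof. by []. Qed.

Lemma rho_ge0 x : 0 <= rho x. Proof. by case: Hrho => _ h _ _; exact: h. Qed.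

Lemma rho_meas : measurable_fun [set: measurableTypeR R] rho.
Proof. by case: Hrho => h _ _ _; exact: h. Qed.

Lemma rho_integrable : mu.-integrable setT (EFin \o rho).
Proof.
apply/integrableP; split; first by apply: measurable_EFin_comp; exact: rho_meas.
have -> : (\int[mu]_x `|(EFin \o rho) x| = \int[mu]_x (rho x)%:E)%E.
  by apply: eq_integral => x _; rewrite /= ger0_norm // rho_ge0.
by case: Hrho => _ _ -> _; rewrite ltry.
Qed.

Lemma rho_support : exists2 K : R, 0 <= K & {ae mu, forall x, K < `|x| -> rho x = 0}.
Proof.
case: Hrho => _ _ _ [S [cS aeS]]; have [K [_ KS]] := compact_bounded cS.
exists (`|K| + 1); first by rewrite addr_ge0.
apply: filterS aeS; first exact: (ae_filter_ringOfSetsType mu).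
move=> x h xK; apply: h => Sx.
have Kl : K < `|K| + 1 by apply: (le_lt_trans (ler_norm _)); rewrite ltrDl.
by have /= := KS _ Kl x Sx; rewrite leNgt xK.
Qed.

(** Linear growth, which is what [value w] has, is harmless because the density vanishes a.e.
    outside a bounded set. *)
Lemma rintg_growth f (A B : R) : measurable_fun [set: measurableTypeR R] f ->
  (forall x, `|f x| <= A + B * `|x|) -> 0 <= A -> 0 <= B -> rintg f.
Proof.
move=> mf fAB A0 B0; have [K K0 aeK] := rho_support.
have mfr : measurable_fun [set: measurableTypeR R] (fun x => f x * rho x).
  by apply: measurable_funM => //; exact: rho_meas.
have AB0 : 0 <= A + B * K by rewrite addr_ge0 // mulr_ge0.
apply/integrableP; split; first exact: measurable_EFin_comp.
have ig := integrableZl measurableT (A + B * K) rho_integrable.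
apply: le_lt_trans (integrable_lty measurableT ig).
apply: ae_ge0_le_integral => //.
- by apply: measurableT_comp => //; exact: measurable_EFin_comp.
- by move=> x _; rewrite lee_fin mulr_ge0 // rho_ge0.
- exact: (measurable_int mu ig).
apply: filterS aeK; first exact: (ae_filter_ringOfSetsType mu).
move=> x h _; rewrite /= lee_fin normrM (ger0_norm (rho_ge0 x)).
have [xK|/h ->] := lerP `|x| K; last by rewrite !mulr0.
rewrite ler_wpM2r ?rho_ge0 //; apply: le_trans (fAB x) _.
by rewrite lerD2l ler_wpM2l.
Qed.

Lemma rintg_bounded f (A : R) : measurable_fun [set: measurableTypeR R] f ->
  (forall x, `|f x| <= A) -> rintg f.
Proof.
move=> mf fA; apply: (@rintg_growth f A 0) => // [x|]; first by rewrite mul0r addr0.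
exact: le_trans (normr_ge0 _) (fA 0).
Qed.

Lemma E_cst k : E (fun=> k) = k.
Proof.
rewrite /E (RintegralZl k measurableT rho_integrable) /Rintegral.
by have [_ _ -> _] := Hrho; rewrite mulr1.
Qed.

Lemma le_E f h : rintg f -> rintg h -> (forall x, f x <= h x) -> E f <= E h.
Proof.
move=> fi hi fh; apply: le_Rintegral => // x _; rewrite ler_wpM2r ?fh //; exact: rho_ge0.
Qed.

Lemma rintgD f h : rintg f -> rintg h -> rintg (fun x => f x + h x).
Proof.
move=> fi hi; have := integrableD measurableT fi hi; apply: eq_integrable => //.
by move=> x _; rewrite /= -EFinD mulrDl.
Qed.

Lemma rintgZ k f : rintg f -> rintg (fun x => k * f x).
Proof.
move=> fi; have := integrableZl measurableT k fi; apply: eq_integrable => //.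
by move=> x _; rewrite /= -EFinM mulrA.
Qed.

Lemma ED f h : rintg f -> rintg h -> E (fun x => f x + h x) = E f + E h.
Proof.
move=> fi hi; rewrite -RintegralD //; apply: eq_Rintegral => x _; exact: mulrDl.
Qed.

Lemma EZ k f : rintg f -> E (fun x => k * f x) = k * E f.
Proof.
by move=> fi; rewrite -RintegralZl //; apply: eq_Rintegral => x _; rewrite mulrA.
Qed.

Lemma eq_E f h : (forall x, f x = h x) -> E f = E h.
Proof. by move=> fh; apply: eq_Rintegral => x _; rewrite fh. Qed.

(** Absolute continuity enters here: the countable set of non-uniqueness carries no mass. *)
Lemma E_countable f h (S : set R) : rintg f -> rintg h -> countable S ->
  (forall x, ~ S x -> f x = h x) -> E f = E h.
Proof.
move=> fi hi cS fh; rewrite /E /Rintegral; congr fine.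
apply: ae_eq_integral => //; [exact: (measurable_int mu fi)|exact: (measurable_int mu hi)|].
exists S; split.
- exact: countable_measurable.
- exact: countable_lebesgue_measure0.
move=> x /=; apply: contra_notP => Sx _; by rewrite fh.
Qed.

End Density.

(** * Measurable selections and averages *)

Section Selection.
Context {R : realType} (T : R) (T_gt0 : 0 < T) (c : R) (c_gt0 : 0 < c).
Variables (V g : R -> R) (M : R).
Hypotheses (HV : smooth_bound M V) (Hg : smooth_bound M g).
Notation D := (`]0, T[%classic : set (measurableTypeR R)).
Notation prim := (prim T).
Notation tail := (tail T).
Notation ip := (ip T).
Notation iD := (iD T).
Notation intg := (intg T).
Notation sqint := (sqint T).
Notation path := (path T).
Notation force := (force T V).
Notation costate := (costate T c V g).
Notation resid := (resid T c V g).
Implicit Types (u w h : R -> R) (x t : R).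
Notation V' := (derive1 V).
Notation g' := (derive1 g).

Notation mu := (@lebesgue_measure R).
Notation optimal := (optimal T c V g).
Variables (w : R -> R) (sw : sqint w).
Notation X := (measurableTypeR R).

Lemma up_set_measurable (A : set R) : (forall x y, x < y -> A x -> A y) -> measurable (A : set X).
Proof.
move=> upA; apply: is_interval_measurable => x y Ax Ay z /andP[xz zy].
by move: xz; rewrite le_eqVlt => /predU1P[<-//|xz]; exact: upA xz Ax.
Qed.

(** By continuity in time, the set where the path exceeds [alpha] is a countable union of rational
    time windows times the set of [x] whose path exceeds [alpha] on that whole window. By the
    ordering of minimisers the latter is an up-set, hence an interval. Any choice of minimisers is
    thus Borel, without a selection theorem. *)
Lemma optimal_path_measurable (u_ : R -> R -> R) : (forall x, optimal w x (u_ x)) ->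
  measurable_fun (`[0, T] `*` [set: X] : set (X * X)) (fun p => path p.2 (u_ p.2) p.1).
Proof.
move=> ou; apply: (@measurability _ _ _ _ _ _ (@RGenOInfty.G R)).
  exact: RGenOInfty.measurableE.
move=> _ [_ [alpha ->] <-].
pose A (q : rat * rat) : set X := [set x | forall s, 0 <= s <= T -> ratr q.1 < s < ratr q.2 ->
  alpha < path x (u_ x) s].
have mA q : measurable (A q).
  apply: up_set_measurable => x y xy Ax s sT qs.
  by apply: lt_le_trans (Ax s sT qs) _; exact: (optimal_monotone T_gt0 c_gt0 HV Hg sw (ou x) (ou y) xy sT).
have -> : (`[0, T] `*` [set: X]) `&` (fun p : X * X => path p.2 (u_ p.2) p.1) @^-1` `]alpha, +oo[%classic =
   \bigcup_(q : rat * rat) ((`[0, T] `&` `]ratr q.1, ratr q.2[%classic : set X) `*` A q).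
  apply/seteqP; split=> [[t x] [[/= tT _]]|[t x] [q _ [/= [tT tq] Aq]]]; last first.
    split; first by split.
    move: tT tq; rewrite /= !in_itv /= andbT => tT tq; exact: Aq.
  rewrite in_itv /= andbT => at_; move: tT; rewrite in_itv /= => tT.
  have [su _] := ou x.
  have cp : continuous (path x (u_ x)) by exact: path_continuous.
  have : \forall s \near t, alpha < path x (u_ x) s.
    by move: (cp t) => /cvgr_gt; apply.
  move=> /nbhs_ballP[d /= d0 db].
  have td : t - d < t by rewrite ltrBlDr ltrDl.
  have dt : t < t + d by rewrite ltrDl.
  have [q1] := rat_in_itvoo td.
  rewrite in_itv /= => /andP[q1a q1b].
  have [q2] := rat_in_itvoo dt.
  rewrite in_itv /= => /andP[q2a q2b].
  exists (q1, q2) => //; split => /=.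
    by split; rewrite /= in_itv /= ?q1b.
  move=> s sT /andP[s1 s2]; apply: db; rewrite /ball /= ltr_norml; apply/andP; split; lra.
apply: countable_bigcupT_measurable; first exact: countableP.
move=> q; apply: measurableX; last exact: mA.
by apply: measurableI; exact: measurable_itv.
Qed.

Section Average.
Variables (rho : R -> R) (Hrho : compactly_supported_density rho).
Notation E := (E rho).
Notation rintg := (rintg rho).
Variables (u_ : R -> R -> R) (ou : forall x, optimal w x (u_ x)).
Hypothesis mu_ : measurable_fun (`[0, T] `*` [set: X] : set (X * X))
  (fun p => path p.2 (u_ p.2) p.1).

Let su_ x : sqint (u_ x). Proof. by case: (ou x). Qed.

Let mslice (s : R) : 0 <= s <= T -> measurable_fun [set: X] (fun x => path x (u_ x) s).
Proof.
move=> sT; apply: (@measurable_comp _ _ _ _ _ _ (`[0, T] `*` [set: X] : set (X * X))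
  (fun p => path p.2 (u_ p.2) p.1) _ (fun x => (s, x))) => //.
- by apply: measurableX => //; exact: measurable_itv.
- by move=> _ [x _ <-]; split => //=; rewrite in_itv.
- exact: pair1_measurable.
Qed.

Lemma rintg_comp_path (F : R -> R) (B s : R) : continuous F -> (forall y, `|F y| <= B) ->
  0 <= s <= T -> rintg (fun x => F (path x (u_ x) s)).
Proof.
move=> cF FB sT; apply: (@rintg_bounded _ _ Hrho _ B) => //.
apply: (@measurableT_comp _ _ _ _ _ _ F); last exact: mslice.
exact: continuous_measurable_fun.
Qed.

Lemma E_le (f : R -> R) (B : R) : rintg f -> (forall x, `|f x| <= B) -> `|E f| <= B.
Proof.
move=> fi fB; have ci k : rintg (fun=> k) by apply: (@rintg_bounded _ _ Hrho _ `|k|).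
rewrite ler_norml -{1}(E_cst Hrho B) -mulN1r -(EZ _ (ci B)) -{2}(E_cst Hrho B).
apply/andP; split; apply: (le_E Hrho) => //; try exact: rintgZ;
  by move=> x; have := fB x; rewrite ler_norml ?mulN1r => /andP[].
Qed.

Section Fubini.
Variables (F : R -> R) (B : R) (cF : continuous F) (FB : forall y, `|F y| <= B).

Let Fpath : X * X -> R := (fun p => F (path p.2 (u_ p.2) p.1)) \_ (D `*` [set: X]).

Let Fpath_meas : measurable_fun setT Fpath.
Proof.
apply/(measurable_restrictT _ _).1; first by apply: measurableX => //; exact: mD.
apply: (@measurableT_comp _ _ _ _ _ _ F); first exact: continuous_measurable_fun.
apply: measurable_funS mu_; first by apply: measurableX => //; exact: measurable_itv.
move=> [t x] [/= tD _]; split=> //=; apply: subset_itvScc tD; by rewrite bnd_simp.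
Qed.

Let FpathE t x : D t -> Fpath (t, x) = F (path x (u_ x) t).
Proof. by move=> Dt; rewrite /Fpath patchE mem_set. Qed.

Let Fpath_le p : `|Fpath p| <= B.
Proof.
rewrite /Fpath patchE; case: ifP => _ //.
by rewrite normr0; exact: le_trans (normr_ge0 _) (FB 0).
Qed.

Variables (b : R -> R) (sb : sqint b).
Let k (p : X * X) : R := (b \_ D) p.1 * (Fpath p * rho p.2).

Let ib : mu.-integrable setT (EFin \o (b \_ D)).
Proof. by apply: integrable_patch; exact: sqint_intg. Qed.

Let k_meas : measurable_fun setT k.
Proof.
have mb : measurable_fun [set: X] (b \_ D).
  by apply/measurable_EFinP; exact: (measurable_int mu ib).
apply: measurable_funM; first by apply: (measurableT_comp mb); exact: measurable_fst.
apply: measurable_funM => //.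
by apply: (measurableT_comp (rho_meas Hrho)); exact: measurable_snd.
Qed.

Let k_le t x : `|k (t, x)| <= (B * `|(b \_ D) t|) * rho x.
Proof.
rewrite /k !normrM /= (ger0_norm (rho_ge0 Hrho x)) mulrA ler_wpM2r ?(rho_ge0 Hrho) //.
by rewrite mulrC ler_wpM2r.
Qed.

Let iBb : mu.-integrable setT (EFin \o (fun t => B * `|(b \_ D) t|)).
Proof.
have := integrableZl measurableT B (integrable_abse ib); apply: eq_integrable => //.
Qed.

Let k_int_x t : \int[mu]_x k (t, x) = ((fun s => E (fun x => F (path x (u_ x) s)) * b s) \_ D) t.
Proof.
rewrite patchE; case: ifPn => [/set_mem Dt|nDt]; last first.
  rewrite -[RHS](mul0r (fine (mu setT))) -Rintegral_cst //; apply: eq_Rintegral => x _.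
  by rewrite /k /= patchE (negbTE nDt) mul0r.
have tT : 0 <= t <= T by move: Dt; rewrite /= in_itv /= => /andP[/ltW -> /ltW ->].
rewrite mulrC /E -RintegralZl //; last exact: (rintg_comp_path cF FB tT).
by apply: eq_Rintegral => x _; rewrite /k /= FpathE // patchE mem_set.
Qed.

Let k_int_t x : \int[mu]_t k (t, x) = ip (fun s => F (path x (u_ x) s)) b * rho x.
Proof.
have sF : sqint (fun s => F (path x (u_ x) s)).
  by apply: continuous_sqint => //; apply: comp_path_continuous.
rewrite mulrC !ipE -(iDZ _ (sqint_mul sF sb)) iDE [RHS]Rintegral_mkcond.
apply: eq_Rintegral => t _; rewrite /k /= !patchE; case: ifPn => [/set_mem Dt|nDt]; last first.
  by rewrite mul0r.
by rewrite FpathE // mulrC mulrAC mulrC.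
Qed.

(** Only functions of the path are known to be jointly measurable, so Fubini is set up for them;
    pairings with velocities are reduced to this case by [optimal_ip]. *)
Lemma E_ip_comp_path : rintg (fun x => ip (fun s => F (path x (u_ x) s)) b) /\
  E (fun x => ip (fun s => F (path x (u_ x) s)) b) = ip (fun s => E (fun x => F (path x (u_ x) s))) b.
Proof.
have irho := rho_integrable Hrho.
have [FE _] := Rintegral_Fubini k_meas iBb irho k_le.
have ks_meas : measurable_fun setT (fun p : X * X => k (p.2, p.1)).
  by apply: (measurableT_comp k_meas); exact: measurable_swap.
have ks_le x t : `|k (t, x)| <= rho x * (B * `|(b \_ D) t|) by rewrite mulrC.
have [_ FI] := Rintegral_Fubini ks_meas irho iBb ks_le.
split; first by apply: eq_integrable FI => // x _ /=; rewrite k_int_t.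
rewrite /E; transitivity (\int[mu]_x \int[mu]_t k (t, x)).
  by apply: eq_Rintegral => x _; rewrite k_int_t.
rewrite -FE [RHS]Rintegral_mkcond; apply: eq_Rintegral => t _; exact: k_int_x.
Qed.

Lemma intg_E_comp_path : intg (fun s => E (fun x => F (path x (u_ x) s)) * b s).
Proof.
have [_ FI] := Rintegral_Fubini k_meas iBb (rho_integrable Hrho) k_le.
apply: (integrable_mkcond _ (mD T)).2; apply: eq_integrable FI => // t _ /=.
by rewrite k_int_x !patchE; case: ifP.
Qed.

End Fubini.

Let V'M y : `|V' y| <= M. Proof. by case: HV => _ h _ _ _; exact: h. Qed.
Let g'M y : `|g' y| <= M. Proof. by case: Hg => _ h _ _ _; exact: h. Qed.
Let cV' : continuous V'. Proof. exact: (V'_continuous HV). Qed.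
Let cg' : continuous g'. Proof. exact: (V'_continuous Hg). Qed.

Definition mean_force s := E (fun x => force x (u_ x) s).
Definition mean_end := E (fun x => g' (path x (u_ x) T)).
(** Averaging first and integrating in time afterwards makes square integrability immediate and
    defines [gradient] at every time, without mentioning velocities. *)
Definition mean_costate t := - (mean_end + tail mean_force t) / c.
Definition gradient t := mean_costate t - w t / c.

Lemma mean_force_sqint : sqint mean_force.
Proof.
apply: (@sqint_bounded _ _ T_gt0 _ M).
  have := intg_meas (intg_E_comp_path cV' V'M (sqint_cst T_gt0 1)).
  by apply: eq_measurable_fun => t _; rewrite mulr1.
move=> t; rewrite /= in_itv /= => /andP[/ltW t0 /ltW tT].
apply: E_le; last by move=> x; exact: V'M.
by apply: (rintg_comp_path cV' V'M); rewrite t0.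
Qed.

Let TT : 0 <= T <= T. Proof. by rewrite lexx ltW. Qed.

Lemma E_costate t : rintg (fun x => costate x (u_ x) t) /\
  E (fun x => costate x (u_ x) t) = mean_costate t.
Proof.
have ig := rintg_comp_path cg' g'M TT.
(* [tail] is a pairing with [after t], so this is the exchange of average and tail. *)
have [it Et] := E_ip_comp_path cV' V'M (sqint_after T_gt0 t).
have Ec : (fun x => costate x (u_ x) t) =
    (fun x => - c^-1 * (g' (path x (u_ x) T) + tail (force x (u_ x)) t)).
  by apply/funext => x; rewrite !costateE mulrC mulrN -mulNr.
rewrite Ec; split; first by apply: rintgZ; exact: rintgD.
rewrite (EZ _ (rintgD ig it)) (ED ig it) [E (fun x => tail _ t)]Et /mean_costate.
by rewrite mulrC mulrN -mulNr mulrC.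
Qed.

Lemma mean_costate_sqint : sqint mean_costate.
Proof.
apply: continuous_sqint => // t; apply: cvgM; last exact: cvg_cst.
apply: cvgN; apply: cvgD; first exact: cvg_cst.
by apply: tail_continuous => //; exact: mean_force_sqint.
Qed.

Lemma gradient_sqint : sqint gradient.
Proof. by apply: sqintB; [exact: mean_costate_sqint|exact: sqint_divc]. Qed.

(** The stationarity condition tested against [h], solved for [ip u h]. On the right only functions
    of the path depend on [x], so the average over [x] makes sense. *)
Lemma optimal_ip x u h : optimal w x u -> sqint h ->
  ip u h = - c^-1 * (ip (force x u) (prim h) + (prim h T * g' (path x u T) + ip w h)).
Proof.
move=> oxu sh; have [su _] := oxu; have swc := sqint_divc c sw.
have sk : sqint (costate x u) by apply: costate_sqint; try exact: HV.
have sr : sqint (resid w x u) by apply: resid_sqint; try exact: HV.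
have r0 : ip (resid w x u) h = 0.
  apply/eqP; rewrite -normr_eq0 eq_le normr_ge0 andbT.
  by have := cauchy_schwarz sr sh; rewrite (optimal_resid T_gt0 c_gt0 HV Hg sw oxu) mul0r.
have Er : ip (resid w x u) h = ip u h + ip (fun t => w t / c) h - ip (costate x u) h.
  by rewrite -(ipDl su swc sh) -(ipBl (sqintD su swc) sk sh).
have Ew : ip (fun t => w t / c) h = ip w h / c.
  rewrite [RHS]mulrC -(ipZl _ sw sh); apply: eq_iD => t _; congr (_ * _); exact: mulrC.
have Ek := costate_prim T_gt0 c_gt0 g HV x su sh.
have alg (a b k f p : R) : a + b / c - k = 0 -> f + p = - c * k -> a = - c^-1 * (f + (p + b)).
  move=> h1 h2; rewrite addrA h2; move: h1 => /eqP; rewrite subr_eq0 => /eqP <-.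
  by field; rewrite lt0r_neq0.
apply: (alg _ _ (ip (costate x u) h)); first by rewrite -Ew -Er.
by rewrite -Ek; congr (_ + _); exact: mulrC.
Qed.

Lemma E_ip h : sqint h ->
  rintg (fun x => ip (u_ x) h) /\ E (fun x => ip (u_ x) h) = ip gradient h.
Proof.
move=> sh; have sph := prim_sqint T_gt0 sh.
have ig := rintg_comp_path cg' g'M TT.
have [it Et] := E_ip_comp_path cV' V'M sph.
have iw : rintg (fun=> ip w h) by apply: (@rintg_bounded _ _ Hrho _ `|ip w h|).
have igw := rintgD (rintgZ (prim h T) ig) iw.
have Eu : (fun x => ip (u_ x) h) = (fun x => - c^-1 * (ip (force x (u_ x)) (prim h)
     + (prim h T * g' (path x (u_ x) T) + ip w h))).
  by apply/funext => x; exact: optimal_ip.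
rewrite Eu; split; first by apply: rintgZ; exact: rintgD.
rewrite (EZ _ (rintgD it igw)) (ED it igw) (ED (rintgZ _ ig) iw) (EZ _ ig) (E_cst Hrho).
rewrite [E (fun x => ip _ _)]Et -/mean_end -[ip (fun s => E _) (prim h)]/(ip mean_force (prim h)).
have smf := mean_force_sqint.
have stf : sqint (tail mean_force) by apply: continuous_sqint => //; exact: tail_continuous.
rewrite (ip_prim T_gt0 smf sh) primT (ipC T h).
have sme := sqint_cst T_gt0 mean_end.
have -> : iD h * mean_end = ip (fun=> mean_end) h by rewrite mulrC -(iDZ _ (sqint_intg T_gt0 sh)).
rewrite addrA -(ipDl stf sme sh) -(ipDl (sqintD stf sme) sw sh).
rewrite -(ipZl _ (sqintD (sqintD stf sme) sw) sh); apply: eq_iD => t _; congr (_ * _).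
have alg (p q r : R) : - c^-1 * (p + q + r) = - (q + p) / c - r / c by ring.
exact: alg.
Qed.

End Average.
End Selection.

Lemma smooth_bound_le (R : realType) (M N : R) f : M <= N -> smooth_bound M f -> smooth_bound N f.
Proof.
move=> MN [M0 b l l' q]; split.
- exact: le_trans MN.
- by move=> x; exact: le_trans (b x) MN.
- by move=> x y; apply: le_trans (l x y) _; rewrite ler_wpM2r.
- by move=> x y; apply: le_trans (l' x y) _; rewrite ler_wpM2r.
- by move=> x h; apply: le_trans (q x h) _; rewrite lerD2l ler_wpM2r ?sqr_ge0.
Qed.

(** * The value function *)

Section Value.
Context {R : realType} (T : R) (T_gt0 : 0 < T) (c : R) (c_gt0 : 0 < c).
Variables (V g : R -> R) (M : R).
Hypotheses (HV : smooth_bound M V) (Hg : smooth_bound M g).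
Notation D := (`]0, T[%classic : set (measurableTypeR R)).
Notation prim := (prim T).
Notation tail := (tail T).
Notation ip := (ip T).
Notation iD := (iD T).
Notation sqint := (sqint T).
Notation nrm := (nrm T).
Notation act := (act T c V g).
Notation path := (path T).
Notation force := (force T V).
Notation costate := (costate T c V g).
Implicit Types (u w h : R -> R) (x t : R).
Notation g' := (derive1 g).
Notation mu := (@lebesgue_measure R).
Notation X := (measurableTypeR R).
Notation value := (value T c V g).
Notation optimal := (optimal T c V g).
Notation uniquely_optimal := (uniquely_optimal T c V g).

Lemma value_lipschitz w x1 x2 : sqint w -> `|value w x1 - value w x2| <= M * (T + 1) * `|x1 - x2|.
Proof.
move=> sw; have W a b : value w a <= value w b + M * (T + 1) * `|a - b|.
  rewrite -lerBlDr; apply: le_value => // u su; rewrite lerBlDr.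
  apply: le_trans (value_le T_gt0 c_gt0 HV Hg a sw su) _.
  exact: (act_lipschitz T_gt0 c HV Hg).
have := W x1 x2; have := W x2 x1; rewrite (distrC x2) ler_norml => W21 W12.
by apply/andP; split; [rewrite lerNl opprB|]; rewrite lerBlDl.
Qed.

Lemma value_continuous w : sqint w -> continuous (value w).
Proof. by move=> sw; apply: (@continuous_lipschitz _ _ (M * (T + 1))) => s t; exact: value_lipschitz. Qed.

Lemma act_add w h x u : sqint w -> sqint h -> sqint u ->
  act (fun t => w t + h t) x u = act w x u + ip u h.
Proof.
move=> sw sh su; have swh := sqintD sw sh.
rewrite (actE T_gt0 c g HV x swh su) (actE T_gt0 c g HV x sw su).
rewrite (ipC T u (fun t => w t + h t)) (ipDl sw sh su) (ipC T w u) (ipC T h u).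
have alg (p q r s k : R) : p + (q + r) + s + k = p + q + s + k + r by ring.
exact: alg.
Qed.

Lemma value_concave w1 w2 (s : R) x : sqint w1 -> sqint w2 -> 0 <= s <= 1 ->
  (1 - s) * value w1 x + s * value w2 x <= value (fun t => (1 - s) * w1 t + s * w2 t) x.
Proof.
move=> sw1 sw2 /andP[s0 s1]; have sa := sqintZ (1 - s) sw1; have sb := sqintZ s sw2.
have sab := sqintD sa sb; apply: le_value => // u su.
have h1 := value_le T_gt0 c_gt0 HV Hg x sw1 su; have h2 := value_le T_gt0 c_gt0 HV Hg x sw2 su.
have -> : act (fun t => (1 - s) * w1 t + s * w2 t) x u = (1 - s) * act w1 x u + s * act w2 x u.
  rewrite (actE T_gt0 c g HV x sab su) (actE T_gt0 c g HV x sw1 su) (actE T_gt0 c g HV x sw2 su).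
  rewrite (ipC T u (fun t => _ + _)) (ipDl sa sb su) (ipZl _ sw1 su) (ipZl _ sw2 su) (ipC T w1 u) (ipC T w2 u).
  have alg (p q r a b : R) : p + ((1 - s) * q + s * r) + a + b = (1 - s) * (p + q + a + b) + s * (p + r + a + b) by ring.
  exact: alg.
by apply: lerD; apply: ler_wpM2l => //; rewrite subr_ge0.
Qed.

(** Potential cost of staying at 0, the reference from which Lipschitz bounds control all others. *)
Definition rest_potential := iD (fun t => V (path 0 (fun=> 0) t)) + g (path 0 (fun=> 0) T).

Lemma value_upper w x : sqint w ->
  value w x <= - (nrm w ^+ 2 / (2 * c)) + rest_potential + M * (T + 1) * (`|x| + nrm w / c * Num.sqrt T).
Proof.
move=> sw; have su := sqintZ (- c^-1) sw; have s0 := sqint_cst T_gt0 (0 : R).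
apply: le_trans (value_le T_gt0 c_gt0 HV Hg x sw su) _.
have hp := @potential_lipschitz _ _ T_gt0 _ _ _ HV Hg x 0 (fun t => - c^-1 * w t) (fun=> 0)
  (`|x| + nrm w / c * Num.sqrt T) su s0.
rewrite (actE T_gt0 c g HV x sw su) (ipZl _ sw sw) (ipZl _ sw su) (ipC T w) (ipZl _ sw sw) -!nrm_sqr.
have -> : c / 2 * (- c^-1 * (- c^-1 * nrm w ^+ 2)) + - c^-1 * nrm w ^+ 2 = - (nrm w ^+ 2 / (2 * c)).
  by field; rewrite lt0r_neq0.
have alg (a p q r s : R) : p + q <= r + s -> a + p + q <= a + r + s by rewrite -!addrA lerD2l.
apply: alg; apply: hp => t _.
rewrite !pathE add0r (_ : prim (fun=> 0) t = 0); last first.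
  by apply: iD_eq0 => // r _; rewrite mul0r.
rewrite subr0; apply: le_trans (ler_normD _ _) _; rewrite lerD2l.
apply: le_trans (prim_le T_gt0 t su) _.
by rewrite nrmZ // normrN gtr0_norm ?invr_gt0 // [c^-1 * _]mulrC.
Qed.

Lemma value_superdifferential w h x u : sqint w -> sqint h -> optimal w x u ->
  value (fun t => w t + h t) x <= value w x + ip u h.
Proof.
move=> sw sh [su <-]; rewrite -act_add //.
exact: (value_le T_gt0 c_gt0 HV Hg x (sqintD sw sh) su).
Qed.

(** Bounds [speed_bound w] plus [speed_bound] of the perturbation w + h when [h] has norm at most 1,
    uniformly in [x]. *)
Definition speed_gap w := 2 * (costate_bound T c M * Num.sqrt T) + (2 * nrm w + 1) / c.

Lemma speed_gap_ge0 w : 0 <= speed_gap w.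
Proof.
have M0 := M_ge0 HV; rewrite /speed_gap /costate_bound addr_ge0 //.
  by rewrite mulr_ge0 // mulr_ge0 ?sqrtr_ge0 // divr_ge0 ?(ltW c_gt0) // mulr_ge0 // addr_ge0 // ltW.
by rewrite divr_ge0 ?(ltW c_gt0) // addr_ge0 // mulr_ge0 // nrm_ge0.
Qed.

(** [v] is optimal for the perturbed problem. Since [act] is affine in [w], the same product of
    norms bounds both its excess cost in the original problem and the linearisation error. *)
Lemma perturbed_optimal w h x u : sqint w -> sqint h -> nrm h <= 1 -> optimal w x u ->
  exists v, [/\ sqint v, nrm (fun t => v t - u t) <= speed_gap w,
    act w x v <= value w x + nrm (fun t => v t - u t) * nrm h &
    value w x + ip u h - value (fun t => w t + h t) x <= nrm (fun t => v t - u t) * nrm h].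
Proof.
move=> sw sh h1 ou; have swh := sqintD sw sh.
have [v ov] := exists_optimal T_gt0 c_gt0 HV Hg x swh; have [sv ev] := ov; have [su eu] := ou.
have svu := sqintB sv su.
have Ea := act_add x sw sh sv.
have ipb : ip u h - ip v h <= nrm (fun t => v t - u t) * nrm h.
  have := cauchy_schwarz svu sh; rewrite (ipBl sv su sh) ler_norml => /andP[+ _].
  by rewrite lerNl opprB.
have hd := value_superdifferential sw sh ou.
have hv := value_le T_gt0 c_gt0 HV Hg x sw sv.
exists v; split=> //.
- apply: le_trans (nrmB sv su) _.
  apply: le_trans (lerD (optimal_nrm T_gt0 c_gt0 HV Hg swh ov) (optimal_nrm T_gt0 c_gt0 HV Hg sw ou)) _.
  have hn : nrm (fun t => w t + h t) / c <= (nrm w + 1) / c.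
    rewrite ler_pM2r ?invr_gt0 //; apply: le_trans (nrmD sw sh) _; by rewrite lerD2l.
  rewrite /speed_bound /speed_gap; move: hn; set a := _ / c.
  rewrite [(nrm w + 1) / c]mulrDl [(2 * _ + 1) / c]mulrDl -mulrA; set b := nrm w / c.
  by move: (costate_bound T c M * _) (1 / c) => p q; lra.
- have alg (p q r s k n : R) : p = q + s -> p <= k + r -> r - s <= n -> q <= k + n by move=> *; lra.
  by apply: alg Ea _ ipb; rewrite ev.
- have alg (p q r s k n : R) : p = q + s -> k <= q -> r - s <= n -> k + r - p <= n by move=> *; lra.
  by rewrite -ev; apply: alg Ea hv ipb.
Qed.

Lemma value_gap_le w h x u : sqint w -> sqint h -> nrm h <= 1 -> optimal w x u ->
  value w x + ip u h - value (fun t => w t + h t) x <= speed_gap w * nrm h.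
Proof.
move=> sw sh h1 ou; have [v [_ vg _ H]] := perturbed_optimal sw sh h1 ou.
by apply: le_trans H _; rewrite ler_wpM2r ?nrm_ge0.
Qed.

(** Bootstrap: the crude bound [speed_gap] makes [v] a near-minimiser for small [h]; [well_posed]
    then makes [v - u] small, and the error becomes o(|h|). The opposite inequality is
    [value_superdifferential]. *)
Lemma value_frechet w x u (e : R) : sqint w -> uniquely_optimal w x u -> 0 < e ->
  exists2 r, 0 < r & forall h, sqint h -> nrm h < r ->
    value w x + ip u h - value (fun t => w t + h t) x <= e * nrm h.
Proof.
move=> sw uu e0; have [ou _] := uu.
have [d d0 Hd] := well_posed T_gt0 c_gt0 HV Hg sw uu e0.
have C1 : 0 < speed_gap w + 1 by rewrite ltr_wpDl // speed_gap_ge0.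
exists (Num.min 1 (d / (speed_gap w + 1))); first by rewrite lt_min ltr01 divr_gt0.
move=> h sh; rewrite lt_min => /andP[/ltW h1 hd].
have [v [sv vg va H]] := perturbed_optimal sw sh h1 ou.
apply: le_trans H _; rewrite ler_wpM2r ?nrm_ge0 //; apply: Hd => //.
apply: le_trans va _; rewrite lerD2l; apply: le_trans (ler_wpM2r (nrm_ge0 _ _) vg) _.
apply: le_trans (ler_wpM2l (speed_gap_ge0 w) (ltW hd)) _.
by rewrite mulrCA ler_piMr ?(ltW d0) // ler_pdivrMr // mul1r lerDl.
Qed.

Lemma minimizer_optimal w x z : sqint w -> minimizer T c V g w x z ->
  exists2 u, optimal w x u & forall t, 0 <= t <= T -> z t = path x u t.
Proof.
move=> sw [[Hz z0] za]; have [u su zE] := H1_primitive T_gt0 Hz.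
have zp t : 0 <= t <= T -> z t = path x u t by move=> tT; rewrite zE // z0.
exists u => //; split=> //; apply: EFin_inj.
by rewrite -(phi_value T_gt0 c_gt0 HV Hg x sw) -za (action_prim T_gt0 c g (V_continuous HV) sw su zp).
Qed.

Lemma optimal_minimizer w x u : sqint w -> optimal w x u -> minimizer T c V g w x (path x u).
Proof.
move=> sw [su ev]; split; first by split; [exact: H1_prim|rewrite !pathE prim0 // addr0].
rewrite (phi_value T_gt0 c_gt0 HV Hg x sw) -ev.
by rewrite (action_prim (x := x) T_gt0 c g (V_continuous HV) sw su).
Qed.

(** The costate is Lipschitz, so its primitive is differentiable at every interior time; the only
    condition on [t] concerns [prim w]. Hence one null set of times serves all [x], although there
    are uncountably many. *)
Lemma optimal_derive1 w x u z t : sqint w -> optimal w x u ->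
  (forall s, 0 <= s <= T -> z s = path x u s) -> D t ->
  derivable (prim w) t 1 -> derive1 (prim w) t = w t -> derive1 z t = costate x u t - w t / c.
Proof.
move=> sw ou zE Dt dw ew; have [su _] := ou.
have sk : sqint (costate x u) by apply: costate_sqint; try exact: HV.
have sf : sqint (force x u) by apply: force_sqint; try exact: HV.
have d1 : is_derive t 1 (prim (costate x u)) (costate x u t).
  apply: (@is_derive_prim_lipschitz _ _ T_gt0 _ (M / c)) => // s _.
  rewrite !costateE !tailE //.
  have -> : - (g' (path x u T) + (iD (force x u) - prim (force x u) s)) / c -
    - (g' (path x u T) + (iD (force x u) - prim (force x u) t)) / c =
    (prim (force x u) s - prim (force x u) t) / c.
    by move: (g' _) (iD _) (prim _ s) (prim _ t) => *; ring.
  rewrite normrM normfV (gtr0_norm c_gt0) mulrAC ler_pM2r ?invr_gt0 //.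
  by apply: prim_lipschitz => // r _; case: HV => _ b _ _ _; exact: b.
have d2 : is_derive t 1 (prim w) (w t) by apply: DeriveDef => //; rewrite -derive1E.
have d3 : is_derive t 1 (fun s => x + prim (costate x u) s - c^-1 * prim w s)
    (0 + costate x u t - c^-1 * w t).
  have d4 := @is_deriveZ _ _ _ (prim w) c^-1 t 1 (w t) d2.
  have d5 := @is_deriveD _ _ _ _ _ t 1 _ _ (is_derive_cst x t 1) d1.
  exact: (@is_deriveB _ _ _ _ _ t 1 _ _ d5 d4).
have tT : 0 < t < T by move: Dt; rewrite /= in_itv.
rewrite add0r mulrC in d3.
rewrite derive1E; suff [_ ->] : is_derive t 1 z (costate x u t - w t / c) by [].
apply: near_eq_is_derive d3; have : \forall s \near t, s \in `]0, T[.
  by apply: near_in_itvoo; rewrite in_itv.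
apply: filterS => s; rewrite in_itv /= => /andP[/ltW s0 /ltW sT].
rewrite zE ?s0 // !pathE (optimal_prim T_gt0 c_gt0 HV Hg s sw ou).
by rewrite addrA [c^-1 * _]mulrC.
Qed.

Section Density.
Variables (rho : R -> R) (Hrho : compactly_supported_density rho).
Notation E := (E rho).
Notation rintg := (rintg rho).

Lemma rintg_value w : sqint w -> rintg (value w).
Proof.
move=> sw; have M0 := M_ge0 HV.
have MT : 0 <= M * (T + 1) by rewrite mulr_ge0 // addr_ge0 // ltW.
apply: (@rintg_growth _ _ Hrho _ `|value w 0| (M * (T + 1))) => //.
  by apply: continuous_measurable_fun; exact: value_continuous.
move=> x; have := value_lipschitz x 0 sw; rewrite subr0 => h.
rewrite -[value w x](subrK (value w 0)) addrC; apply: le_trans (ler_normD _ _) _.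
by rewrite lerD2l.
Qed.

Lemma J_value w : sqint w ->
  mu.-integrable [set: X] (fun x => (phi T c V g w x * (rho x)%:E)%E) /\
  J T c V g rho w = (E (value w))%:E.
Proof.
move=> sw.
have -> : (fun x => (phi T c V g w x * (rho x)%:E)%E) = (fun x => (value w x * rho x)%:E).
  by apply/funext => x; rewrite (phi_value T_gt0 c_gt0 HV Hg x sw).
split; first exact: rintg_value.
rewrite /J EE /Rintegral fineK.
  by apply: eq_integral => x _; rewrite (phi_value T_gt0 c_gt0 HV Hg x sw).
by apply: integrable_fin_num => //; exact: rintg_value.
Qed.

Variables (w : R -> R) (sw : sqint w).
Variables (u_ : R -> R -> R) (ou : forall x, optimal w x (u_ x)).
Hypothesis mu_ : measurable_fun (`[0, T] `*` [set: X] : set (X * X))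
  (fun p => path p.2 (u_ p.2) p.1).
Notation d := (gradient T c V g w rho u_).

(** The radius in [value_frechet] depends on [x], so it cannot be integrated directly. A failure
    yields a sequence [h_] tending to 0 whose quotients [q] lie between 0 and [speed_gap w] and tend
    to 0 off a countable set; dominated convergence contradicts E (q n) > e. *)
Lemma E_value_frechet (e : R) : 0 < e -> exists2 r, 0 < r & forall h, sqint h -> nrm h < r ->
  `|E (value (fun t => w t + h t)) - E (value w) - ip d h| <= e * nrm h.
Proof.
move=> e0; apply: contrapT => H.
have iv := rintg_value sw.
pose gap h x := value w x + ip (u_ x) h - value (fun t => w t + h t) x.
have gap_rintg h : sqint h -> rintg (gap h).
  move=> sh; have [ih _] := E_ip T_gt0 c_gt0 HV Hg sw Hrho ou mu_ sh.
  have := rintgD (rintgD iv ih) (rintgZ (-1) (rintg_value (sqintD sw sh))).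
  by apply: eq_integrable => // x _ /=; rewrite mulN1r.
have E_gap h : sqint h -> E (gap h) = - (E (value (fun t => w t + h t)) - E (value w) - ip d h).
  move=> sh; have [ih <-] := E_ip T_gt0 c_gt0 HV Hg sw Hrho ou mu_ sh.
  have iwh := rintg_value (sqintD sw sh).
  rewrite (_ : E (gap h) = E (fun x => value w x + ip (u_ x) h + -1 * value (fun t => w t + h t) x)); last first.
    by apply: eq_E => x; rewrite mulN1r.
  rewrite (ED (rintgD iv ih) (rintgZ _ iwh)) (ED iv ih) (EZ _ iwh).
  by move: (E _) (E _) (E _) => p q r; ring.
have gap_ge0 h x : sqint h -> 0 <= gap h x.
  by move=> sh; rewrite /gap subr_ge0; exact: value_superdifferential.
have /choice[h_ hP] : forall n : nat, exists h, [/\ sqint h, nrm h < n.+1%:R^-1 & e * nrm h < E (gap h)].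
  move=> n; apply: contrapT => h; apply: H; exists n.+1%:R^-1; first by rewrite invr_gt0.
  move=> k sk kn; rewrite leNgt; apply/negP => ek; apply: h; exists k; split=> //.
  rewrite -normrN -E_gap // ger0_norm // in ek.
  have i0 : rintg (fun=> 0) by apply: (@rintg_bounded _ _ Hrho _ 0) => // x; rewrite normr0.
  by rewrite -(E_cst Hrho 0); apply: le_E => //; [exact: gap_rintg|move=> x; exact: gap_ge0].
have sh n : sqint (h_ n) by case: (hP n).
have h1 n : nrm (h_ n) <= 1.
  have [_ /ltW + _] := hP n; move=> /le_trans; apply.
  by rewrite invf_le1 // ler1n.
have gap_le n x : gap (h_ n) x <= speed_gap w * nrm (h_ n) by exact: value_gap_le.
(* If the norm were zero, [gap_le] would make the average gap nonpositive, against the choice of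
   [h_ n]. *)
have hpos n : 0 < nrm (h_ n).
  rewrite lt_neqAle nrm_ge0 andbT eq_sym; apply/negP => /eqP hn0.
  have [_ _] := hP n; rewrite hn0 mulr0 ltNge => /negP; apply.
  have i0 : rintg (fun=> 0) by apply: (@rintg_bounded _ _ Hrho _ 0) => // x; rewrite normr0.
  rewrite -[leRHS](E_cst Hrho 0); apply: le_E => //; first exact: gap_rintg.
  by move=> x; have := gap_le n x; rewrite hn0 mulr0.
pose q n x := (nrm (h_ n))^-1 * gap (h_ n) x.
have iq n : rintg (q n) by apply: rintgZ; exact: gap_rintg.
have q0 n x : 0 <= q n x by rewrite mulr_ge0 ?invr_ge0 ?nrm_ge0 // gap_ge0.
have qle n x : q n x <= speed_gap w.
  by rewrite /q mulrC ler_pdivrMr.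
have Eq n : e < E (q n).
  rewrite (EZ _ (gap_rintg _ (sh n))) mulrC ltr_pdivlMr //.
  by case: (hP n).
have qcvg x : uniquely_optimal w x (u_ x) -> (q n x * rho x)%:E @[n --> \oo] --> 0%:E.
  move=> ux; apply: cvg_EFin; first by apply: nearW.
  apply/cvgrPdist_le => a a0; have r0 := rho_ge0 Hrho x.
  have r1 : 0 < rho x + 1 by rewrite ltr_wpDl.
  have [r rp Hr] := value_frechet sw ux (divr_gt0 a0 r1).
  have [N _ Nr] := near_infty_natSinv_lt (PosNum rp).
  exists N => // n Nn /=; rewrite sub0r normrN (ger0_norm (mulr_ge0 (q0 n x) r0)).
  have qa : q n x <= a / (rho x + 1).
    rewrite /q mulrC ler_pdivrMr //; apply: Hr => //.
    by have [_ hn _] := hP n; apply: lt_trans hn (Nr n Nn).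
  apply: le_trans (ler_wpM2r r0 qa) _.
  by rewrite mulrAC -mulrA ler_piMr ?(ltW a0) // ler_pdivrMr // mul1r lerDl.
have cS := nonunique_countable T_gt0 c_gt0 HV Hg sw ou.
have [||||| _ _] := @dominated_convergence _ X R mu setT measurableT
   (fun n x => (q n x * rho x)%:E) (fun=> 0%:E) (fun x => (speed_gap w * rho x)%:E).
- by move=> n; exact: (measurable_int mu (iq n)).
- exact: measurable_cst.
- exists [set x | ~ uniquely_optimal w x (u_ x)]; split.
  + exact: countable_measurable.
  + exact: countable_lebesgue_measure0.
  + by move=> x /=; apply: contra_not => ux _; exact: qcvg.
- have := integrableZl measurableT (speed_gap w) (rho_integrable Hrho); exact.
- apply: aeW => x n _; have r0 := rho_ge0 Hrho x.
  by rewrite /= lee_fin (ger0_norm (mulr_ge0 (q0 n x) r0)) ler_wpM2r.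
rewrite integral0 => cv.
have {}cv : fine \o (fun n => \int[mu]_x (q n x * rho x)%:E)%E @ \oo --> (0 : R) by exact: fine_cvg cv.
move/cvgrPdist_lt : cv => /(_ e e0)[N _ HN].
have := HN N (leqnn N); rewrite /= sub0r normrN -/(E (q N)).
by have := Eq N; move=> + /(le_lt_trans (ler_norm _)); rewrite -[fine _]/(E (q N)) => /lt_trans h /h; rewrite ltxx.
Qed.

(** Two selections give the same path off a countable set of [x]. The gradient, fixed with one
    selection, can thus be compared with any other, at every time. *)
Lemma gradient_unique (v_ : R -> R -> R) t : (forall x, optimal w x (v_ x)) ->
  measurable_fun (`[0, T] `*` [set: X] : set (X * X)) (fun p => path p.2 (v_ p.2) p.1) ->
  gradient T c V g w rho v_ t = d t.
Proof.
move=> ov mv; have cS := nonunique_countable T_gt0 c_gt0 HV Hg sw ou.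
have TT : 0 <= T <= T by rewrite lexx ltW.
have EF F (s : R) : continuous F -> (forall y, `|F y| <= M) -> 0 <= s <= T ->
    E (fun x => F (path x (v_ x) s)) = E (fun x => F (path x (u_ x) s)).
  move=> cF FM sT; apply: (E_countable (S := [set x | ~ uniquely_optimal w x (u_ x)])) => //.
  - exact: (rintg_comp_path Hrho mv cF FM).
  - exact: (rintg_comp_path Hrho mu_ cF FM).
  move=> x /contrapT[_ ux]; congr F.
  exact: (optimal_path_unique T_gt0 c_gt0 HV Hg sw (ov x) (ou x) (ux _ (ov x))).
have e1 : mean_end T g rho v_ = mean_end T g rho u_.
  by apply: EF => //; [exact: (V'_continuous Hg)|case: Hg].
have e2 : tail (mean_force T V rho v_) t = tail (mean_force T V rho u_) t.
  apply: eq_iD => s; rewrite /= in_itv /= => /andP[/ltW s0 /ltW sT].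
  have ef : mean_force T V rho v_ s = mean_force T V rho u_ s.
    by apply: EF; [exact: (V'_continuous HV)|case: HV|rewrite s0].
  exact: (congr1 (fun y => y * after t s) ef).
exact: (congr2 (fun p q => - (p + q) / c - w t / c) e1 e2).
Qed.

End Density.
End Value.

(** * Finiteness, concavity, upper bound and gradient of the averaged value *)

Theorem proposition3p1 (R : realType) (T c0 : R) (V g rho : R -> R)
    (T_gt0 : 0 < T) (c0_gt0 : 0 < c0)
    (HV : twice_differentiable_bounded V)
    (Hg : twice_differentiable_bounded g)
    (Hrho : compactly_supported_density rho) :
  [/\ (* J is well defined and everywhere finite *)
      forall w : R -> R, L2 T w ->
        (@lebesgue_measure R).-integrable [set: R]
          (fun x => (phi T c0 V g w x * (rho x)%:E)%E) /\
        J T c0 V g rho w \is a fin_num,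
      (* concavity *)
      forall (w1 w2 : R -> R) (s : R), L2 T w1 -> L2 T w2 -> 0 <= s <= 1 ->
        (1 - s) * fine (J T c0 V g rho w1) + s * fine (J T c0 V g rho w2)
        <= fine (J T c0 V g rho (fun t => (1 - s) * w1 t + s * w2 t)),
      (* coercivity, with constants independent of w *)
      exists C1 C2 : R, [/\ 0 < C1, 0 < C2 &
        forall w : R -> R, L2 T w ->
          (J T c0 V g rho w <= (C1 - C2 * norm2 T w ^+ 2)%:E)%E] &
      (* Frechet differentiability and the formula for the gradient *)
      forall w : R -> R, L2 T w ->
        (exists zs : R -> R -> R, borel_selection T c0 V g w zs) /\
        exists d : R -> R,
          frechet_gradient T (fun v => fine (J T c0 V g rho v)) w d /\
          forall zs : R -> R -> R, borel_selection T c0 V g w zs ->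
            {ae (@lebesgue_measure R), forall t, t \in `]0, T[ ->
              (@lebesgue_measure R).-integrable [set: R]
                (fun x => (derive1 (zs^~ x) t * rho x)%:E) /\
              d t = \int[@lebesgue_measure R]_x (derive1 (zs^~ x) t * rho x)}].

Proof.
have [M1 HV1] := twice_differentiable_smooth HV; have [M2 Hg2] := twice_differentiable_smooth Hg.
pose M := Num.max M1 M2.
have SV : smooth_bound M V by apply: smooth_bound_le HV1; rewrite le_max lexx.
have Sg : smooth_bound M g by apply: smooth_bound_le Hg2; rewrite le_max lexx orbT.
have JE w : sqint T w -> J T c0 V g rho w = (E rho (value T c0 V g w))%:E.
  by move=> sw; case: (J_value T_gt0 c0_gt0 SV Sg Hrho sw).
split.
- move=> w /L2_sqint sw; have [iJ ->] := J_value T_gt0 c0_gt0 SV Sg Hrho sw.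
  by split.
- move=> w1 w2 s /L2_sqint sw1 /L2_sqint sw2 s01.
  have sw := sqintD (sqintZ (1 - s) sw1) (sqintZ s sw2).
  rewrite !JE //=.
  have i1 := rintg_value T_gt0 c0_gt0 SV Sg Hrho sw1; have i2 := rintg_value T_gt0 c0_gt0 SV Sg Hrho sw2.
  rewrite -(EZ _ i1) -(EZ _ i2) -(ED (rintgZ _ i1) (rintgZ _ i2)).
  apply: (le_E Hrho); first by apply: rintgD; exact: rintgZ.
    exact: (rintg_value T_gt0 c0_gt0 SV Sg Hrho sw).
  by move=> x; exact: (value_concave T_gt0 c0_gt0 SV Sg x sw1 sw2 s01).
- have alg (p k y z : R) : p + k * (y + z) = p + k * z + k * y by ring.
  have M0 := M_ge0 SV.
  have K0 : 0 <= M * (T + 1) by rewrite mulr_ge0 // addr_ge0 // ltW.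
  have iabs : rintg rho (fun x => `|x|).
    apply: (@rintg_growth _ _ Hrho _ 0 1) => //; last by move=> x; rewrite normr_id add0r mul1r.
    by apply: continuous_measurable_fun; exact: norm_continuous.
  pose m1 := E rho (fun x => `|x|).
  pose a := M * (T + 1) / c0 * Num.sqrt T.
  pose b := `|rest_potential T V g + M * (T + 1) * m1| + 1.
  have b0 : 0 < b by rewrite ltr_wpDl.
  (* [value_upper] has the quadratic term - |w|^2 / (2 c0) and a linear term |w| a. By completing a
     square, half of the former absorbs the latter at the cost c0 a^2, leaving 1 / (4 c0). The + 1
     in [b] makes the constant positive. *)
  exists (b + c0 * a ^+ 2), (1 / (4 * c0)); split.
  + by rewrite ltr_wpDr // mulr_ge0 ?sqr_ge0 // ltW.
  + by rewrite divr_gt0 // mulr_gt0.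
  move=> w /L2_sqint sw; rewrite JE // norm2_nrm // lee_fin.
  have icst k : rintg rho (fun=> k) by apply: (@rintg_bounded _ _ Hrho _ `|k|).
  pose k1 := - (nrm T w ^+ 2 / (2 * c0)) + rest_potential T V g + M * (T + 1) * (nrm T w / c0 * Num.sqrt T).
  have h : E rho (value T c0 V g w) <= k1 + M * (T + 1) * m1.
    rewrite -{1}(E_cst Hrho k1) -(EZ _ iabs) -(ED (icst k1) (rintgZ _ iabs)).
    apply: (le_E Hrho); first exact: (rintg_value T_gt0 c0_gt0 SV Sg Hrho sw).
      by apply: rintgD => //; exact: rintgZ.
    move=> x; apply: le_trans (value_upper T_gt0 c0_gt0 SV Sg x sw) _.
    by rewrite alg.
  apply: le_trans h _; rewrite /k1.
  have h1 : rest_potential T V g + M * (T + 1) * m1 <= b.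
    by apply: le_trans (ler_norm _) _; rewrite lerDl.
  have -> : M * (T + 1) * (nrm T w / c0 * Num.sqrt T) = nrm T w * a by rewrite /a; ring.
  have h2 : 0 <= (nrm T w / 2 - c0 * a) ^+ 2 / c0 by rewrite divr_ge0 ?sqr_ge0 // ltW.
  have E2 : (nrm T w / 2 - c0 * a) ^+ 2 / c0 = nrm T w ^+ 2 / (2 * c0) - 1 / (4 * c0) * nrm T w ^+ 2
      - nrm T w * a + c0 * a ^+ 2 by field; rewrite lt0r_neq0.
  move: h1 h2; rewrite E2; move: (rest_potential T V g) (M * (T + 1) * m1) => p q; lra.
- move=> w /L2_sqint sw.
  have /choice[us ous] : forall x, exists u, optimal T c0 V g w x u.
    by move=> x; exact: (exists_optimal T_gt0 c0_gt0 SV Sg).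
  have mus := optimal_path_measurable T_gt0 c0_gt0 SV Sg sw ous.
  split.
    exists (fun t x => path T x (us x) t); split; first exact: mus.
    by move=> x; exact: (optimal_minimizer T_gt0 c0_gt0 SV Sg).
  pose d := gradient T c0 V g w rho us.
  have sd : sqint T d by exact: (gradient_sqint T_gt0 c0 g SV sw Hrho mus).
  exists d; split.
    split; first exact/L2_sqint.
    move=> e e0; have [r r0 Hr] := E_value_frechet T_gt0 c0_gt0 SV Sg Hrho sw ous mus e0.
    exists r => // h /L2_sqint sh; rewrite (norm2_nrm sh) => hr.
    have := Hr h sh hr; rewrite !JE //; exact: sqintD.
  move=> zs [mzs mins].
  have /choice[v_ vP] : forall x, exists u, optimal T c0 V g w x u /\
      forall t, 0 <= t <= T -> zs t x = path T x u t.
    move=> x; have [u ou uE] := minimizer_optimal T_gt0 c0_gt0 SV Sg sw (mins x).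
    by exists u.
  have ov x : optimal T c0 V g w x (v_ x) by case: (vP x).
  have mv : measurable_fun (`[0, T] `*` [set: measurableTypeR R] : set (measurableTypeR R * measurableTypeR R))
      (fun p => path T p.2 (v_ p.2) p.1).
    apply: eq_measurable_fun mzs => -[t x]; rewrite inE => -[/= tT _].
    by case: (vP x) => _ -> //; move: tT; rewrite in_itv.
  (* The excluded times are those where [prim w] fails to have derivative [w]; neither [zs] nor [x]
     affects them. *)
  have := ftc_ae T_gt0 sw; apply: filterS; first exact: (ae_filter_ringOfSetsType (@lebesgue_measure R)).
  move=> t [dt et]; rewrite in_itv /= => tT.
  have Dt : (`]0, T[%classic : set R) t by rewrite /= in_itv.
  have {}et : derive1 (prim T w) t = w t by rewrite et patchE mem_set.
  have zE x : derive1 (zs^~ x) t = costate T c0 V g x (v_ x) t - w t / c0.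
    by apply: (optimal_derive1 T_gt0 c0_gt0 SV Sg sw (ov x) _ Dt dt et) => s; case: (vP x) => _; apply.
  have [ik Ek] := E_costate T_gt0 SV Sg Hrho ov mv t.
  have ic : rintg rho (fun=> - (w t / c0)) by apply: (@rintg_bounded _ _ Hrho _ `|- (w t / c0)|).
  have -> : (fun x => (derive1 (zs^~ x) t * rho x)%:E) =
     (fun x => ((costate T c0 V g x (v_ x) t + - (w t / c0)) * rho x)%:E).
    by apply/funext => x; rewrite zE.
  split; first exact: (rintgD ik ic).
  have -> : \int[@lebesgue_measure R]_x (derive1 (zs^~ x) t * rho x) =
     E rho (fun x => costate T c0 V g x (v_ x) t + - (w t / c0)).
    by apply: eq_Rintegral => x _; rewrite zE.
  rewrite (ED ik ic) Ek (E_cst Hrho) -/(gradient T c0 V g w rho v_ t).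
  by rewrite (gradient_unique T_gt0 c0_gt0 SV Sg Hrho sw ous mus t ov mv).
Qed.
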